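(* There exists a discrete set $\Lambda\subset\mathbb{R}\times\mathbb{R}$ such that the Gaussian Gabor system $\mathcal{G}_\Lambda=\{\tau_{x,y}\gamma\}_{(x,y)\in\Lambda}$ is complete and minimal in $L^2(\mathbb{R})$ but is not a strong Markushevich basis.
   Context: Let $\gamma(s)=e^{-\pi s^2}$, $s\in\mathbb{R}$, and for $(x,y)\in\mathbb{R}\times\mathbb{R}$ put $\tau_{x,y}\gamma(s)=e^{2\pi i ys}\gamma(s-x)$. For a discrete set $\Lambda\subset\mathbb{R}\times\mathbb{R}$, the Gaussian Gabor system is $\mathcal{G}_\Lambda=\{\tau_{x,y}\gamma\}_{(x,y)\in\Lambda}\subset L^2(\mathbb{R})$. A system of vectors is complete if its closed linear span is the whole space, and minimal if no element of it belongs to the closed linear span of the others. If $\mathcal{G}_\Lambda$ is complete and minimal, there is a unique biorthogonal system $\{h_{x,y}\}_{(x,y)\in\Lambda}\subset L^2(\mathbb{R})$, i.e. $(\tau_{x,y}\gamma,h_{x',y'})=\delta_{x,x'}\delta_{y,y'}$ for $(x,y),(x',y')\in\Lambda$. A complete and minimal system $\mathcal{G}_\Lambda$ is called a strong Markushevich basis (equivalently, hereditarily complete) if every $f\in L^2(\mathbb{R})$ belongs to the closed linear span of $\{(f,h_{x,y})\,\tau_{x,y}\gamma\}_{(x,y)\in\Lambda}$. Equivalently: for every partition of $\Lambda$ into disjoint sets $\Lambda_1,\Lambda_2$, the mixed system $\{\tau_{x,y}\gamma\}_{(x,y)\in\Lambda_2}\cup\{h_{x,y}\}_{(x,y)\in\Lambda_1}$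 is complete in $L^2(\mathbb{R})$. *)

(* Defs.v *)
From HB Require Import structures.
From mathcomp Require Import all_boot all_order all_algebra.
From mathcomp Require Import complex.
From mathcomp Require Import all_classical all_reals all_analysis.

Set Implicit Arguments.
Unset Strict Implicit.
Unset Printing Implicit Defensive.

Import Order.TTheory GRing.Theory Num.Theory.
Import numFieldNormedType.Exports.

Local Open Scope classical_set_scope.
Local Open Scope ring_scope.
Local Open Scope complex_scope.

Section L2.
Context {R : realType}.
Local Notation mu := (@lebesgue_measure R).
Implicit Types f g : R -> R[i].

(* L^2(R; C) is handled through its square-integrable representatives: all
   the notions below only see a function through integrals, hence do not
   distinguish almost everywhere equal functions. *)

Definition norm2 f : \bar R :=
  ('N[mu]_2%:E[(fun s => (Normc.normc (f s))%:E)])%E.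

Definition measurable_cfun f : Prop :=
  measurable_fun setT (fun s => complex.Re (f s)) /\
  measurable_fun setT (fun s => complex.Im (f s)).

Definition L2 : set (R -> R[i]) :=
  [set f | measurable_cfun f /\ (norm2 f < +oo)%E].

(* linear in the first argument, antilinear in the second *)
Definition inner f g : R[i] :=
  (\int[mu]_s complex.Re (f s * (g s)^*)) +i*
  (\int[mu]_s complex.Im (f s * (g s)^*)).

Definition lin_span (S : set (R -> R[i])) : set (R -> R[i]) :=
  [set g | exists (n : nat) (c : 'I_n -> R[i]) (v : 'I_n -> R -> R[i]),
     (forall i, S (v i)) /\ g = (fun s => \sum_(i < n) c i * v i s)].

Definition closed_span (S : set (R -> R[i])) : set (R -> R[i]) :=
  [set f | L2 f /\ forall eps : R, 0 < eps ->
     exists2 g, lin_span S g & (norm2 (fun s => (f s - g s)%R) < eps%:E)%E].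

Section systems.
Context {I : choiceType}.
Implicit Types (J : set I) (e h : I -> R -> R[i]).

Definition complete_system J e : Prop := L2 `<=` closed_span (e @` J).

Definition minimal_system J e : Prop :=
  forall p, J p -> ~ closed_span (e @` (J `\ p)) (e p).

Definition biorthogonal J e h : Prop :=
  (forall p, J p -> L2 (h p)) /\
  (forall p q, J p -> J q -> inner (e p) (h q) = (p == q)%:R).

(* The biorthogonal system of a complete minimal system exists and is unique
   up to almost everywhere equality, so quantifying universally over h is
   speaking of the biorthogonal system. *)
Definition strong_Markushevich_basis J e : Prop :=
  [/\ complete_system J e, minimal_system J e &
      forall h, biorthogonal J e h -> forall f, L2 f ->
        closed_span ((fun p s => inner f (h p) * e p s) @` J) f].

End systems.

Definition gaussian : R -> R[i] := fun s => (expR (- (pi * s ^+ 2)))%:C.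

Definition expi (t : R) : R[i] := cos t +i* sin t.

Definition tf_shift (p : R * R) f : R -> R[i] :=
  fun s => expi (2 * pi * p.2 * s) * f (s - p.1).

Definition gabor (p : R * R) : R -> R[i] := tf_shift p gaussian.

(* Discrete as usual for zero sets of entire functions: no accumulation point
   in the plane.  For index sets of minimal Gaussian Gabor systems this is the
   same as every point being isolated: by the Bargmann transform, all points
   of the set but one are zeros of a nonzero entire function. *)
Definition discrete_set (L : set (R * R)) : Prop := limit_point L = set0.

End L2.

(* Main.v *)
(* Expanding in Hermite functions, the pairing of the atom at a point z of the plane with
   the function attached to a polynomial p is p(z) up to a nonzero factor (Bargmann
   transform), and the norm of that function is the l2 norm of the coefficients of p
   weighted by kap n, where kap n ^ 2 = n! / pi ^ n.

   Two polynomials S and g of the same degree are built in stages, with all zeros of S and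
   of X g simple.  They share a large factor; S has the extra zeros - x_j, and g the extra
   zeros t_j = 4 x_j.  A stage multiplies S by u q (1 + X / x) and g by
   u (1 - (X / t) ^ 2k), where q = (1 - (X / t) ^ 2k) / (1 - X / t), u = 1 + rho X ^ N,
   t = k / sqrt pi, x = t / 4 and N = k ^ 2 - d.  As k grows the weights kap m are
   comparable to a geometric sequence of ratio t for m near k ^ 2, so that rho can be chosen
   to make the following limits exist.  The set Lambda consists of the zeros of all the S.
   - The functions attached to S / ((X - z) S'(z)) converge, for each zero z, to the
     biorthogonal system, which gives minimality.
   - The functions attached to g converge to some G, orthogonal to the atoms at the zeros
     common to S and g.
   - The sums of the atoms at 0 and the t_j with coefficients 1 / (X g)'(t), up to the
     nonzero factors, converge to some F with (F, G) = g(0) / g(0) = 1.  By Lagrange's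
     identity F is orthogonal to the biorthogonal functions of the points - x_j.
   Hence the span of the (F, h_z) e_z is orthogonal to G while F is not.

   After K stages the leading coefficient of S is 4 ^ K times that of g, which makes it large
   enough for completeness: the moments of the Lagrange weights at the zeros of S
   satisfy a linear recurrence that is a contraction in a weighted l1 norm, so that each
   Hermite function is a limit of combinations of the atoms.  The Hermite functions in turn
   span all atoms, and modulated Gaussians are dense by Bernstein approximation in the
   variable sin (e s). *)

Require Import Defs.
From mathcomp Require Import all_boot all_order all_algebra.
From mathcomp Require Import complex separable.
From mathcomp Require Import all_classical all_reals all_analysis.
From mathcomp Require Import measurable_realfun.
From mathcomp Require Import ring lra zify.

Set Implicit Arguments.
Unset Strict Implicit.
Unset Printing Implicit Defensive.

Import Order.TTheory GRing.Theory Num.Theory.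
Import numFieldNormedType.Exports.

Local Open Scope classical_set_scope.
Local Open Scope ring_scope.

(** * Square-integrable complex functions *)

Section complex_modulus.
Context {R : realType}.
Implicit Types z w : R[i].
Local Notation nc := (@Normc.normc R).

(** Two demands conflict: g must stay bounded in the norm of the weights [kap], so that G exists,
    while S must grow, since a limit of S would be a nonzero function orthogonal to all atoms. A
    stage changes the ratio of the leading coefficients only through the pair 1 + X / x, 1 - X / t,
    by t / x = 4. This has to beat the factor 2 lost because the increments of g decay like tau = 1
    / 2 ^ K, and the factor 3/2 allowed for the coefficients of S; what remains is the rate 3/4 of
    completeness. The factor q serves the other limits. At t the derivative of 1 - (X / t) ^ 2k has
    modulus 2k / t instead of 1 / t, and this k outruns the sqrt k of Stirling's formula for kap (k
    ^ 2), so the coefficient of the atom at t is small. The price is a polynomial with 2k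
    coefficients of comparable weighted size, whose norm grows like sqrt (2k); the biorthogonal
    functions, one degree below S, gain 1 / t of order 1 / k and absorb it. The length 2k is of the
    order of the square root of k ^ 2, the range on which the weights are still geometric. *)

Definition sq (z : R[i]) : R := complex.Re z ^+ 2 + complex.Im z ^+ 2.

Lemma sq_ge0 z : 0 <= sq z. Proof. by rewrite addr_ge0 ?sqr_ge0. Qed.

Lemma ncE z : nc z = Num.sqrt (sq z). Proof. by case: z. Qed.

Lemma nc_ge0 z : 0 <= nc z. Proof. by rewrite ncE sqrtr_ge0. Qed.

Lemma nc_sq z : nc z ^+ 2 = sq z. Proof. by rewrite ncE sqr_sqrtr ?sq_ge0. Qed.

Lemma nc_eq0 z : (nc z == 0) = (z == 0).
Proof.
by apply/eqP/eqP => [/Normc.eq0_normc //|->]; rewrite ncE /sq /= expr0n /= addr0 sqrtr0.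
Qed.

Lemma nc_gt0 z : (0 < nc z) = (z != 0).
Proof. by rewrite lt_def nc_eq0 nc_ge0 andbT. Qed.

Lemma nc0 : nc 0 = 0. Proof. by apply/eqP; rewrite nc_eq0. Qed.

Lemma ncM z w : nc (z * w) = nc z * nc w. Proof. exact: Normc.normcM. Qed.

Lemma nc1 : nc 1 = 1. Proof. exact: Normc.normc1. Qed.

Lemma ncX z n : nc (z ^+ n) = nc z ^+ n.
Proof. by elim: n => [|n ih]; rewrite ?expr0 ?nc1 // !exprS ncM ih. Qed.

Lemma ncV z : nc z^-1 = (nc z)^-1. Proof. exact: Normc.normcV. Qed.

Lemma ncN z : nc (- z) = nc z. Proof. exact: normcN. Qed.

Lemma ncD z w : nc (z + w) <= nc z + nc w. Proof. exact: le_normcD. Qed.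

Lemma nc_sum I (r : seq I) (P : pred I) (F : I -> R[i]) :
  nc (\sum_(i <- r | P i) F i) <= \sum_(i <- r | P i) nc (F i).
Proof.
elim/big_ind2: _ => // [|x1 x2 y1 y2 h1 h2]; first by rewrite nc0.
by apply: (le_trans (ncD _ _)); rewrite lerD.
Qed.

Lemma nc_real (x : R) : nc (x%:C)%C = `|x|.
Proof. by rewrite ncE /sq /= expr0n /= addr0 sqrtr_sqr. Qed.

Lemma nc_conj z : nc (z^*)%C = nc z.
Proof. by rewrite !ncE /sq; case: z => a b /=; rewrite sqrrN. Qed.

Lemma ncB_ge z w : nc z - nc w <= nc (z - w).
Proof. by rewrite lerBlDr -{1}(subrK w z) ncD. Qed.

Lemma Re_le_nc z : `|complex.Re z| <= nc z.
Proof. by rewrite ncE -sqrtr_sqr ler_wsqrtr // lerDl sqr_ge0. Qed.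

Lemma Im_le_nc z : `|complex.Im z| <= nc z.
Proof. by rewrite ncE -sqrtr_sqr ler_wsqrtr // lerDr sqr_ge0. Qed.

Lemma conjc_mul z : z * (z^*)%C = ((sq z)%:C)%C.
Proof.
by case: z => a b; rewrite /sq /=; apply/eqP; rewrite eq_complex /=; apply/andP;
  split; apply/eqP; ring.
Qed.

End complex_modulus.

Section L2_space.
Context {R : realType}.
Local Notation mu := (@lebesgue_measure R).
Local Notation nc := (@Normc.normc R).
Implicit Types f g h : R -> R[i].

Lemma mcfunD f g : measurable_cfun f -> measurable_cfun g ->
  measurable_cfun (fun s => f s + g s).
Proof.
move=> [fr fi] [gr gi]; split.
- rewrite (_ : (fun s => _) = (fun s => complex.Re (f s)) \+ (fun s => complex.Re (g s))).
    exact: measurable_funD.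
  by apply/funext => s /=; case: (f s) (g s) => a b [c d].
- rewrite (_ : (fun s => _) = (fun s => complex.Im (f s)) \+ (fun s => complex.Im (g s))).
    exact: measurable_funD.
  by apply/funext => s /=; case: (f s) (g s) => a b [c d].
Qed.

Lemma mcfunM f g : measurable_cfun f -> measurable_cfun g ->
  measurable_cfun (fun s => f s * g s).
Proof.
move=> [fr fi] [gr gi]; split.
- rewrite (_ : (fun s => _) = (fun s => complex.Re (f s) * complex.Re (g s)) \-
      (fun s => complex.Im (f s) * complex.Im (g s))).
    by apply: measurable_funB; exact: measurable_funM.
  by apply/funext => s /=; case: (f s) (g s) => a b [c d].
- rewrite (_ : (fun s => _) = (fun s => complex.Re (f s) * complex.Im (g s)) \+
      (fun s => complex.Im (f s) * complex.Re (g s))).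
    by apply: measurable_funD; exact: measurable_funM.
  by apply/funext => s /=; case: (f s) (g s) => a b [c d].
Qed.

Lemma mcfun_cst (c : R[i]) : measurable_cfun (fun _ : R => c).
Proof. by split; exact: measurable_cst. Qed.

Lemma mcfun_real (u : R -> R) : measurable_fun setT u ->
  measurable_cfun (fun s => ((u s)%:C)%C).
Proof. by move=> mu_; split => //; exact: measurable_cst. Qed.

Lemma mcfun_conj f : measurable_cfun f -> measurable_cfun (fun s => ((f s)^*)%C).
Proof.
move=> [fr fi]; split.
- by rewrite (_ : (fun s => _) = (fun s => complex.Re (f s)))//; apply/funext => s; case: (f s).
- rewrite (_ : (fun s => _) = \- (fun s => complex.Im (f s))); first exact: measurable_funN.
  by apply/funext => s /=; case: (f s).
Qed.

Lemma mcfun_sq f : measurable_cfun f -> measurable_fun setT (fun s => sq (f s)).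
Proof. by move=> [fr fi]; apply: measurable_funD; apply: measurable_funX. Qed.

Lemma norm2E f : norm2 f = ((\int[mu]_s (sq (f s))%:E) `^ 2^-1)%E.
Proof.
rewrite /norm2 unlock /=; congr (_ `^ _)%E; apply: eq_integral => s _.
by rewrite ger0_norm ?nc_ge0// powR_mulrn ?nc_ge0// nc_sq.
Qed.

Lemma norm2_lty f : (norm2 f < +oo)%E <-> (\int[mu]_s (sq (f s))%:E < +oo)%E.
Proof.
rewrite norm2E; split => h; last first.
  have : (0 <= \int[mu]_s (sq (f s))%:E)%E by apply: integral_ge0 => s _; rewrite lee_fin sq_ge0.
  by case: (\int[mu]_s _)%E h => //= r _ _; rewrite ltry.
rewrite ltNge; apply/negP; rewrite leye_eq => /eqP E; move: h; rewrite E.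
by rewrite poweRyr ?ltxx// invr_neq0.
Qed.

Lemma L2P f : L2 f <-> measurable_cfun f /\
  mu.-integrable setT (fun s => (sq (f s))%:E).
Proof.
split=> [[mf /norm2_lty lf]|[mf /integrableP[_ fi]]]; split => //.
- apply/integrableP; split; first by apply/measurable_EFinP; exact: mcfun_sq.
  by under eq_integral => s _ do rewrite gee0_abs ?lee_fin ?sq_ge0//.
- move: fi; under eq_integral => s _ do rewrite gee0_abs ?lee_fin ?sq_ge0//.
  by move/norm2_lty.
Qed.

Lemma L2m f : L2 f -> measurable_cfun f. Proof. by case. Qed.

Lemma L2_dom f g : measurable_cfun f -> L2 g -> (forall s, sq (f s) <= sq (g s)) -> L2 f.
Proof.
move=> mf /L2P[mg gi] fg; apply/L2P; split => //.
apply: le_integrable gi => //; first by apply/measurable_EFinP; exact: mcfun_sq.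
by move=> s _; rewrite /= !ger0_norm ?sq_ge0// lee_fin.
Qed.

Lemma sqD_le (z w : R[i]) : sq (z + w) <= 2 * (sq z + sq w).
Proof.
case: z w => a b [c d]; rewrite /sq /= -subr_ge0.
have -> : 2 * (a ^+ 2 + b ^+ 2 + (c ^+ 2 + d ^+ 2)) - ((a + c) ^+ 2 + (b + d) ^+ 2)
  = (a - c) ^+ 2 + (b - d) ^+ 2 by ring.
exact: sq_ge0 ((a-c) +i* (b-d))%C.
Qed.

Lemma sqM (z w : R[i]) : sq (z * w) = sq z * sq w.
Proof. by rewrite -!nc_sq ncM exprMn. Qed.

Lemma L2D f g : L2 f -> L2 g -> L2 (fun s => f s + g s).
Proof.
move=> /L2P[mf fi] /L2P[mg gi]; apply/L2P; split; first exact: mcfunD.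
have H : mu.-integrable setT (fun s => 2%:E * ((sq (f s))%:E + (sq (g s))%:E))%E.
  by apply: integrableZl => //; exact: integrableD.
apply: (le_integrable measurableT) H.
  by apply/measurable_EFinP; apply: mcfun_sq; exact: mcfunD.
move=> s _; rewrite /= !ger0_norm ?sq_ge0// ?lee_fin ?sqD_le//.
by rewrite mulr_ge0// addr_ge0// sq_ge0.
Qed.

Lemma L2Z (c : R[i]) f : L2 f -> L2 (fun s => c * f s).
Proof.
move=> /L2P[mf fi]; apply/L2P; split; first by apply: mcfunM => //; exact: mcfun_cst.
under eq_fun do rewrite sqM EFinM.
exact: integrableZl.
Qed.

Lemma L20 : L2 (fun _ : R => 0 : R[i]).
Proof.
apply/L2P; split; first exact: mcfun_cst.
under eq_fun do rewrite /sq /= expr0n addr0.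
exact: integrable0.
Qed.

Lemma L2B f g : L2 f -> L2 g -> L2 (fun s => f s - g s).
Proof.
move=> Lf Lg; rewrite (_ : (fun s => _) = (fun s => f s + (-1) * g s)).
  by apply: L2D => //; exact: L2Z.
by apply/funext => s; rewrite mulN1r.
Qed.

Lemma L2_sum I (r : seq I) (P : pred I) (F : I -> R -> R[i]) :
  (forall i, P i -> L2 (F i)) -> L2 (fun s => \sum_(i <- r | P i) F i s).
Proof.
move=> LF; elim: r => [|i r ih].
  by under eq_fun do rewrite big_nil; exact: L20.
case: (boolP (P i)) => Pi; under eq_fun do rewrite big_cons ?Pi ?(negbTE Pi).
  by apply: L2D => //; exact: LF.
by [].
Qed.

Lemma L2_Re_int f g : L2 f -> L2 g ->
  mu.-integrable setT (EFin \o (fun s => complex.Re (f s * ((g s)^*)%C))).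
Proof.
move=> /L2P[mf fi] /L2P[mg gi].
apply: (le_integrable measurableT) (integrableD measurableT fi gi).
  by apply/measurable_EFinP; have [] := mcfunM mf (mcfun_conj mg).
move=> s _; rewrite /= lee_fin [leRHS]ger0_norm; last by apply: addr_ge0; exact: sq_ge0.
apply: le_trans (Re_le_nc _) _; rewrite ncM nc_conj -!nc_sq.
have : 0 <= (nc (f s) - nc (g s)) ^+ 2 + nc (f s) ^+ 2 + nc (g s) ^+ 2.
  by rewrite !addr_ge0 ?sqr_ge0.
rewrite sqrrB; have := nc_ge0 (f s); have := nc_ge0 (g s); nra.
Qed.

Lemma L2_Im_int f g : L2 f -> L2 g ->
  mu.-integrable setT (EFin \o (fun s => complex.Im (f s * ((g s)^*)%C))).
Proof.
move=> /L2P[mf fi] /L2P[mg gi].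
apply: (le_integrable measurableT) (integrableD measurableT fi gi).
  by apply/measurable_EFinP; have [] := mcfunM mf (mcfun_conj mg).
move=> s _; rewrite /= lee_fin [leRHS]ger0_norm; last by apply: addr_ge0; exact: sq_ge0.
apply: le_trans (Im_le_nc _) _; rewrite ncM nc_conj -!nc_sq.
have : 0 <= (nc (f s) - nc (g s)) ^+ 2 + nc (f s) ^+ 2 + nc (g s) ^+ 2.
  by rewrite !addr_ge0 ?sqr_ge0.
rewrite sqrrB; have := nc_ge0 (f s); have := nc_ge0 (g s); nra.
Qed.

Lemma innerDl f g h : L2 f -> L2 g -> L2 h ->
  inner (fun s => f s + g s) h = inner f h + inner g h.
Proof.
move=> Lf Lg Lh; apply/eqP; rewrite eq_complex /=; apply/andP; split; apply/eqP.
- rewrite -RintegralD//; [|exact: L2_Re_int|exact: L2_Re_int].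
  by apply: eq_Rintegral => s _; rewrite mulrDl; case: (_ * _) (_ * _) => a b [c d].
- rewrite -RintegralD//; [|exact: L2_Im_int|exact: L2_Im_int].
  by apply: eq_Rintegral => s _; rewrite mulrDl; case: (_ * _) (_ * _) => a b [c d].
Qed.

Lemma innerZl c f g : L2 f -> L2 g -> inner (fun s => c * f s) g = c * inner f g.
Proof.
move=> Lf Lg; rewrite [RHS]/GRing.mul /=; case: c => a b.
have rI := L2_Re_int Lf Lg; have iI := L2_Im_int Lf Lg.
have Z (r : R) u : mu.-integrable setT (EFin \o u) ->
    mu.-integrable setT (EFin \o (fun s => r * u s)).
  by move=> ui; rewrite /comp; under eq_fun do rewrite EFinM; exact: integrableZl.
apply/eqP; rewrite eq_complex /=; apply/andP; split; apply/eqP.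
- rewrite -!RintegralZl// -RintegralB//; [|exact: Z|exact: Z].
  by apply: eq_Rintegral => s _; rewrite -mulrA; case: (f s * _).
- rewrite -!RintegralZl// -RintegralD//; [|exact: Z|exact: Z].
  by apply: eq_Rintegral => s _; rewrite -mulrA; case: (f s * _).
Qed.

Lemma inner_conj f g : L2 f -> L2 g -> inner g f = ((inner f g)^*)%C.
Proof.
move=> Lf Lg; apply/eqP; rewrite eq_complex /=; apply/andP; split; apply/eqP.
- by apply: eq_Rintegral => s _; case: (f s) (g s) => a b [c d] /=; ring.
- rewrite -mulN1r -RintegralZl//; last exact: L2_Im_int.
  by apply: eq_Rintegral => s _; case: (f s) (g s) => a b [c d] /=; ring.
Qed.

Lemma innerDr f g h : L2 f -> L2 g -> L2 h ->
  inner h (fun s => f s + g s) = inner h f + inner h g.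
Proof.
move=> Lf Lg Lh; rewrite inner_conj//; last exact: L2D.
by rewrite innerDl// rmorphD /= (inner_conj Lf Lh) (inner_conj Lg Lh).
Qed.

Lemma innerZr c f g : L2 f -> L2 g -> inner f (fun s => c * g s) = (c^*)%C * inner f g.
Proof.
move=> Lf Lg; rewrite inner_conj//; last exact: L2Z.
by rewrite innerZl// rmorphM /= (inner_conj Lg Lf).
Qed.

Lemma Rintegral0c : \int[mu]_s (0 : R) = 0.
Proof. by rewrite /Rintegral integral0. Qed.

Lemma inner0l f : inner (fun _ => 0) f = 0.
Proof.
apply/eqP; rewrite eq_complex /=; apply/andP; split; apply/eqP;
by rewrite -[RHS]Rintegral0c; apply: eq_Rintegral => s _; rewrite mul0r.
Qed.

Lemma inner_suml I (r : seq I) (F : I -> R -> R[i]) f : L2 f ->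
  (forall i, L2 (F i)) -> inner (fun s => \sum_(i <- r) F i s) f = \sum_(i <- r) inner (F i) f.
Proof.
move=> Lf LF; elim: r => [|i r ih].
  by rewrite big_nil -[RHS](inner0l f); congr inner; apply/funext => s; rewrite big_nil.
rewrite big_cons -ih -innerDl//; last exact: L2_sum.
by congr inner; apply/funext => s; rewrite big_cons.
Qed.

Definition nrm f : R := Num.sqrt (\int[mu]_s sq (f s)).

Lemma nrm_ge0 f : 0 <= nrm f. Proof. exact: sqrtr_ge0. Qed.

Lemma int_sq_ge0 f : 0 <= \int[mu]_s sq (f s).
Proof. by apply: Rintegral_ge0 => s _; exact: sq_ge0. Qed.

Lemma nrm_sq f : nrm f ^+ 2 = \int[mu]_s sq (f s).
Proof. by rewrite sqr_sqrtr// int_sq_ge0. Qed.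

Lemma inner_self f : L2 f -> inner f f = ((nrm f ^+ 2)%:C)%C.
Proof.
move=> Lf; rewrite nrm_sq; apply/eqP; rewrite eq_complex /=; apply/andP; split; apply/eqP.
- by apply: eq_Rintegral => s _; rewrite conjc_mul.
- rewrite -[RHS]Rintegral0c.
  by apply: eq_Rintegral => s _; rewrite conjc_mul.
Qed.

Lemma norm2_nrm f : L2 f -> norm2 f = (nrm f)%:E.
Proof.
move=> /L2P[mf fi]; rewrite norm2E /nrm.
have F : (\int[mu]_s (sq (f s))%:E)%E = (\int[mu]_s sq (f s))%:E.
  by rewrite /Rintegral fineK//; exact: integrable_fin_num.
by rewrite F poweR_EFin powR12_sqrt// int_sq_ge0.
Qed.

End L2_space.

Section L2_norm.
Context {R : realType}.
Local Notation mu := (@lebesgue_measure R).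
Local Notation nc := (@Normc.normc R).
Implicit Types f g h : R -> R[i].

Lemma nrmZ (c : R[i]) f : L2 f -> nrm (fun s => c * f s) = nc c * nrm f.
Proof.
move=> /L2P[mf fi]; rewrite /nrm.
rewrite (_ : \int[mu]_s sq (c * f s) = sq c * \int[mu]_s sq (f s)); last first.
  by rewrite -RintegralZl//; apply: eq_Rintegral => s _; rewrite sqM.
by rewrite sqrtrM ?sq_ge0// -ncE.
Qed.

Lemma eq_nrm f g : (forall s, sq (f s) = sq (g s)) -> nrm f = nrm g.
Proof. by move=> fg; congr Num.sqrt; apply: eq_Rintegral => s _. Qed.

Lemma nrmN f : nrm (fun s => - f s) = nrm f.
Proof. by apply: eq_nrm => s; rewrite -!nc_sq ncN. Qed.

Lemma nrmBC f g : nrm (fun s => f s - g s) = nrm (fun s => g s - f s).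
Proof. by apply: eq_nrm => s; rewrite -!nc_sq -ncN opprB. Qed.

Lemma nrm0 : nrm (fun _ : R => 0 : R[i]) = 0.
Proof.
rewrite /nrm (_ : \int[mu]_s _ = 0) ?sqrtr0//.
by rewrite -[RHS](Rintegral0c (R := R)); apply: eq_Rintegral => s _; rewrite /sq /= expr0n addr0.
Qed.

Lemma nrm_sqD f g : L2 f -> L2 g ->
  nrm (fun s => f s + g s) ^+ 2 = nrm f ^+ 2 + nrm g ^+ 2 + 2 * complex.Re (inner f g).
Proof.
move=> Lf Lg; have LD := L2D Lf Lg; apply: (@complexI R).
rewrite -(inner_self LD) innerDl// !innerDr// (inner_self Lf) (inner_self Lg).
rewrite (inner_conj Lf Lg); case: (inner f g) => a b.
by apply/eqP; rewrite eq_complex /=; apply/andP; split; apply/eqP; ring.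
Qed.

Lemma inner_le f g : L2 f -> L2 g -> nc (inner f g) <= nrm f * nrm g.
Proof.
move=> Lf Lg.
have [g0|g0] := eqVneq (nrm g) 0.
  (* when |g| = 0, the inequality 0 <= |f + c g|^2 is affine in c *)
  have H (r : R) : 0 <= nrm f ^+ 2 - r * 2 * sq (inner f g).
    have Lc := L2Z (- r%:C%C * inner f g) Lg.
    have := nrm_sqD Lf Lc; rewrite nrmZ// g0 mulr0 expr0n addr0 innerZr// => E.
    have := sqr_ge0 (nrm (fun s => f s + - (r%:C)%C * inner f g * g s)); rewrite E.
    congr (_ <= _); congr (_ + _); rewrite /sq.
    by case: (inner f g) => a b /=; ring.
  suff : sq (inner f g) <= 0.
    by rewrite -nc_sq g0 mulr0 => h; rewrite -(ler_pXn2r (n := 2))// ?nnegrE ?nc_ge0// expr0n.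
  rewrite leNgt; apply/negP => p; have := H (nrm f ^+ 2 / sq (inner f g)).
  have -> : nrm f ^+ 2 / sq (inner f g) * 2 * sq (inner f g) = 2 * nrm f ^+ 2.
    by field; rewrite gt_eqF.
  have := H (sq (inner f g))^-1; rewrite mulrAC mulVf ?gt_eqF//; nra.
have gp : 0 < nrm g by rewrite lt_def g0 nrm_ge0.
have gp2 : 0 < nrm g ^+ 2 by rewrite exprn_gt0.
(* The minimiser of the norm of f + c g. The case [nrm g = 0] was separated because a representative
   of norm 0 need not be the zero function. *)
pose c := - (((nrm g ^+ 2)^-1)%:C)%C * inner f g.
have Lc := L2Z c Lg.
have := sqr_ge0 (nrm (fun s => f s + c * g s)); rewrite nrm_sqD// nrmZ// innerZr//.
have -> : complex.Re ((c^*)%C * inner f g) = - (nrm g ^+ 2)^-1 * sq (inner f g).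
  by rewrite /c /sq; case: (inner f g) => a b /=; ring.
rewrite exprMn nc_sq.
have -> : sq c = (nrm g ^+ 2)^-1 ^+ 2 * sq (inner f g).
  by rewrite /c /sq; case: (inner f g) => a b /=; ring.
have -> : (nrm g ^+ 2)^-1 ^+ 2 * sq (inner f g) * nrm g ^+ 2 = sq (inner f g) / nrm g ^+ 2.
  by field.
rewrite -nc_sq => h.
rewrite -(ler_pXn2r (n := 2))// ?nnegrE ?nc_ge0 ?mulr_ge0 ?nrm_ge0// exprMn -ler_pdivrMr//.
by move: h; lra.
Qed.

Lemma nrmD f g : L2 f -> L2 g -> nrm (fun s => f s + g s) <= nrm f + nrm g.
Proof.
move=> Lf Lg; rewrite -(ler_pXn2r (n := 2))// ?nnegrE ?addr_ge0 ?nrm_ge0//.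
rewrite nrm_sqD// sqrrD.
have := le_trans (Re_le_nc (inner f g)) (inner_le Lf Lg).
by have := ler_norm (complex.Re (inner f g)); lra.
Qed.

Lemma nrmB f g : L2 f -> L2 g -> nrm (fun s => f s - g s) <= nrm f + nrm g.
Proof.
move=> Lf Lg; rewrite -(nrmN g).
have LN : L2 (fun s => - g s).
  by rewrite (_ : (fun s => _) = (fun s => (-1) * g s)); [exact: L2Z|apply/funext => s; rewrite mulN1r].
exact: nrmD.
Qed.

Lemma nrm_tri f g h : L2 f -> L2 g -> L2 h ->
  nrm (fun s => f s - h s) <= nrm (fun s => f s - g s) + nrm (fun s => g s - h s).
Proof.
move=> Lf Lg Lh; apply: le_trans (nrmD (L2B Lf Lg) (L2B Lg Lh)).
by rewrite le_eqVlt; apply/orP; left; apply/eqP; congr nrm; apply/funext => s; rewrite addrA subrK.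
Qed.

Lemma nrm_sum I (r : seq I) (F : I -> R -> R[i]) : (forall i, L2 (F i)) ->
  nrm (fun s => \sum_(i <- r) F i s) <= \sum_(i <- r) nrm (F i).
Proof.
move=> LF; elim: r => [|i r ih].
  by rewrite big_nil; under eq_fun do rewrite big_nil; rewrite nrm0.
rewrite big_cons; under eq_fun do rewrite big_cons.
have LS : L2 (fun s => \sum_(i <- r) F i s) by apply: L2_sum.
by apply: le_trans (nrmD (LF i) LS) _; rewrite lerD2l.
Qed.

(** Fatou's lemma: a norm bound passes to a pointwise limit without an integrable majorant. *)
Lemma L2_fatou (u : nat -> R -> R[i]) f (B : R) :
  (forall n, L2 (u n)) -> (forall n, nrm (u n) <= B) ->
  (forall s, (complex.Re (u n s) @[n --> \oo] --> complex.Re (f s)) /\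
             (complex.Im (u n s) @[n --> \oo] --> complex.Im (f s))) ->
  L2 f /\ nrm f <= B.
Proof.
move=> Lu uB uf.
have B0 : 0 <= B by apply: le_trans (uB 0%N); exact: nrm_ge0.
have mf : measurable_cfun f.
  split.
  - apply: (measurable_fun_cvg (h := fun n s => complex.Re (u n s))) => [m|s _].
      by case: (L2m (Lu m)).
    by case: (uf s).
  - apply: (measurable_fun_cvg (h := fun n s => complex.Im (u n s))) => [m|s _].
      by case: (L2m (Lu m)).
    by case: (uf s).
have sqc s : (sq (u n s))%:E @[n --> \oo] --> (sq (f s))%:E.
  apply: cvg_EFin; first by apply: nearW.
  have [cr ci] := uf s.
  by rewrite /comp /=; apply: cvgD; rewrite !expr2; [apply: cvgM|apply: cvgM]; rewrite ?expr2.
have F : (\int[mu]_s (sq (f s))%:E <= (B ^+ 2)%:E)%E.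
  have -> : (\int[mu]_s (sq (f s))%:E = \int[mu]_s limn_einf (fun n => (sq (u n s))%:E))%E.
    apply: eq_integral => s _; have [-> _] := cvg_limn_einf_sup (sqc s); by [].
  apply: le_trans (@fatou _ _ R mu setT measurableT (fun n s => (sq (u n s))%:E) _ _) _.
  - by move=> n; apply/measurable_EFinP; apply: mcfun_sq; exact: L2m.
  - by move=> n s _; rewrite lee_fin sq_ge0.
  rewrite limn_einf_lim; apply: lime_le; first exact: is_cvg_einfs.
  apply: nearW => n; apply: (@le_trans _ _ (\int[mu]_s (sq (u n s))%:E)%E).
    by apply: ereal_inf_lbound; exists n => //=.
  have /L2P[_ ui] := Lu n.
  rewrite -(@fineK _ (\int[mu]_s (sq (u n s))%:E)%E) ?lee_fin; last exact: integrable_fin_num.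
  rewrite -/(Rintegral _ _ _) -nrm_sq ler_pXn2r// ?nnegrE ?nrm_ge0//.
have Lf : L2 f.
  by split => //; apply/norm2_lty; apply: le_lt_trans F _; rewrite ltry.
split => //; rewrite -(ler_pXn2r (n := 2))// ?nnegrE ?nrm_ge0// nrm_sq -lee_fin.
have /L2P[_ fi] := Lf.
by rewrite /Rintegral fineK//; exact: integrable_fin_num.
Qed.

End L2_norm.

(** * Completeness of L2 along geometrically convergent sequences *)

Section L2_complete.
Context {R : realType}.
Local Notation mu := (@lebesgue_measure R).
Local Notation nc := (@Normc.normc R).
Implicit Types f g h : R -> R[i].

Lemma bounded_variation_cvg (a : nat -> R) (M : R) :
  (forall n, \sum_(0 <= i < n) `|a i.+1 - a i| <= M) -> cvgn a.
Proof.
move=> aM.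
have -> : a = (fun n => a 0%N + series (telescope a) n).
  by apply/funext => n; exact: eq_sum_telescope.
apply: is_cvgD; first exact: is_cvg_cst.
apply: normed_cvg; apply: nondecreasing_is_cvgn.
  apply/nondecreasing_seqP => n; rewrite /= !seriesEnat /= big_nat_recr//= lerDl//.
exists M => _ [n _ <-]; apply: le_trans (aM n).
rewrite le_eqVlt; apply/orP; left; apply/eqP; rewrite /series /=; exact: eq_bigr.
Qed.

Lemma sum_half_pow (n : nat) : \sum_(0 <= i < n) (2^-1 : R) ^+ i <= 2.
Proof.
suff -> : \sum_(0 <= i < n) (2^-1 : R) ^+ i = 2 - 2 * 2^-1 ^+ n.
  by rewrite gerBl mulr_ge0// exprn_ge0.
elim: n => [|n ih]; first by rewrite big_nil expr0; ring.
by rewrite big_nat_recr//= ih exprS; field.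
Qed.

Lemma sum_half_pow_tail (n m : nat) :
  \sum_(n <= i < m) (2^-1 : R) ^+ i <= 2 * 2^-1 ^+ n.
Proof.
rewrite -{1}(add0n n) big_addn; under eq_bigr do rewrite exprD.
rewrite -mulr_suml; apply: ler_wpM2r; [by rewrite exprn_ge0|exact: sum_half_pow].
Qed.

Lemma nrm_chain (u : nat -> R -> R[i]) (a : nat -> R) (n m : nat) :
  (forall n, L2 (u n)) ->
  (forall n, nrm (fun s => u n.+1 s - u n s) <= a n) -> (n <= m)%N ->
  nrm (fun s => u m s - u n s) <= \sum_(n <= i < m) a i.
Proof.
move=> Lu ua; elim: m => [|m ih]; first rewrite leqn0 => /eqP ->.
  rewrite big_geq// (_ : (fun s => _) = (fun _ => 0)) ?nrm0//.
  by apply/funext => s; rewrite subrr.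
rewrite leq_eqVlt => /predU1P[->|nm].
  rewrite big_geq// (_ : (fun s => _) = (fun _ => 0)) ?nrm0//.
  by apply/funext => s; rewrite subrr.
rewrite big_nat_recr//= addrC; apply: le_trans (nrm_tri (Lu _) (Lu m) (Lu _)) _.
by apply: lerD => //; exact: ih.
Qed.

Lemma nrm_ae0 f (A : set R) : measurable A -> mu A = 0 -> L2 f ->
  (forall s, ~ A s -> f s = 0) -> nrm f = 0.
Proof.
move=> mA A0 Lf fA; rewrite /nrm /Rintegral.
rewrite (@ge0_ae_eq_integral _ _ _ mu setT _ (cst 0%E)) ?integral0 ?sqrtr0//.
- by apply/measurable_EFinP; apply: mcfun_sq; exact: L2m.
- by move=> s _; rewrite lee_fin sq_ge0.
- exists A; split => // s /= /not_implyP[_ h]; apply: contrapT => nA; apply: h.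
  by rewrite fA// /sq /= expr0n addr0.
Qed.

Lemma mcfun_indic f (A : set R) : measurable A -> measurable_cfun f ->
  measurable_cfun (fun s => (\1_A s)%:C%C * f s).
Proof.
move=> mA mf; apply: mcfunM => //; apply: mcfun_real.
exact: measurable_indic.
Qed.

(** Fatou's lemma is applied to [u (m + n) - u n] as m grows, which turns a pointwise limit into a
    limit in norm with the rate of the geometric tail. *)
Lemma L2_complete_pointwise (u : nat -> R -> R[i]) f (C : R) : (forall n, L2 (u n)) ->
  (forall n, nrm (fun s => u n.+1 s - u n s) <= C * 2^-1 ^+ n) ->
  (forall s, (complex.Re (u n s) @[n --> \oo] --> complex.Re (f s)) /\
             (complex.Im (u n s) @[n --> \oo] --> complex.Im (f s))) ->
  L2 f /\ forall n, nrm (fun s => f s - u n s) <= C * 2 * 2^-1 ^+ n.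
Proof.
move=> Lu uC fE.
have C0 : 0 <= C by have := le_trans (nrm_ge0 _) (uC 0%N); rewrite expr0 mulr1.
have nv n m : nrm (fun s => u (m + n)%N s - u n s) <= C * 2 * 2^-1 ^+ n.
  apply: (le_trans (nrm_chain Lu uC (leq_addl m n))).
  by rewrite -mulr_sumr -mulrA; apply: ler_wpM2l => //; exact: sum_half_pow_tail.
have key n : L2 (fun s => f s - u n s) /\ nrm (fun s => f s - u n s) <= C * 2 * 2^-1 ^+ n.
  apply: (@L2_fatou _ (fun m s => u (m + n)%N s - u n s)).
  - by move=> m; apply: L2B.
  - by move=> m; exact: nv.
  - move=> s; have [cr ci] := fE s; split.
    + rewrite (_ : complex.Re (f s - u n s) = complex.Re (f s) - complex.Re (u n s)); last first.
        by case: (f s) (u n s) => a b [].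
      rewrite (_ : (fun m => _) = (fun m => complex.Re (u (m + n)%N s) - complex.Re (u n s))).
        by apply: cvgB; [rewrite (cvg_shiftn n (fun m => complex.Re (u m s)))|exact: cvg_cst].
      by apply/funext => m; case: (u _ s) (u _ s) => a b [].
    + rewrite (_ : complex.Im (f s - u n s) = complex.Im (f s) - complex.Im (u n s)); last first.
        by case: (f s) (u n s) => a b [].
      rewrite (_ : (fun m => _) = (fun m => complex.Im (u (m + n)%N s) - complex.Im (u n s))).
        by apply: cvgB; [rewrite (cvg_shiftn n (fun m => complex.Im (u m s)))|exact: cvg_cst].
      by apply/funext => m; case: (u _ s) (u _ s) => a b [].
split; last by move=> n; case: (key n).
have [L0 _] := key 0%N; rewrite (_ : f = (fun s => (f s - u 0%N s) + u 0%N s)).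
  exact: L2D.
by apply/funext => s; rewrite subrK.
Qed.

Theorem L2_complete (u : nat -> R -> R[i]) (C : R) : (forall n, L2 (u n)) ->
  (forall n, nrm (fun s => u n.+1 s - u n s) <= C * 2^-1 ^+ n) ->
  exists f, L2 f /\ forall n, nrm (fun s => f s - u n s) <= C * 2 * 2^-1 ^+ n.
Proof.
move=> Lu uC.
have C0 : 0 <= C by have := le_trans (nrm_ge0 _) (uC 0%N); rewrite expr0 mulr1.
pose d n s := u n.+1 s - u n s.
have Ld n : L2 (d n) by apply: L2B.
(* Riesz-Fischer: the integral of [w n] is at most C^2 2^-n, so the sum is finite almost everywhere,
   and 2 |d| <= 2^-n + 2^n |d|^2 then makes the increments absolutely summable there. *)
pose w n s : \bar R := (2 ^+ n * sq (d n s))%:E.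
have w0 n s : (0 <= w n s)%E by rewrite lee_fin mulr_ge0 ?exprn_ge0 ?sq_ge0.
have mw n : measurable_fun setT (w n).
  apply/measurable_EFinP; apply: measurable_funM => //.
  by apply: mcfun_sq; exact: L2m.
pose W s := (\sum_(0 <= n <oo) w n s)%E.
have mW : measurable_fun setT W by apply: ge0_emeasurable_sum => // n; rewrite /w.
have iw n : (\int[mu]_s w n s = (2 ^+ n * nrm (d n) ^+ 2)%:E)%E.
  have /L2P[_ di] := Ld n.
  rewrite nrm_sq /w; under eq_integral do rewrite EFinM.
  rewrite integralZl// EFinM; congr (_ * _)%E.
  by rewrite /Rintegral fineK//; exact: integrable_fin_num.
have WI : mu.-integrable setT W.
  apply/integrableP; split => //.
  under eq_integral => s _ do rewrite gee0_abs ?nneseries_ge0//.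
  rewrite integral_nneseries//.
  apply: (@le_lt_trans _ _ (2 * C ^+ 2)%:E); last by rewrite ltry.
  apply: lime_le; first by apply: is_cvg_nneseries => n _ _; rewrite integral_ge0.
  apply: nearW => n.
  rewrite (_ : (\sum_(0 <= i < n) _)%E = (\sum_(0 <= i < n) 2 ^+ i * nrm (d i) ^+ 2)%:E).
    rewrite lee_fin; apply: le_trans (_ : \sum_(0 <= i < n) C ^+ 2 * 2^-1 ^+ i <= _).
      apply: ler_sum_nat => i _.
      have H : nrm (d i) ^+ 2 <= (C * 2^-1 ^+ i) ^+ 2.
        by rewrite ler_pXn2r ?nnegrE ?nrm_ge0 ?uC// mulr_ge0 ?exprn_ge0.
      apply: le_trans (ler_wpM2l (exprn_ge0 _ _) H) _ => //.
      rewrite exprMn [2^-1 ^+ i ^+ 2]expr2 mulrCA; apply: ler_wpM2l; first exact: sqr_ge0.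
      by rewrite mulrA -exprMn mulfV// expr1n mul1r.
    rewrite -mulr_sumr mulrC; apply: ler_wpM2r; first exact: sqr_ge0.
    exact: sum_half_pow.
  by rewrite -sumEFin; apply: eq_bigr => i _; exact: iw.
have [A [mA A0 subA]] := integrable_ae measurableT WI.
have Afin s : ~ A s -> W s \is a fin_num.
  by move=> nA; apply: contrapT => h; apply: nA; apply: subA => /= /(_ I).
(* Zero on the null set [A], so that the pointwise limit exists everywhere. *)
pose v n s := (\1_(~` A) s)%:C%C * u n s.
have vA n s : A s -> v n s = 0.
  by move=> As; rewrite /v indicE memNset/= ?mul0r// => /(_ As).
have vN n s : ~ A s -> v n s = u n s.
  by move=> As; rewrite /v indicE mem_set/= ?mul1r.
have sqv (z : R[i]) s : sq ((\1_(~` A) s)%:C%C * z) <= sq z.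
  rewrite sqM -[leRHS]mul1r; apply: ler_wpM2r; first exact: sq_ge0.
  by rewrite /sq indicE /= expr0n addr0; case: (_ \in _); rewrite ?expr1n ?expr0n.
have Lv n : L2 (v n).
  apply: L2_dom (Lu n) _ => //.
  by apply: (@mcfun_indic (u n) (~` A)); [exact: measurableC|exact: L2m].
  by move=> s; exact: sqv.
have vu n m : nrm (fun s => v n s - v m s) <= nrm (fun s => u n s - u m s).
  have LBv := L2B (Lv n) (Lv m); have LBu := L2B (Lu n) (Lu m).
  rewrite ler_wsqrtr//; have /L2P[_ i1] := LBv; have /L2P[_ i2] := LBu.
  by apply: le_Rintegral => // s _; rewrite /v -mulrBr.
have bv s : ~ A s -> exists M : R, forall n, \sum_(0 <= i < n) nc (v i.+1 s - v i s) <= M.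
  move=> nA; exists ((2 + fine (W s)) / 2) => n.
  apply: (@le_trans _ _ (\sum_(0 <= i < n) (2^-1 ^+ i + 2 ^+ i * sq (d i s)) / 2)).
    apply: ler_sum => i _; rewrite !vN// -/(d i s) -nc_sq.
    set x := nc _; have p : 0 < 2 ^+ i :> R by rewrite exprn_gt0.
    have : 0 <= (1 - 2 ^+ i * x) ^+ 2 / 2 ^+ i by rewrite divr_ge0 ?sqr_ge0// ltW.
    have -> : (1 - 2 ^+ i * x) ^+ 2 / 2 ^+ i = (2^-1 ^+ i + 2 ^+ i * x ^+ 2) - 2 * x.
      by rewrite exprVn; field; rewrite gt_eqF.
    by lra.
  rewrite -mulr_suml; apply: ler_wpM2r => //; rewrite big_split /=; apply: lerD.
    exact: sum_half_pow.
  rewrite -lee_fin fineK ?Afin// -sumEFin; apply: nneseries_lim_ge => i _ _; exact: w0.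
have cv s : exists z : R[i], (complex.Re (v n s) @[n --> \oo] --> complex.Re z) /\
    (complex.Im (v n s) @[n --> \oo] --> complex.Im z).
  have [As|nA] := pselect (A s).
    by exists 0; split; under eq_fun do rewrite vA//; exact: cvg_cst.
  have [M hM] := bv s nA.
  have ReB (x y : R[i]) : complex.Re x - complex.Re y = complex.Re (x - y) by case: x y => a b [].
  have ImB (x y : R[i]) : complex.Im x - complex.Im y = complex.Im (x - y) by case: x y => a b [].
  have /cvg_ex[/= a ca] : cvgn (fun n => complex.Re (v n s)).
    apply: (@bounded_variation_cvg _ M) => n; apply: le_trans (hM n).
    by apply: ler_sum => i _; rewrite ReB Re_le_nc.
  have /cvg_ex[/= b cb] : cvgn (fun n => complex.Im (v n s)).
    apply: (@bounded_variation_cvg _ M) => n; apply: le_trans (hM n).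
    by apply: ler_sum => i _; rewrite ImB Im_le_nc.
  by exists (a +i* b)%C.
have [f fE] := choice cv.
have [Lf key] := L2_complete_pointwise Lv (fun n => le_trans (vu n.+1 n) (uC n)) fE.
exists f; split => // n; apply: le_trans (key n).
apply: (le_trans (nrm_tri Lf (Lv n) (Lu n))).
rewrite [X in _ + X](nrm_ae0 mA A0) ?addr0//; first exact: L2B.
by move=> s nA; rewrite vN// subrr.
Qed.

End L2_complete.

(** * Hermite functions and the Gabor series *)

Section gaussian_weight.
Context {R : realType}.
Local Notation mu := (@lebesgue_measure R).
Implicit Types P Q : {poly R}.

(** The square of the Gaussian window, hence the weight for which the polynomials [hp] are
    orthogonal. *)
Definition gw (s : R) : R := expR (- (2 * pi * s ^+ 2)).

Lemma gw_gt0 s : 0 < gw s. Proof. exact: expR_gt0. Qed.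

Lemma pi_ge2R : 2 <= pi :> R. Proof. exact: pi_ge2. Qed.

Lemma is_derive_horner P (x : R) : is_derive x 1 (fun s => P.[s]) P^`().[x].
Proof.
apply: DeriveDef; first exact: derivable_horner.
by rewrite derivE derive1E.
Qed.

Lemma is_derive_gw (x : R) : is_derive x 1 gw (- (4 * pi * x) * gw x).
Proof. by apply: is_derive_eq; rewrite /gw /GRing.scale /=; ring. Qed.

Lemma continuous_gw : continuous gw.
Proof.
move=> x; apply/differentiable_continuous/derivable1_diffP.
by have [] := is_derive_gw x.
Qed.

Lemma measurable_pgw P : measurable_fun setT (fun s => P.[s] * gw s).
Proof.
by apply: measurable_funM; apply: continuous_measurable_fun; [exact: continuous_horner|exact: continuous_gw].
Qed.

Lemma horner_le_gauss P : exists C : R, forall s, `|P.[s]| <= C * expR (s ^+ 2).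
Proof.
have mono (m : nat) (s : R) : `|s ^+ m| <= (1 + m`!%:R) * expR (s ^+ 2).
  rewrite normrX.
  have e1 : 1 <= expR (s ^+ 2) by rewrite -expR0 ler_expR sqr_ge0.
  have h : `|s| ^+ m <= 1 + (s ^+ 2) ^+ m.
    have [s1|s1] := leP `|s| 1.
      by apply: ler_wpDr; [rewrite exprn_ge0// sqr_ge0|exact: exprn_ile1].
    rewrite ler_wpDl// -(real_normK (num_real s)) -exprM.
    by rewrite ler_eXn2l// mul2n -addnn leq_addr.
  apply: (le_trans h); rewrite mulrDl mul1r; apply: lerD => //.
  case: m {h} => [|m]; first by rewrite expr0 fact0 mul1r.
  have := expR_ge1Dxn m (sqr_ge0 s).
  have fp : 0 < m.+1`!%:R :> R by rewrite ltr0n fact_gt0.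
  move=> h; rewrite mulrC -ler_pdivrMr//; apply: le_trans h.
  by rewrite ler_wpDl.
exists (\sum_(i < size P) `|P`_i| * (1 + i`!%:R)) => s.
rewrite horner_coef mulr_suml; apply: (le_trans (ler_norm_sum _ _ _)).
by apply: ler_sum => i _; rewrite normrM -mulrA ler_wpM2l.
Qed.

Lemma gw_le s : expR (s ^+ 2) * gw s <= gauss_fun s.
Proof.
rewrite /gw /gauss_fun -expRD ler_expR.
have := sqr_ge0 s; have := pi_ge2R; nra.
Qed.

Lemma pgw_le P : exists2 C : R, 0 <= C & forall s, `|P.[s] * gw s| <= C * gauss_fun s.
Proof.
have [C hC] := horner_le_gauss P.
have C0 : 0 <= C by have := le_trans (normr_ge0 _) (hC 0); rewrite pmulr_lge0// expR_gt0.
exists C => // s; rewrite normrM (gtr0_norm (gw_gt0 s)).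
apply: le_trans (_ : C * expR (s ^+ 2) * gw s <= _); first by rewrite ler_wpM2r ?hC// ltW// gw_gt0.
by rewrite -mulrA ler_wpM2l// gw_le.
Qed.

Lemma pgw_int P : mu.-integrable setT (EFin \o (fun s => P.[s] * gw s)).
Proof.
have [C C0 hC] := pgw_le P.
have gi : mu.-integrable setT (fun s => C%:E * (gauss_fun s)%:E)%E.
  by apply: integrableZl => //; exact: integrableT_gauss.
apply: (le_integrable measurableT) gi; first by apply/measurable_EFinP; exact: measurable_pgw.
move=> s _; rewrite /= lee_fin [leRHS]ger0_norm; first exact: hC.
by rewrite mulr_ge0// gauss_fun_ge0.
Qed.

Definition Lg P : R := \int[mu]_s (P.[s] * gw s).

Lemma LgD P Q : Lg (P + Q) = Lg P + Lg Q.
Proof.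
rewrite /Lg -RintegralD//; [|exact: pgw_int|exact: pgw_int].
by apply: eq_Rintegral => s _; rewrite hornerD mulrDl.
Qed.

Lemma LgZ (c : R) P : Lg (c *: P) = c * Lg P.
Proof.
rewrite /Lg -RintegralZl//; last exact: pgw_int.
by apply: eq_Rintegral => s _; rewrite hornerZ mulrA.
Qed.

(** Integration by parts: the difference of the two sides is the integral of the derivative of P gw,
    computed over growing intervals, and P gw vanishes at infinity. *)
Lemma Lg_parts P : Lg P^`() = Lg ((4 * pi) *: ('X * P)).
Proof.
pose Q := P^`() - (4 * pi) *: ('X * P).
suff : Lg Q = 0.
  rewrite /Q -scaleN1r LgD [Lg (-1 *: _)]LgZ mulN1r => /eqP.
  by rewrite subr_eq0 => /eqP.
pose F s := P.[s] * gw s; pose q s := Q.[s] * gw s.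
have dF (x : R) : is_derive x 1 F (q x).
  rewrite /F; have d1 := is_derive_horner P x; have d2 := is_derive_gw x.
  apply: is_derive_eq.
  by rewrite /q /Q !hornerE /GRing.scale /=; ring.
have cF : continuous F.
  by move=> x; apply: cvgM; [exact: continuous_horner|exact: continuous_gw].
have cq : continuous q.
  by move=> x; apply: cvgM; [exact: continuous_horner|exact: continuous_gw].
pose A (n : nat) : set R := `[- n.+1%:R, n.+1%:R]%classic.
have lt_n n : - n.+1%:R < n.+1%:R :> R by rewrite gtrN.
have FTC n : (\int[mu]_(x in A n) (q x)%:E = (F n.+1%:R - F (- n.+1%:R))%:E)%E.
  rewrite (@continuous_FTC2 _ q F)//.
  - by apply: continuous_subspaceT.
  - split.
    + by move=> x _; have [] := dF x.
    + by apply: cvg_at_right_filter; exact: cF.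
    + by apply: cvg_at_left_filter; exact: cF.
  - by move=> x _; rewrite derive1E; exact: derive_val.
have lim1 : (\int[mu]_x (\1_(A n) x * q x)%:E @[n --> \oo] --> \int[mu]_x (q x)%:E)%E.
  apply: (@dominated_cvg _ _ _ mu setT measurableT
    (fun n x => (\1_(A n) x * q x)%:E) (EFin \o q) (fun x => `|q x|%:E)).
  - move=> n; apply/measurable_EFinP; apply: measurable_funM; last exact: measurable_pgw.
    by apply: (measurable_indic (U := A n)); exact: measurable_itv.
  - move=> x _; apply: cvg_near_cst.
    have [m xm] : exists m : nat, `|x| <= m%:R.
      by exists (Num.truncn `|x|).+1; apply: ltW; exact: truncnS_gt.
    exists m => // n /= mn; rewrite indicE mem_set ?mul1r// /A /= in_itv /= -ler_norml.
    by rewrite (le_trans xm)// ler_nat ltnW.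
  - by [].
  - by apply: integrable_norm; exact: pgw_int.
  - move=> n x _; rewrite lee_fin normrM indicE; case: (x \in A n); rewrite ?normr1 ?mul1r//.
    by rewrite normr0 mul0r.
have lim0 : ((F n.+1%:R - F (- n.+1%:R))%:E @[n --> \oo] --> (0 : \bar R))%E.
  have [C C0 hC] := pgw_le P.
  have g0 : (C * gauss_fun (n.+1%:R : R)) @[n --> \oo] --> (0 : R).
    rewrite -(mulr0 C); apply: cvgM; first exact: cvg_cst.
    rewrite (cvg_shiftS (fun n => gauss_fun (n%:R : R))).
    exact: (cvg_comp _ _ (@cvgr_idn R) (@cvg_gauss_fun R)).
  have z : (F x.+1%:R) @[x --> \oo] --> (0 : R).
    apply/norm_cvg0P; apply: (squeeze_cvgr _ (cvg_cst 0) g0).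
    by apply: nearW => n; rewrite normr_ge0 hC.
  have z' : (F (- x.+1%:R)) @[x --> \oo] --> (0 : R).
    apply/norm_cvg0P; apply: (squeeze_cvgr _ (cvg_cst 0) g0).
    by apply: nearW => n; rewrite normr_ge0 (le_trans (hC _))// /gauss_fun sqrrN.
  have zz : (F n.+1%:R - F (- n.+1%:R)) @[n --> \oo] --> (0 : R).
    by rewrite -(subr0 (0 : R)); exact: cvgB.
  by apply: cvg_EFin; [exact: nearW|exact: zz].
have -> : Lg Q = fine (\int[mu]_x (q x)%:E)%E by [].
suff -> : (\int[mu]_x (q x)%:E = 0)%E by [].
apply: (cvg_unique _ lim1) => //; rewrite (_ : (fun n => _) = (fun n => (F n.+1%:R - F (- n.+1%:R))%:E))//.
apply/funext => n; rewrite -FTC [RHS]integral_mkcond; apply: eq_integral => x _.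
by rewrite patchE indicE; case: ifPn => xA; rewrite ?mul1r ?mul0r.
Qed.

Lemma Lg1_gt0 : 0 < Lg 1.
Proof.
apply: (@lt_le_trans _ _ (gw 1)); first exact: gw_gt0.
have -> : gw 1 = \int[mu]_s (gw 1 * \1_(`[0, 1]%classic : set R) s).
  rewrite RintegralZl//; last exact: integrable_indic_itv.
  rewrite /Rintegral integral_indic//.
  transitivity (gw 1 * fine (lebesgue_measure (`[0, 1]%classic : set R))); last by rewrite setIT.
  by rewrite lebesgue_measure_itv/= lte_fin ltr01 -EFinB subr0 mulr1.
apply: le_Rintegral => //.
- rewrite /comp; under eq_fun do rewrite EFinM; apply: integrableZl => //.
  exact: integrable_indic_itv.
- exact: pgw_int.
- move=> s _; rewrite hornerC mul1r indicE; case: (boolP (s \in _)) => h; last by rewrite mulr0 ltW// gw_gt0.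
  rewrite mulr1 ler_expR lerN2; apply: ler_wpM2l; first by rewrite mulr_ge0// pi_ge0.
  move: h; rewrite inE /= in_itv /= => /andP[s0 s1].
  by rewrite ler_pXn2r ?nnegrE.
Qed.

End gaussian_weight.

(** * Hermite polynomials and their orthogonality *)

Section hermite.
Context {R : realType}.

(** Two consecutive polynomials are carried along, which makes the three-term recurrence
    structural. *)
Fixpoint hermite_pair (n : nat) : {poly R} * {poly R} :=
  if n is m.+1 then
    let: (a, b) := hermite_pair m in
    (b, (m.+2%:R)^-1 *: ((2 * pi) *: ('X * b) - pi *: a))
  else (1, (2 * pi) *: 'X).

(* Hermite polynomials with generating function
   [\sum_n z ^+ n * hp n s = exp (2 pi z s - pi z ^ 2 / 2)] *)
Definition hp (n : nat) : {poly R} := (hermite_pair n).1.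

Definition hp_pred (n : nat) : {poly R} := if n is m.+1 then hp m else 0.

Lemma hermite_pairE n : hermite_pair n = (hp n, hp n.+1).
Proof. by rewrite /hp /=; case: (hermite_pair n). Qed.

Lemma hp0 : hp 0 = 1. Proof. by []. Qed.

Lemma hp_rec n : n.+1%:R *: hp n.+1 = (2 * pi) *: ('X * hp n) - pi *: hp_pred n.
Proof.
case: n => [|n]; first by rewrite /hp_pred scale1r scaler0 subr0 mulr1 /hp.
rewrite {1}/hp [hermite_pair _]/= hermite_pairE /= scalerA divff ?pnatr_eq0//.
by rewrite scale1r.
Qed.

Lemma deriv_hp n : (hp n)^`() = (2 * pi) *: hp_pred n.
Proof.
have [m] := ubnP n; elim: m n => // m ih [|n] nm; first by rewrite /= scaler0 hp0 -polyC1 derivC.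
have nz : n.+1%:R != 0 :> R by rewrite pnatr_eq0.
apply: (scalerI nz); rewrite -derivZ hp_rec derivB !derivZ derivM derivX mul1r.
rewrite ih//= [RHS]scalerA [n.+1%:R * _]mulrC -[RHS]scalerA.
have -> : n.+1%:R *: hp n = hp n + n%:R *: hp n by rewrite -natr1 scalerDl scale1r addrC.
rewrite !scalerDr -addrA; congr (_ + _).
case: n nm {nz} => [|n] nm; first by rewrite /= scale0r deriv0 !scaler0 mulr0 scaler0 subr0.
rewrite [hp_pred _]/= ih; last by apply: (@ltn_trans n.+1).
rewrite hp_rec scalerBr -scalerAr !scalerA.
by congr (_ - _ *: _); ring.
Qed.

(** Integration by parts on [hp n * hp m]: the recurrence writes ['X * hp n] through its two
    neighbours, and the terms with [hp_pred n] cancel. Each use lowers both indices by one, which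
    gives orthogonality and norms at once. *)
Lemma Lg_hp_rec n m : n.+1%:R * Lg (hp n.+1 * hp m) = pi * Lg (hp n * hp_pred m).
Proof.
have := Lg_parts (hp n * hp m).
rewrite derivM !deriv_hp LgD -!(scalerAl, scalerAr) !LgZ.
have -> : Lg ('X * (hp n * hp m)) = (2 * pi)^-1 * (n.+1%:R * Lg (hp n.+1 * hp m) +
    pi * Lg (hp_pred n * hp m)).
  rewrite -!LgZ -LgD -LgZ; congr Lg; rewrite !scalerAl -mulrDl hp_rec subrK -scalerAl.
  by rewrite scalerA mulVf ?scale1r ?mulrA// mulf_neq0// ?gt_eqF ?pi_gt0.
have p0 : 0 < pi :> R by exact: pi_gt0.
set a := Lg (hp_pred n * _); set b := Lg (hp n * _); set c := Lg (hp n.+1 * _).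
move: (pi) p0 => p p0.
have -> : 4 * p * ((2 * p)^-1 * (n.+1%:R * c + p * a)) = 2 * (n.+1%:R * c + p * a).
  by field; rewrite (gt_eqF p0).
by lra.
Qed.

Lemma Lg_hp n m : Lg (hp n * hp m) = (n == m)%:R * (pi ^+ n / n`!%:R) * Lg 1.
Proof.
elim: n m => [|n ih] [|m] /=; first by rewrite hp0 expr0 fact0 divr1 !mul1r.
- have := Lg_hp_rec m 0; rewrite /= mulr0 -(scale0r 0) LgZ mul0r mulr0 => /eqP.
  by rewrite mulf_eq0 pnatr_eq0 /= mulrC !mul0r => /eqP.
- have := Lg_hp_rec n 0; rewrite /= mulr0 -(scale0r 0) LgZ mul0r mulr0 => /eqP.
  by rewrite mulf_eq0 pnatr_eq0 /= !mul0r => /eqP.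
- have nz : n.+1%:R != 0 :> R by rewrite pnatr_eq0.
  apply: (mulfI nz); rewrite Lg_hp_rec /= ih eqSS factS exprS natrM.
  by field; rewrite pnatr_eq0 -lt0n fact_gt0 /= addrC natr1.
Qed.

Definition phi (n : nat) : R -> R[i] :=
  fun s => (((hp n).[s] * expR (- (pi * s ^+ 2)))%:C)%C.

Lemma expR_sqr_gw (s : R) : expR (- (pi * s ^+ 2)) * expR (- (pi * s ^+ 2)) = gw s.
Proof. by rewrite -expRD /gw; congr expR; ring. Qed.

Lemma L2_phi n : L2 (phi n).
Proof.
apply/L2P; split.
  have ce : continuous (fun s : R => expR (- (pi * s ^+ 2))).
    by move=> x; apply/differentiable_continuous/derivable1_diffP; exact: ex_derive.
  apply: mcfun_real; apply: continuous_measurable_fun => x; apply: cvgM; last exact: ce.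
  exact: continuous_horner.
have := pgw_int (hp n * hp n); congr (_.-integrable _ _); apply/funext => s.
by rewrite /phi /sq /= expr0n addr0 hornerM -expR_sqr_gw; congr EFin; ring.
Qed.

Lemma inner_phi n m : inner (phi n) (phi m) = ((Lg (hp n * hp m))%:C)%C.
Proof.
apply/eqP; rewrite eq_complex /=; apply/andP; split; apply/eqP.
- apply: eq_Rintegral => s _; rewrite /phi /= oppr0 mulr0 subr0 hornerM -expR_sqr_gw; ring.
- rewrite -[RHS](Rintegral0c (R := R)); apply: eq_Rintegral => s _.
  by rewrite /phi /= oppr0 mulr0 mul0r addr0.
Qed.

End hermite.

(** * Entire power series *)

Section hermite_series.
Context {R : realType}.

(** The coefficient sequences of entire power series; the class is stable under the operations that
    the differential equation of the generating function requires. *)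
Definition rapid (c : nat -> R) :=
  forall r : R, 0 < r -> exists C : R, forall n, `|c n| <= C * r ^+ n.

Lemma rapid_le (a b : nat -> R) : rapid b -> (forall n, `|a n| <= `|b n|) -> rapid a.
Proof.
move=> rb ab r r0; have [C hC] := rb r r0; exists C => n; exact: le_trans (ab n) (hC n).
Qed.

Lemma natr_le_exp2 n : n.+1%:R <= 2 ^+ n :> R.
Proof. by rewrite -natrX ler_nat; elim: n => // n ih; rewrite expnS; lia. Qed.

Lemma rapid_diffs c : rapid c -> rapid (pseries_diffs c).
Proof.
move=> rc r r0; have r20 : 0 < r / 2 by rewrite divr_gt0.
have [C hC] := rc _ r20; exists (C * (r / 2)) => n.
rewrite /pseries_diffs normrM normr_nat; apply: (le_trans (ler_wpM2l _ (hC n.+1))) => //.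
have C0 : 0 <= C by have := le_trans (normr_ge0 _) (hC 0%N); rewrite expr0 mulr1.
rewrite exprS (mulrA C) mulrCA; apply: ler_wpM2l; first by rewrite mulr_ge0// ltW.
rewrite exprMn -[leRHS]mul1r exprVn mulrCA [leRHS]mulrC.
apply: ler_wpM2l; first by rewrite exprn_ge0// ltW.
by rewrite ler_pdivrMr ?exprn_gt0// mul1r natr_le_exp2.
Qed.

Lemma rapid_cvg c (u : R) : rapid c -> cvgn (pseries c u).
Proof.
move=> rc; rewrite /pseries; apply: normed_cvg.
have p : 0 < (2 * (`|u| + 1))^-1 by rewrite invr_gt0 mulr_gt0// ltr_wpDl.
have [C hC] := rc _ p.
have C0 : 0 <= C by have := le_trans (normr_ge0 _) (hC 0%N); rewrite expr0 mulr1.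
apply: (@series_le_cvg _ _ (geometric C (2^-1))) => //.
- by move=> n; rewrite normr_ge0.
- by move=> n; rewrite /geometric /= mulr_ge0// exprn_ge0.
- move=> n /=; rewrite normrM normrX; apply: le_trans (ler_wpM2r _ (hC n)) _ => //.
  rewrite -mulrA; apply: ler_wpM2l => //; rewrite -exprMn.
  apply: lerXn2r; rewrite ?nnegrE ?mulr_ge0 ?(ltW p)//.
  rewrite invfM -mulrA ger_pMr// mulrC ler_pdivrMr ?mul1r ?lerDl// ltr_wpDl//.
- by apply: is_cvg_geometric_series; rewrite ger0_norm// invf_lt1// ltr1n.
Qed.

Lemma rapid_is_derive c (u : R) : rapid c ->
  is_derive u 1 (fun x => limn (pseries c x)) (limn (pseries (pseries_diffs c) u)).
Proof.
move=> rc; apply: (@pseries_snd_diffs _ c (`|u| + 1)).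
- exact: rapid_cvg.
- exact/rapid_cvg/rapid_diffs.
- exact/rapid_cvg/rapid_diffs/rapid_diffs.
- by rewrite ltr_normr ltrDl ltr01.
Qed.

(** After scaling by [r ^- n] the recurrence reads (n + 2) b(n + 2) <= K max(b(n + 1), b(n)), so
    this maximum stops growing once n + 2 exceeds K. *)
Lemma rapid_hp (s : R) : rapid (fun n => (hp n).[s]).
Proof.
move=> r r0.
pose b n := `|(hp n).[s]| * r ^- n.
pose K := 2 * pi * `|s| / r + pi / r ^+ 2.
have K0 : 0 <= K by rewrite addr_ge0// divr_ge0 ?mulr_ge0 ?pi_ge0 ?exprn_ge0 ?(ltW r0).
have rec n : n.+2%:R * b n.+2 <= K * Num.max (b n.+1) (b n).
  have E : n.+2%:R * (hp n.+2).[s] = 2 * pi * (s * (hp n.+1).[s]) - pi * (hp n).[s].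
    by have := congr1 (fun P => P.[s]) (hp_rec n.+1); rewrite !hornerE.
  have -> : n.+2%:R * b n.+2 = `|n.+2%:R * (hp n.+2).[s]| * r ^- n.+2.
    by rewrite normrM normr_nat /b mulrA.
  rewrite E; apply: le_trans (_ : (2 * pi * `|s| * `|(hp n.+1).[s]| + pi * `|(hp n).[s]|) * r ^- n.+2 <= _).
    apply: ler_wpM2r; first by rewrite invr_ge0 exprn_ge0// ltW.
    apply: (le_trans (ler_normB _ _)).
    by rewrite !normrM !(ger0_norm (pi_ge0 R)) normr_nat !mulrA.
  have -> : (2 * pi * `|s| * `|(hp n.+1).[s]| + pi * `|(hp n).[s]|) * r ^- n.+2 =
      2 * pi * `|s| / r * b n.+1 + pi / r ^+ 2 * b n.
    rewrite /b mulrDl; congr (_ + _).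
      by rewrite [in LHS]exprS; move: (pi) => p; field; rewrite ?expf_neq0 ?gt_eqF.
    by rewrite -addn2 exprD; move: (pi) => p; field; rewrite ?expf_neq0 ?gt_eqF.
  rewrite /K [leRHS]mulrDl; apply: lerD; apply: ler_wpM2l.
  - by rewrite divr_ge0 ?mulr_ge0 ?pi_ge0 ?(ltW r0).
  - by rewrite le_max lexx.
  - by rewrite divr_ge0 ?pi_ge0 ?exprn_ge0 ?(ltW r0).
  - by rewrite le_max lexx orbT.
have b0 n : 0 <= b n by rewrite mulr_ge0// invr_ge0 exprn_ge0// ltW.
pose m := Num.truncn K.
have hm n : (m <= n)%N -> Num.max (b n.+2) (b n.+1) <= Num.max (b n.+1) (b n).
  move=> mn; have h := rec n; set M := Num.max (b n.+1) (b n) in h *.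
  have M0 : 0 <= M by rewrite /M le_max b0.
  have h1 : b n.+1 <= M by rewrite /M le_max lexx.
  rewrite ge_max h1 andbT -(ler_pM2l (x := n.+2%:R))//.
  apply: (le_trans h); apply: ler_wpM2r => //; apply: ltW.
  apply: lt_le_trans (truncnS_gt K) _; rewrite ler_nat.
  by apply: leq_trans (leqnSn _); rewrite ltnS.
pose B := \sum_(i < m.+2) b i.
have Bb i : (i < m.+2)%N -> b i <= B.
  move=> im; rewrite /B (bigD1 (Ordinal im))//= lerDl.
  by apply: sumr_ge0.
have big k : Num.max (b (m + k).+1) (b (m + k)%N) <= B.
  elim: k => [|k ih]; first by rewrite addn0 ge_max !Bb// ltnS leqnSn.
  by rewrite addnS; apply: le_trans (hm _ (leq_addr _ _)) ih.
exists B => n; have : b n <= B.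
  have [nm|mn] := ltnP n m.+2; first exact: Bb.
  by apply: le_trans (big (n - m)%N); rewrite subnKC ?le_max ?lexx ?orbT//; lia.
by rewrite /b ler_pdivrMr ?exprn_gt0.
Qed.

Lemma limn_pseriesD a b (u : R) : rapid a -> rapid b ->
  limn (pseries (fun n => a n + b n) u) = limn (pseries a u) + limn (pseries b u).
Proof.
move=> /(@rapid_cvg _ u)/cvg_ex[l hl] /(@rapid_cvg _ u)/cvg_ex[m hm].
rewrite (cvg_lim _ hl)// (cvg_lim _ hm)//; apply: cvg_lim => //.
suff -> : pseries (fun n => a n + b n) u = pseries a u \+ pseries b u by exact: cvgD.
apply/funext => n; rewrite /pseries /series /= -big_split /=.
by apply: eq_bigr => i _; rewrite mulrDl.
Qed.

Lemma limn_pseriesZ a (c u : R) : rapid a ->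
  limn (pseries (fun n => c * a n) u) = c * limn (pseries a u).
Proof.
move=> /(@rapid_cvg _ u)/cvg_ex[l hl]; rewrite (cvg_lim _ hl)//; apply: cvg_lim => //.
suff -> : pseries (fun n => c * a n) u = (fun n => c * pseries a u n).
  by apply: cvgM => //; exact: cvg_cst.
apply/funext => n; rewrite /pseries /series /= mulr_sumr.
by apply: eq_bigr => i _; rewrite mulrA.
Qed.

Definition shiftr (a : nat -> R) (n : nat) : R := if n is m.+1 then a m else 0.

Lemma rapid_shiftr a : rapid a -> rapid (shiftr a).
Proof.
move=> ra r r0; have [C hC] := ra r r0.
have C0 : 0 <= C by have := le_trans (normr_ge0 _) (hC 0%N); rewrite expr0 mulr1.
exists (C / r) => -[|n] /=; first by rewrite normr0 expr0 mulr1 divr_ge0// ltW.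
by rewrite exprS mulrA divfK ?gt_eqF.
Qed.

Lemma limn_pseries_shiftr a (u : R) : rapid a ->
  limn (pseries (shiftr a) u) = u * limn (pseries a u).
Proof.
move=> /(@rapid_cvg _ u)/cvg_ex[l hl]; rewrite (cvg_lim _ hl)//; apply: cvg_lim => //.
rewrite -cvg_shiftS.
suff -> : (fun n => pseries (shiftr a) u n.+1) = (fun n => u * pseries a u n).
  by apply: cvgM => //; exact: cvg_cst.
apply/funext => n; rewrite /pseries /series /= big_nat_recl//= mul0r add0r mulr_sumr.
by apply: eq_bigr => i _; rewrite exprS mulrCA.
Qed.

Lemma rapidD a b : rapid a -> rapid b -> rapid (fun n => a n + b n).
Proof.
move=> ra rb r r0; have [C hC] := ra r r0; have [D hD] := rb r r0.
by exists (C + D) => n; rewrite mulrDl; apply: le_trans (ler_normD _ _) (lerD _ _).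
Qed.

Lemma rapidZ c a : rapid a -> rapid (fun n => c * a n).
Proof.
move=> ra r r0; have [C hC] := ra r r0; exists (`|c| * C) => n.
by rewrite normrM -mulrA ler_wpM2l.
Qed.

Lemma rapidX c (x : R) : rapid c -> rapid (fun n => x ^+ n * c n).
Proof.
move=> rc r r0; have p : 0 < r / (`|x| + 1) by rewrite divr_gt0// ltr_wpDl.
have [C hC] := rc _ p; exists C => n.
have C0 : 0 <= C by have := le_trans (normr_ge0 _) (hC 0%N); rewrite expr0 mulr1.
rewrite normrM normrX; apply: (le_trans (ler_wpM2l _ (hC n))); first by rewrite exprn_ge0.
rewrite mulrCA; apply: ler_wpM2l => //; rewrite -exprMn; apply: lerXn2r.
- by rewrite nnegrE mulr_ge0// ltW.
- by rewrite nnegrE ltW.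
by rewrite mulrCA ger_pMr// ler_pdivrMr ?mul1r ?lerDl// ltr_wpDl.
Qed.

End hermite_series.

(** The complex equation w' = (A' + i B') w for w = P + i Q in real terms: [C1] and [D1] are the
    real and imaginary parts of exp (- A - i B) w, which is constant. *)
Lemma linear_ode_solution (R : realType) (P Q A B A' B' : R -> R) :
  (forall u : R, is_derive u 1 P (A' u * P u - B' u * Q u)) ->
  (forall u : R, is_derive u 1 Q (A' u * Q u + B' u * P u)) ->
  (forall u : R, is_derive u 1 A (A' u)) -> (forall u : R, is_derive u 1 B (B' u)) ->
  A 0 = 0 -> B 0 = 0 -> P 0 = 1 -> Q 0 = 0 ->
  P 1 = expR (A 1) * cos (B 1) /\ Q 1 = expR (A 1) * sin (B 1).
Proof.
move=> dP dQ dA dB A0 B0 P0 Q0.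
pose C1 u := expR (- A u) * (P u * cos (B u) + Q u * sin (B u)).
pose D1 u := expR (- A u) * (Q u * cos (B u) - P u * sin (B u)).
have C1E : C1 1 = 1.
  have d0 (u : R) : is_derive u 1 C1 0.
    by apply: is_derive_eq; rewrite /GRing.scale /=; ring.
  rewrite (@is_derive_0_is_cst _ C1 1 0) /C1 A0 B0 P0 Q0.
  by rewrite oppr0 expR0 cos0 sin0; ring.
have D1E : D1 1 = 0.
  have d0 (u : R) : is_derive u 1 D1 0.
    by apply: is_derive_eq; rewrite /GRing.scale /=; ring.
  rewrite (@is_derive_0_is_cst _ D1 1 0) /D1 A0 B0 P0 Q0.
  by rewrite oppr0 expR0 cos0 sin0; ring.
have := cos2Dsin2 (B 1); have := C1E; have := D1E; rewrite /C1 /D1 expRN.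
set c := cos _; set d := sin _; set e := expR _ => h1 h2 h3.
have e0 : e != 0 by rewrite gt_eqF// expR_gt0.
have h1' : Q 1 * c - P 1 * d = 0.
  by apply: (mulfI (invr_neq0 e0)); rewrite h1 mulr0.
have h2' : P 1 * c + Q 1 * d = e.
  by apply: (mulfI (invr_neq0 e0)); rewrite h2 mulVf.
split; apply/eqP; rewrite -subr_eq0 -h2'; apply/eqP.
  transitivity (P 1 * (1 - (c ^+ 2 + d ^+ 2)) - d * (Q 1 * c - P 1 * d)); first by ring.
  by rewrite h3 h1'; ring.
transitivity (Q 1 * (1 - (c ^+ 2 + d ^+ 2)) + c * (Q 1 * c - P 1 * d)); first by ring.
by rewrite h3 h1'; ring.
Qed.

(** * The generating function of the Hermite polynomials at a complex point *)

Section generating_function.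
Context {R : realType}.
Local Notation nc := (@Normc.normc R).
Variables (s : R) (z : R[i]).
Let x := complex.Re z.
Let y := complex.Im z.
Let a n := complex.Re (z ^+ n) * (hp n).[s].
Let b n := complex.Im (z ^+ n) * (hp n).[s].
Let X2 := x ^+ 2 - y ^+ 2.
Let Y2 := 2 * x * y.

Let ReS n : complex.Re (z ^+ n.+1) = x * complex.Re (z ^+ n) - y * complex.Im (z ^+ n).
Proof. by rewrite exprS /x /y; case: (z) (z ^+ n) => p q [t u]. Qed.

Let ImS n : complex.Im (z ^+ n.+1) = x * complex.Im (z ^+ n) + y * complex.Re (z ^+ n).
Proof. by rewrite exprS /x /y; case: (z) (z ^+ n) => p q [t u]. Qed.

Let ra : rapid a.
Proof.
apply: rapid_le (rapidX (nc z) (rapid_hp s)) _ => n.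
rewrite /a !normrM; apply: ler_wpM2r => //; rewrite normrX (ger0_norm (nc_ge0 z)) -ncX.
exact: Re_le_nc.
Qed.

Let rb : rapid b.
Proof.
apply: rapid_le (rapidX (nc z) (rapid_hp s)) _ => n.
rewrite /b !normrM; apply: ler_wpM2r => //; rewrite normrX (ger0_norm (nc_ge0 z)) -ncX.
exact: Im_le_nc.
Qed.

Let rec n : n.+1%:R * (hp n.+1).[s] = 2 * pi * (s * (hp n).[s]) - pi * (hp_pred n).[s].
Proof. by have := congr1 (fun P => P.[s]) (hp_rec n); rewrite !hornerE. Qed.

Let da : pseries_diffs a = fun n => 2 * pi * s * x * a n + (- (2 * pi * s * y) * b n +
  (- (pi * X2) * shiftr a n + pi * Y2 * shiftr b n)).
Proof.
apply/funext => n; rewrite /pseries_diffs {1}/a mulrCA rec.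
case: n => [|n].
  by rewrite ReS /shiftr /a /b /hp_pred horner0 expr0 /=; move: (pi) => p; ring.
rewrite !ReS ImS /shiftr /a /b /hp_pred !ReS !ImS /X2 /Y2.
by move: (pi) => p; ring.
Qed.

Let db : pseries_diffs b = fun n => 2 * pi * s * x * b n + (2 * pi * s * y * a n +
  (- (pi * X2) * shiftr b n + - (pi * Y2) * shiftr a n)).
Proof.
apply/funext => n; rewrite /pseries_diffs {1}/b mulrCA rec.
case: n => [|n].
  by rewrite ImS /shiftr /a /b /hp_pred horner0 expr0 /=; move: (pi) => p; ring.
rewrite !ImS ReS /shiftr /a /b /hp_pred !ReS !ImS /X2 /Y2.
by move: (pi) => p; ring.
Qed.

(** P + i Q is the generating function at u z, as a function of the real parameter u. The recurrence
    gives it the logarithmic derivative 2 pi s z - pi z^2 u; the value wanted is the one at u =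
    1. *)
Let P (u : R) : R := limn (pseries a u).
Let Q (u : R) : R := limn (pseries b u).
Let A (u : R) : R := 2 * pi * s * x * u - pi * X2 * u ^+ 2 / 2.
Let B (u : R) : R := 2 * pi * s * y * u - pi * Y2 * u ^+ 2 / 2.
Let A' (u : R) : R := 2 * pi * s * x - pi * X2 * u.
Let B' (u : R) : R := 2 * pi * s * y - pi * Y2 * u.

Let dP (u : R) : is_derive u 1 P (A' u * P u - B' u * Q u).
Proof.
have := rapid_is_derive u ra; rewrite da.
have rsa := rapid_shiftr ra; have rsb := rapid_shiftr rb.
rewrite !limn_pseriesD; [|by repeat (apply: rapidZ || apply: rapidD)..].
rewrite !limn_pseriesZ//; rewrite !limn_pseries_shiftr// -/(P u) -/(Q u).
by congr is_derive; rewrite /A' /B'; move: (pi) => p; ring.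
Qed.

Let dQ (u : R) : is_derive u 1 Q (A' u * Q u + B' u * P u).
Proof.
have := rapid_is_derive u rb; rewrite db.
have rsa := rapid_shiftr ra; have rsb := rapid_shiftr rb.
rewrite !limn_pseriesD; [|by repeat (apply: rapidZ || apply: rapidD)..].
rewrite !limn_pseriesZ//; rewrite !limn_pseries_shiftr// -/(P u) -/(Q u).
by congr is_derive; rewrite /A' /B'; move: (pi) => p; ring.
Qed.

Let dA (u : R) : is_derive u 1 A (A' u).
Proof.
by apply: is_derive_eq; rewrite /A' /GRing.scale /=; move: (pi) => p; field.
Qed.

Let dB (u : R) : is_derive u 1 B (B' u).
Proof.
by apply: is_derive_eq; rewrite /B' /GRing.scale /=; move: (pi) => p; field.
Qed.

Let at0 c : limn (pseries c (0 : R)) = c 0%N.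
Proof.
apply: cvg_lim => //; rewrite -cvg_shiftS.
rewrite (_ : (fun n => _) = cst (c 0%N)); first exact: cvg_cst.
apply/funext => n; rewrite /pseries /series /= big_nat_recl//= expr0 mulr1 big1 ?addr0// => i _.
by rewrite exprS mul0r mulr0.
Qed.

Let AA := 2 * pi * s * x - pi * X2 / 2.
Let BB := 2 * pi * s * y - pi * Y2 / 2.

Lemma hermite_gen :
  (series a @ \oo --> expR AA * cos BB) /\ (series b @ \oo --> expR AA * sin BB).
Proof.
have E1 : expR AA * cos BB = P 1 /\ expR AA * sin BB = Q 1.
  have -> : AA = A 1 by rewrite /A /AA expr1n !mulr1.
  have -> : BB = B 1 by rewrite /B /BB expr1n !mulr1.
  have [] := linear_ode_solution dP dQ dA dB; rewrite ?/A ?/B ?/P ?/Q ?at0 ?/a ?/b ?expr0 ?mulr0 ?mul0r ?expr0n/= ?mulr0 ?mul0r ?subrr ?hp0 ?hornerC ?mul1r//.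
have s1 c : pseries c 1 = series c.
  by apply/funext => n; rewrite /pseries /series /=; apply: eq_bigr => i _; rewrite expr1n mulr1.
by rewrite E1.1 E1.2; split; rewrite -s1; [exact: (rapid_cvg (u := 1) ra)|exact: (rapid_cvg (u := 1) rb)].
Qed.

End generating_function.

(** * Hermite expansion of the Gabor atoms *)

Section gabor_series.
Context {R : realType}.
Local Notation nc := (@Normc.normc R).
Implicit Types (p : R * R) (z : R[i]).

(** The squared norm of the Gaussian, carried as an unevaluated positive constant. *)
Definition c0 : R := Lg 1.

Lemma c0_gt0 : 0 < c0. Proof. exact: Lg1_gt0. Qed.

Definition kap2 (n : nat) : R := n`!%:R / pi ^+ n.

Lemma kap2_gt0 n : 0 < kap2 n.
Proof. by rewrite divr_gt0 ?ltr0n ?fact_gt0// exprn_gt0// pi_gt0. Qed.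

Lemma inner_phiE n m : inner (phi n) (phi m) = (((n == m)%:R * (c0 / kap2 n))%:C)%C.
Proof.
rewrite inner_phi Lg_hp /kap2 invfM invrK; congr (_%:C)%C; rewrite -/c0.
by rewrite -mulrA; congr (_ * _); rewrite mulrC [pi ^+ n / _]mulrC.
Qed.

Definition phi_sum (c : nat -> R[i]) (N : nat) : R -> R[i] :=
  fun s => \sum_(0 <= n < N) c n * phi n s.

Lemma L2_phi_sum c N : L2 (phi_sum c N).
Proof. by apply: L2_sum => i _; apply: L2Z; exact: L2_phi. Qed.

Lemma inner_phi_sum c N m :
  inner (phi_sum c N) (phi m) = (m < N)%:R * (c m * ((c0 / kap2 m)%:C)%C).
Proof.
rewrite /phi_sum inner_suml; [|exact: L2_phi|by move=> i; apply: L2Z; exact: L2_phi].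
transitivity (\sum_(0 <= i < N) c i * (((i == m)%:R * (c0 / kap2 i))%:C)%C).
  by apply: eq_bigr => i _; rewrite innerZl ?inner_phiE//; exact: L2_phi.
have [mN|mN] := ltnP m N.
  rewrite mul1r (bigD1_seq m)/= ?mem_index_iota ?iota_uniq// eqxx mul1r big1 ?addr0// => i im.
  by rewrite (negbTE im) mul0r mulr0.
rewrite mul0r big_nat big1// => i /andP[_ iN].
by rewrite ltn_eqF ?mul0r ?mulr0//; exact: leq_trans iN mN.
Qed.

Lemma phi_sumS c N : phi_sum c N.+1 = (fun s => phi_sum c N s + c N * phi N s).
Proof. by apply/funext => s; rewrite /phi_sum big_nat_recr. Qed.

Lemma nrm_phi_sq n : nrm (phi n : R -> R[i]) ^+ 2 = c0 / kap2 n.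
Proof.
apply: (@complexI R); rewrite -inner_self; last exact: L2_phi.
by rewrite inner_phiE eqxx mul1r.
Qed.

Lemma nrm_phi_sum c N : nrm (phi_sum c N) ^+ 2 = c0 * \sum_(0 <= n < N) sq (c n) / kap2 n.
Proof.
elim: N => [|N ih].
  rewrite big_nil mulr0 (_ : phi_sum c 0 = fun _ => 0) ?nrm0 ?expr0n//.
  by apply/funext => s; rewrite /phi_sum big_nil.
have LN := L2_phi_sum c N; have Lp := @L2_phi R N.
rewrite phi_sumS nrm_sqD//; last exact: L2Z.
rewrite ih innerZr// inner_phi_sum ltnn mul0r mulr0 /= mulr0 addr0.
rewrite nrmZ// exprMn nc_sq nrm_phi_sq big_nat_recr//= mulrDr; congr (_ + _).
by rewrite mulrCA mulrA.
Qed.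

(** One term of the exponential series at 4 r pi. The ratio 1/4 for squared norms yields the rate
    1/2 for norms. *)
Lemma kap2_geom (r : R) : 0 <= r -> exists2 C : R, 0 <= C & forall n, r ^+ n / kap2 n <= C * 4^-1 ^+ n.
Proof.
move=> r0; exists (expR (4 * r * pi)); first exact: expR_ge0.
move=> n; have q0 : 0 <= 4 * r * pi by rewrite !mulr_ge0// pi_ge0.
have h : (4 * r * pi) ^+ n / n`!%:R <= expR (4 * r * pi).
  case: n => [|n]; first by rewrite expr0 fact0 divr1; apply: le_trans (expR_ge1Dx _); rewrite lerDl.
  by apply: le_trans (expR_ge1Dxn n q0); rewrite lerDr.
rewrite exprVn ler_pdivlMr ?exprn_gt0//; apply: le_trans h.
rewrite /kap2 !exprMn invf_div le_eqVlt; apply/orP; left; apply/eqP.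
by rewrite !mulrA; ring.
Qed.

(** The factor left by completing the square: [gabor p] is [omega p] times the sum of the
    [cpx p ^+ n * phi n]. *)
Definition omega p : R[i] :=
  ((expR (- (pi * (p.1 ^+ 2 + p.2 ^+ 2) / 2)))%:C)%C * expi (pi * p.1 * p.2).

Lemma nc_expi (t : R) : nc (expi t) = 1.
Proof. by rewrite ncE /sq /expi /= cos2Dsin2 sqrtr1. Qed.

Lemma nc_omega p : nc (omega p) = expR (- (pi * (p.1 ^+ 2 + p.2 ^+ 2) / 2)).
Proof. by rewrite ncM nc_expi mulr1 nc_real ger0_norm// expR_ge0. Qed.

Lemma omega_neq0 p : omega p != 0.
Proof. by rewrite -nc_gt0 nc_omega expR_gt0. Qed.

Definition cpx p : R[i] := (p.1 +i* p.2)%C.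

Definition gabor_part p (N : nat) : R -> R[i] :=
  phi_sum (fun n => omega p * cpx p ^+ n) N.

Lemma gabor_part_cvg p (s : R) :
  (complex.Re (gabor_part p N s) @[N --> \oo] --> complex.Re (gabor p s)) /\
  (complex.Im (gabor_part p N s) @[N --> \oo] --> complex.Im (gabor p s)).
Proof.
set z := cpx p.
pose a n := complex.Re (z ^+ n) * (hp n).[s].
pose b n := complex.Im (z ^+ n) * (hp n).[s].
have [ca cb] := hermite_gen s z; rewrite -/a -/b in ca cb.
set AA := 2 * pi * s * _ - _ in ca cb; set BB := 2 * pi * s * _ - _ in ca cb.
set e := expR (- (pi * s ^+ 2)).
have partE N : gabor_part p N s =
    omega p * ((e * series a N) +i* (e * series b N))%C.
  rewrite /gabor_part /phi_sum.
  under eq_bigr do rewrite -mulrA; rewrite -mulr_sumr; congr (_ * _).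
  rewrite /series /=; elim: N => [|N ih]; first by rewrite !big_nil mulr0.
  rewrite !big_nat_recr//= ih {ih}/phi -/e /a /b.
  case: (z ^+ N) => u v; apply/eqP; rewrite eq_complex /=; apply/andP.
  by split; apply/eqP; ring.
have gabE : gabor p s = omega p * ((e * (expR AA * cos BB)) +i* (e * (expR AA * sin BB)))%C.
  rewrite /gabor /tf_shift /omega /gaussian.
  have -> : 2 * pi * p.2 * s = pi * p.1 * p.2 + BB.
    by rewrite /BB /z /cpx /=; move: (pi) => q; field.
  have -> : expR (- (pi * (s - p.1) ^+ 2)) =
      expR (- (pi * (p.1 ^+ 2 + p.2 ^+ 2) / 2)) * (e * expR AA).
    rewrite /e -!expRD; congr expR; rewrite /AA /z /cpx /=; by move: (pi) => q; field.
  rewrite /expi (cosD _ BB) (sinD _ BB); set o := expR (- (_ / 2)).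
  apply/eqP; rewrite eq_complex /=; apply/andP; split; apply/eqP; ring.
have cga : e * series a N @[N --> \oo] --> e * (expR AA * cos BB).
  by apply: cvgM => //; exact: cvg_cst.
have cgb : e * series b N @[N --> \oo] --> e * (expR AA * sin BB).
  by apply: cvgM => //; exact: cvg_cst.
rewrite gabE; case: (omega p) partE => u v partE; split.
  under eq_fun do rewrite partE /=; rewrite /=.
  by apply: cvgB; apply: cvgM => //; exact: cvg_cst.
under eq_fun do rewrite partE /=; rewrite /=.
by apply: cvgD; apply: cvgM => //; exact: cvg_cst.
Qed.

Lemma gabor_part_step p : exists2 C : R, 0 <= C & forall N,
  nrm (fun s => gabor_part p N.+1 s - gabor_part p N s) <= C * 2^-1 ^+ N.
Proof.
set r := nc (cpx p) ^+ 2.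
have r0 : 0 <= r by rewrite sqr_ge0.
have [C C0 hC] := kap2_geom r0.
exists (nc (omega p) * Num.sqrt (c0 * C)); first by rewrite mulr_ge0 ?nc_ge0 ?sqrtr_ge0.
move=> N; rewrite /gabor_part phi_sumS.
rewrite (_ : (fun s => _) = (fun s => omega p * cpx p ^+ N * phi N s)); last first.
  by apply/funext => s; rewrite addrAC subrr add0r.
rewrite nrmZ; last exact: L2_phi.
rewrite ncM ncX -!mulrA; apply: ler_wpM2l; first exact: nc_ge0.
rewrite -(ler_pXn2r (n := 2))// ?nnegrE ?mulr_ge0 ?exprn_ge0 ?nc_ge0 ?nrm_ge0 ?sqrtr_ge0//.
rewrite exprMn nrm_phi_sq exprMn sqr_sqrtr ?mulr_ge0 ?(ltW c0_gt0)//.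
rewrite -exprM mulnC exprM -/r mulrCA -mulrA; apply: ler_wpM2l; first exact: ltW c0_gt0.
apply: le_trans (hC N) _; apply: ler_wpM2l => //.
by rewrite -exprM mulnC exprM; apply: lerXn2r; rewrite ?nnegrE ?invr_ge0 ?exprn_ge0//; lra.
Qed.

Lemma gabor_approx p : L2 (gabor p) /\ exists2 C : R, 0 <= C &
  forall N, nrm (fun s => gabor p s - gabor_part p N s) <= C * 2^-1 ^+ N.
Proof.
have [C C0 hC] := gabor_part_step p.
have [Lg hg] := L2_complete_pointwise (fun N => L2_phi_sum _ N) hC (gabor_part_cvg p).
by split => //; exists (C * 2); [rewrite mulr_ge0|].
Qed.

Lemma L2_gabor p : L2 (gabor p). Proof. by case: (gabor_approx p). Qed.

Lemma cvg_half (C : R) : C * 2^-1 ^+ N @[N --> \oo] --> (0 : R).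
Proof.
have := @cvg_geometric R C 2^-1; rewrite /geometric /=; apply.
by rewrite ger0_norm ?invr_ge0// invf_lt1// ltr1n.
Qed.

Lemma le_half (x y C : R) : (forall N, x <= y + C * 2^-1 ^+ N) -> x <= y.
Proof.
move=> h; rewrite leNgt; apply/negP => yx.
have xy0 : 0 < x - y by rewrite subr_gt0.
have [N _ /(_ N (leqnn N)) /=] := cvgr_lt _ (cvg_half C) _ xy0.
by have := h N; lra.
Qed.

Lemma inner_gabor_phi p m :
  inner (gabor p) (phi m) = omega p * cpx p ^+ m * ((c0 / kap2 m)%:C)%C.
Proof.
have [Lg [C C0 hC]] := gabor_approx p.
apply/eqP; rewrite -subr_eq0 -nc_eq0 eq_le nc_ge0 andbT.
apply: (@le_half _ _ (C * nrm (phi m : R -> R[i]))) => N; rewrite add0r.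
have LP k := L2_phi_sum (fun n => omega p * cpx p ^+ n) k.
have E k : (m < k)%N -> inner (gabor p) (phi m) - omega p * cpx p ^+ m * ((c0 / kap2 m)%:C)%C =
    inner (fun s => gabor p s - gabor_part p k s) (phi m).
  move=> mk.
  rewrite (_ : (fun s => _) = (fun s => gabor p s + (-1) * gabor_part p k s)); last first.
    by apply/funext => s; rewrite mulN1r.
  have := L2_phi m; have := LP k => LPk Lm.
  by rewrite innerDl//; [rewrite innerZl// inner_phi_sum mk mul1r mulN1r|exact: L2Z].
have mk : (m < m.+1 + N)%N by rewrite ltnS leq_addr.
rewrite (E _ mk); apply: le_trans (inner_le (L2B Lg (LP _)) (L2_phi m)) _.
apply: le_trans (ler_wpM2r (nrm_ge0 _) (hC _)) _.
rewrite mulrAC; apply: ler_wpM2l; first by rewrite mulr_ge0// nrm_ge0.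
by rewrite exprD ger_pMl ?exprn_gt0// exprn_ile1//; lra.
Qed.

Lemma sum_exp_le (x : R) N : 0 <= x -> \sum_(0 <= n < N) x ^+ n / n`!%:R <= expR x.
Proof.
move=> x0.
have h : nondecreasing_seq (series (exp_coeff x)).
  apply/nondecreasing_seqP => n; rewrite /series /= big_nat_recr//= lerDl.
  by rewrite /exp_coeff /= divr_ge0// exprn_ge0.
have := nondecreasing_cvgn_le h (is_cvg_series_exp_coeff x) N; apply: le_trans.
by rewrite /series /=; apply: ler_sum => i _; rewrite /exp_coeff.
Qed.

Lemma nrm_gabor p : nrm (gabor p) <= Num.sqrt c0.
Proof.
have [Lg [C C0 hC]] := gabor_approx p.
apply: (@le_half _ _ C) => N.
have LP := L2_phi_sum (fun n => omega p * cpx p ^+ n) N.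
rewrite (_ : gabor p = (fun s => (gabor p s - gabor_part p N s) + gabor_part p N s)); last first.
  by apply/funext => s; rewrite subrK.
apply: le_trans (nrmD (L2B Lg LP) LP) _; rewrite addrC; apply: lerD (hC N).
rewrite -(ler_pXn2r (n := 2))// ?nnegrE ?nrm_ge0 ?sqrtr_ge0//.
rewrite nrm_phi_sum sqr_sqrtr ?(ltW c0_gt0)// ger_pMr ?c0_gt0//.
set r := p.1 ^+ 2 + p.2 ^+ 2.
have r0 : 0 <= pi * r by rewrite mulr_ge0 ?pi_ge0// addr_ge0 ?sqr_ge0.
rewrite (_ : \sum_(0 <= n < N) _ = expR (- (pi * r)) * \sum_(0 <= n < N) (pi * r) ^+ n / n`!%:R).
  by rewrite expRN ler_pdivrMl ?expR_gt0// mulr1; exact: sum_exp_le.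
rewrite mulr_sumr; apply: eq_bigr => i _.
rewrite sqM -nc_sq nc_omega -expRM_natl -nc_sq ncX -exprM mulnC exprM nc_sq -/r.
rewrite -/(sq (cpx p)) (_ : sq (cpx p) = r)// exprMn /kap2 invf_div.
rewrite -!mulrA; congr (_ * _); first by congr expR; field.
by ring.
Qed.

End gabor_series.

(** * Closed spans and the density of the Gabor atoms *)

Section closed_spans.
Context {R : realType}.
Local Notation nc := (@Normc.normc R).
Implicit Types (S T : set (R -> R[i])) (f g : R -> R[i]).

Lemma lin_span_L2 S g : S `<=` L2 -> lin_span S g -> L2 g.
Proof.
move=> SL [n [c [v [Sv ->]]]]; apply: L2_sum => i _; apply: L2Z; apply: SL; exact: Sv.
Qed.

Lemma closed_spanP S f : S `<=` L2 ->
  closed_span S f <-> L2 f /\ forall eps : R, 0 < eps ->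
    exists2 g, lin_span S g & nrm (fun s => f s - g s) < eps.
Proof.
move=> SL; split=> -[Lf h]; split => // e e0; have [g Sg gn] := h e e0; exists g => //.
  have Lg := lin_span_L2 SL Sg.
  by move: gn; rewrite norm2_nrm ?lte_fin//; exact: L2B.
have Lg := lin_span_L2 SL Sg.
by rewrite norm2_nrm ?lte_fin//; exact: L2B.
Qed.

Lemma lin_span_in S f : S f -> lin_span S f.
Proof.
move=> Sf; exists 1%N, (fun _ => 1), (fun _ => f); split => //.
by apply/funext => s; rewrite big_ord1 mul1r.
Qed.

Lemma lin_span0 S : lin_span S (fun _ => 0).
Proof.
exists 0%N, (fun _ => 0), (fun _ _ => 0); split; first by case.
by apply/funext => s; rewrite big_ord0.
Qed.

Lemma lin_spanD S f g : lin_span S f -> lin_span S g -> lin_span S (fun s => f s + g s).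
Proof.
move=> [n [c [v [Sv ->]]]] [m [d [w [Sw ->]]]].
exists (n + m)%N, (fun i => match fintype.split i with inl j => c j | inr j => d j end),
  (fun i => match fintype.split i with inl j => v j | inr j => w j end); split.
  by move=> i; case: fintype.split.
apply/funext => s; rewrite big_split_ord /=; congr (_ + _); apply: eq_bigr => i _.
  by rewrite -/(unsplit (inl i)) unsplitK.
  by rewrite -/(unsplit (inr i)) unsplitK.
Qed.

Lemma lin_spanZ S c f : lin_span S f -> lin_span S (fun s => c * f s).
Proof.
move=> [n [d [v [Sv ->]]]]; exists n, (fun i => c * d i), v; split => //.
by apply/funext => s; rewrite mulr_sumr; apply: eq_bigr => i _; rewrite mulrA.
Qed.

Lemma lin_span_sum S I (r : seq I) (F : I -> R -> R[i]) :
  (forall i, lin_span S (F i)) -> lin_span S (fun s => \sum_(i <- r) F i s).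
Proof.
move=> SF; elim: r => [|i r ih].
  by under eq_fun do rewrite big_nil; exact: lin_span0.
by under eq_fun do rewrite big_cons; exact: lin_spanD.
Qed.

Lemma lin_span_closed S f : S `<=` L2 -> lin_span S f -> closed_span S f.
Proof.
move=> SL Sf; apply/(closed_spanP _ SL); split; first exact: lin_span_L2 Sf.
move=> e e0; exists f => //.
by rewrite (_ : (fun s => _) = (fun _ => 0)) ?nrm0//; apply/funext => s; rewrite subrr.
Qed.

Lemma closed_span_lim S f : S `<=` L2 -> L2 f ->
  (forall eps : R, 0 < eps -> exists2 g, closed_span S g & nrm (fun s => f s - g s) < eps) ->
  closed_span S f.
Proof.
move=> SL Lf h; apply/(closed_spanP _ SL); split => // e e0.
have e20 : 0 < e / 2 by rewrite divr_gt0.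
have [g /(closed_spanP _ SL)[Lg hg] fg] := h _ e20.
have [k Sk gk] := hg _ e20; exists k => //.
apply: le_lt_trans (nrm_tri Lf Lg (lin_span_L2 SL Sk)) _.
by rewrite (splitr e) ltrD.
Qed.

Lemma closed_spanD S f g : S `<=` L2 -> closed_span S f -> closed_span S g ->
  closed_span S (fun s => f s + g s).
Proof.
move=> SL /(closed_spanP _ SL)[Lf hf] /(closed_spanP _ SL)[Lg hg].
apply/(closed_spanP _ SL); split; first exact: L2D.
move=> e e0; have e20 : 0 < e / 2 by rewrite divr_gt0.
have [f' Sf ff] := hf _ e20; have [g' Sg gg] := hg _ e20.
exists (fun s => f' s + g' s); first exact: lin_spanD.
have Lf' := lin_span_L2 SL Sf; have Lg' := lin_span_L2 SL Sg.
rewrite (_ : (fun s => _) = (fun s => (f s - f' s) + (g s - g' s))).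
  by apply: le_lt_trans (nrmD (L2B Lf Lf') (L2B Lg Lg')) _; rewrite (splitr e) ltrD.
by apply/funext => s; ring.
Qed.

Lemma closed_spanZ S c f : S `<=` L2 -> closed_span S f -> closed_span S (fun s => c * f s).
Proof.
move=> SL /(closed_spanP _ SL)[Lf hf].
apply/(closed_spanP _ SL); split; first exact: L2Z.
have c0 : 0 < nc c + 1 by rewrite ltr_wpDl// nc_ge0.
move=> e e0; have e20 : 0 < e / (nc c + 1) by rewrite divr_gt0.
have [f' Sf ff] := hf _ e20; exists (fun s => c * f' s); first exact: lin_spanZ.
have Lf' := lin_span_L2 SL Sf.
rewrite (_ : (fun s => _) = (fun s => c * (f s - f' s))); last first.
  by apply/funext => s; rewrite mulrBr.
rewrite nrmZ; last exact: L2B.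
move: ff; rewrite ltr_pdivlMr// => ff; apply: le_lt_trans ff.
by rewrite mulrC ler_wpM2l ?nrm_ge0// lerDl.
Qed.

Lemma closed_span_trans S T : S `<=` L2 -> T `<=` L2 ->
  S `<=` closed_span T -> closed_span S `<=` closed_span T.
Proof.
move=> SL TL ST f /(closed_spanP _ SL)[Lf h].
apply: closed_span_lim => // e e0; have [g [n [c [v [Sv ->]]]] fg] := h e e0.
exists (fun s => \sum_(i < n) c i * v i s) => //.
elim: n c v Sv {fg} => [|n ih] c v Sv.
  under eq_fun do rewrite big_ord0; apply: lin_span_closed => //; exact: lin_span0.
under eq_fun do rewrite big_ord_recl; apply: closed_spanD => //.
  by apply: closed_spanZ => //; apply: ST.
exact: ih.
Qed.

Lemma closed_span_ortho S f g : S `<=` L2 -> L2 g -> (forall u, S u -> inner u g = 0) ->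
  closed_span S f -> inner f g = 0.
Proof.
move=> SL Lg Sg /(closed_spanP _ SL)[Lf h].
apply/eqP; rewrite -nc_eq0 eq_le nc_ge0 andbT; apply/ler_addgt0Pr => e e0; rewrite add0r.
have p : 0 < nrm g + 1 by rewrite ltr_wpDl// nrm_ge0.
have [u Su fu] := h (e / (nrm g + 1)) (divr_gt0 e0 p).
have Lu := lin_span_L2 SL Su.
have -> : inner f g = inner (fun s => f s - u s) g.
  rewrite (_ : (fun s => f s - u s) = (fun s => f s + (-1) * u s)); last first.
    by apply/funext => s; rewrite mulN1r.
  rewrite innerDl//; last exact: L2Z.
  rewrite innerZl// (_ : inner u g = 0) ?mulr0 ?addr0//.
  case: Su => n [c [v [Sv ->]]].
  have Lv i : L2 (v i) by apply: SL; exact: Sv.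
  rewrite inner_suml//; last by move=> i; exact: L2Z.
  by apply: big1 => i _; rewrite innerZl// Sg ?mulr0.
apply: le_trans (inner_le (L2B Lf Lu) Lg) _.
move: fu; rewrite ltr_pdivlMr// => fu; apply: le_trans (ltW fu).
by rewrite ler_wpM2l ?nrm_ge0// lerDl.
Qed.

End closed_spans.

(** * Bernstein approximation on an interval [-W, W] *)

Section bernstein.
Context {R : realType}.
Implicit Types (x : R) (n k : nat).

Definition bern n k x : R := 'C(n, k)%:R * (x ^+ k * (1 - x) ^+ (n - k)).

Lemma bern_ge0 n k x : 0 <= x <= 1 -> 0 <= bern n k x.
Proof.
by move=> /andP[x0 x1]; rewrite mulr_ge0// mulr_ge0// exprn_ge0// subr_ge0.
Qed.

Lemma sum_bern n x : \sum_(k < n.+1) bern n k x = 1.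
Proof.
have := exprDn (1 - x) x n; rewrite subrK expr1n => ->.
by apply: eq_bigr => k _; rewrite /bern mulr_natl [_ ^+ k * _]mulrC.
Qed.

Lemma bernS n k x : k.+1%:R * bern n.+1 k.+1 x = n.+1%:R * x * bern n k x.
Proof.
rewrite /bern subSS exprS !mulrA -natrM -mul_bin_diag natrM; ring.
Qed.

Lemma sum_bern1 n x : \sum_(k < n.+1) k%:R * bern n k x = n%:R * x.
Proof.
case: n => [|n]; first by rewrite big_ord1 !mul0r.
rewrite big_ord_recl mul0r add0r; under eq_bigr do rewrite lift0 bernS.
by rewrite -mulr_sumr sum_bern mulr1.
Qed.

Lemma sum_bern2 n x : \sum_(k < n.+1) k%:R ^+ 2 * bern n k x =
  n%:R * x * (1 - x) + (n%:R * x) ^+ 2.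
Proof.
case: n => [|n]; first by rewrite big_ord1 !mul0r expr0n /= mul0r addr0 // expr0n.
rewrite big_ord_recl expr0n /= mul0r add0r.
transitivity (\sum_(k < n.+1) n.+1%:R * x * (k%:R * bern n k x + bern n k x)).
  apply: eq_bigr => k _; rewrite /bump /= add1n expr2 -mulrA bernS mulrCA; congr (_ * _).
  by rewrite -natr1; ring.
rewrite -mulr_sumr big_split /= sum_bern1 sum_bern -natr1; ring.
Qed.

(** Variance plus squared bias of the binomial mean, after [0, 1] is stretched to [-W, W]. *)
Lemma bern_var n x (W s : R) : (0 < n)%N ->
  \sum_(k < n.+1) bern n k x * (W * (2 * (k%:R / n%:R) - 1) - s) ^+ 2 =
  4 * W ^+ 2 * (x * (1 - x)) / n%:R + (W * (2 * x - 1) - s) ^+ 2.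
Proof.
move=> n0; have nz : n%:R != 0 :> R by rewrite pnatr_eq0 -lt0n.
transitivity ((2 * W / n%:R) ^+ 2 * (\sum_(k < n.+1) k%:R ^+ 2 * bern n k x)
   + (- (2 * (2 * W / n%:R) * (W + s))) * (\sum_(k < n.+1) k%:R * bern n k x)
   + (W + s) ^+ 2 * \sum_(k < n.+1) bern n k x).
  rewrite !mulr_sumr -!big_split /=; apply: eq_bigr => k _; by field.
by rewrite sum_bern sum_bern1 sum_bern2; field.
Qed.

Definition bern_approx (g : R -> R) (W : R) n x : R :=
  \sum_(k < n.+1) g (W * (2 * (k%:R / n%:R) - 1)) * bern n k x.

Lemma bern_approx_le g W n x M : 0 <= x <= 1 -> (forall t, `|g t| <= M) ->
  `|bern_approx g W n x| <= M.
Proof.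
move=> x01 gM; apply: (le_trans (ler_norm_sum _ _ _)).
rewrite -[leRHS]mulr1 -(sum_bern n x) mulr_sumr; apply: ler_sum => k _.
by rewrite normrM (ger0_norm (bern_ge0 _ _ x01)) ler_wpM2r ?bern_ge0.
Qed.

(** Chebyshev's argument: nodes closer to [s] than [d] cost [e], the others at most 2 M (t - s)^2 /
    d^2. The target [s] need not be the point of [-W, W] that corresponds to [x]; the mismatch
    enters as the squared bias. *)
Lemma bern_approx_err g W n x M (s d e : R) : (0 < n)%N -> 0 <= x <= 1 ->
  (forall t, `|g t| <= M) -> 0 < d -> (forall t, `|t - s| < d -> `|g t - g s| <= e) ->
  `|bern_approx g W n x - g s| <=
  e + 2 * M / d ^+ 2 * (4 * W ^+ 2 * (x * (1 - x)) / n%:R + (W * (2 * x - 1) - s) ^+ 2).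
Proof.
move=> n0 x01 gM d0 gd.
have M0 : 0 <= M := le_trans (normr_ge0 _) (gM 0).
have e0 : 0 <= e by apply: le_trans (gd s _); rewrite ?subrr ?normr0.
rewrite -bern_var// -[X in _ - X]mulr1 -(sum_bern n x) mulr_sumr -sumrB.
apply: (le_trans (ler_norm_sum _ _ _)).
set K := 2 * M / d ^+ 2; set q := fun k : nat => (W * (2 * (k%:R / n%:R) - 1) - s) ^+ 2.
apply: le_trans (_ : \sum_(k < n.+1) (e * bern n k x + K * (bern n k x * q k)) <= _); last first.
  by rewrite big_split /= -!mulr_sumr sum_bern mulr1.
apply: ler_sum => k _; rewrite /q; set t := W * _.
have b0 := bern_ge0 n k x01; set b := bern n k x in b0 *.
rewrite -mulrBl normrM (ger0_norm b0).
have -> : e * b + K * (b * (t - s) ^+ 2) = (e + K * (t - s) ^+ 2) * b by ring.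
apply: ler_wpM2r => //; rewrite /K => {K q}.
have [td|td] := ltP `|t - s| d.
  by apply: (le_trans (gd _ td)); rewrite lerDl; apply: mulr_ge0; [apply: divr_ge0; [exact: mulr_ge0|exact: sqr_ge0]|exact: sqr_ge0].
apply: (le_trans (ler_normB _ _)); apply: (le_trans (lerD (gM _) (gM _))).
have : 1 <= (t - s) ^+ 2 / d ^+ 2.
  rewrite ler_pdivlMr ?exprn_gt0// mul1r -[leRHS]real_normK ?num_real//.
  by rewrite ler_pXn2r ?nnegrE ?(ltW d0).
have -> : 2 * M / d ^+ 2 * (t - s) ^+ 2 = 2 * M * ((t - s) ^+ 2 / d ^+ 2) by ring.
by nra.
Qed.

End bernstein.

(** * Density of the modulated Gaussians *)

Section density.
Context {R : realType}.
Local Notation mu := (@lebesgue_measure R).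
Local Notation nc := (@Normc.normc R).
Local Notation gsn := (@gaussian R).

Lemma dominated_nrm (u : nat -> R -> R[i]) (F : R -> R[i]) :
  (forall n, measurable_cfun (u n)) -> L2 F -> (forall n s, sq (u n s) <= sq (F s)) ->
  (forall s, sq (u n s) @[n --> \oo] --> (0 : R)) ->
  forall e : R, 0 < e -> exists n, nrm (u n) < e.
Proof.
move=> mu_ LF uF u0 e e0; have /L2P[mF iF] := LF.
have Lu n : L2 (u n) by apply: L2_dom LF _.
have : (\int[mu]_s (sq (u n s))%:E @[n --> \oo] --> \int[mu]_s (cst 0 s : \bar R))%E.
  apply: (@dominated_cvg _ _ _ mu setT measurableT (fun n s => (sq (u n s))%:E) (cst 0%E)
    (fun s => (sq (F s))%:E)) => //.
  - by move=> n; apply/measurable_EFinP; exact: mcfun_sq.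
  - by move=> s _; apply: cvg_EFin; [exact: nearW|exact: u0].
  - by move=> n s _; rewrite gee0_abs ?lee_fin ?sq_ge0.
rewrite integral0 => c0.
have e20 : 0 < e ^+ 2 by rewrite exprn_gt0.
have [N _ /(_ N (leqnn N)) /=] := cvgr_lt _ (fine_cvg c0) _ e20.
rewrite -/(Rintegral _ _ _) -nrm_sq => h; exists N.
by rewrite -(ltr_pXn2r (n := 2))// ?nnegrE ?nrm_ge0// ltW.
Qed.

Lemma nrm_mono (f g : R -> R[i]) : measurable_cfun f -> L2 g ->
  (forall s, sq (f s) <= sq (g s)) -> nrm f <= nrm g.
Proof.
move=> mf Lg fg; have Lf := L2_dom mf Lg fg; rewrite ler_wsqrtr//.
have /L2P[_ fi] := Lf; have /L2P[_ gi] := Lg.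
by apply: le_Rintegral => // s _.
Qed.

Definition modulations : set (R -> R[i]) := gabor @` [set p | p.1 = 0].

Lemma modulations_L2 : modulations `<=` L2.
Proof. by move=> _ [p _ <-]; exact: L2_gabor. Qed.

Definition trig (q : R -> R[i]) := exists l : seq (R[i] * R),
  forall s, q s = \sum_(cy <- l) cy.1 * expi (cy.2 * s).

Lemma expiD (a b : R) : expi (a + b) = expi a * expi b.
Proof.
rewrite /expi cosD sinD; apply/eqP; rewrite eq_complex /=; apply/andP.
by split; apply/eqP; ring.
Qed.

Lemma trigD p q : trig p -> trig q -> trig (fun s => p s + q s).
Proof. by move=> [l hl] [m hm]; exists (l ++ m) => s; rewrite big_cat hl hm. Qed.

Lemma trig_cst c : trig (fun _ => c).
Proof.
exists [:: (c, 0)] => s; rewrite big_seq1 /= mul0r /expi cos0 sin0.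
by rewrite -[LHS]mulr1; congr (_ * _).
Qed.

Lemma trigM p q : trig p -> trig q -> trig (fun s => p s * q s).
Proof.
move=> [l hl] [m hm]; exists [seq (a.1 * b.1, a.2 + b.2) | a <- l, b <- m] => s.
rewrite big_allpairs_dep hl hm big_distrl /=; apply: eq_bigr => a _.
by rewrite big_distrr /=; apply: eq_bigr => b _; rewrite mulrDl expiD; ring.
Qed.

Lemma trigX p n : trig p -> trig (fun s => p s ^+ n).
Proof.
move=> hp_; elim: n => [|n ih]; first by under eq_fun do rewrite expr0; exact: trig_cst.
by under eq_fun do rewrite exprS; exact: trigM.
Qed.

Lemma trig_sum I (r : seq I) (F : I -> R -> R[i]) :
  (forall i, trig (F i)) -> trig (fun s => \sum_(i <- r) F i s).
Proof.
move=> hF; elim: r => [|i r ih].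
  by under eq_fun do rewrite big_nil; exact: trig_cst.
by under eq_fun do rewrite big_cons; exact: trigD.
Qed.

Lemma trig_sin (e : R) : trig (fun s => ((sin (e * s))%:C)%C).
Proof.
exists [:: ((0 -i* 2^-1)%C, e); ((0 +i* 2^-1)%C, - e)] => s.
rewrite big_cons big_seq1 /= /expi mulNr cosN sinN.
by apply/eqP; rewrite eq_complex /=; apply/andP; split; apply/eqP; field.
Qed.

Lemma trig_lin_span q : trig q -> lin_span modulations (fun s => q s * gsn s).
Proof.
move=> [l hl]; under eq_fun do rewrite hl mulr_suml.
apply: lin_span_sum => -[c y] /=.
under eq_fun do rewrite -mulrA; apply: lin_spanZ; apply: lin_span_in.
exists (0, y / (2 * pi)) => //=; apply/funext => s; rewrite /gabor /tf_shift /= subr0.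
congr (expi _ * _); have := @pi_gt0 R; move: (pi) => w w0.
by field; rewrite gt_eqF.
Qed.

Lemma sq_real_gaussian (u s : R) : sq ((u%:C)%C * gsn s) = u ^+ 2 * gw s.
Proof.
by rewrite sqM /gaussian /sq /= !expr0n !addr0 expr2 -[in RHS]expR_sqr_gw.
Qed.

Lemma mcfun_gaussian : measurable_cfun gsn.
Proof.
apply: mcfun_real; apply: continuous_measurable_fun => x.
by apply/differentiable_continuous/derivable1_diffP; exact: ex_derive.
Qed.

Lemma gw_int : mu.-integrable setT (EFin \o (@gw R)).
Proof. by have := pgw_int (1 : {poly R}); under eq_fun do rewrite hornerC mul1r. Qed.

Lemma L2_bounded_gaussian (u : R -> R) (M : R) : measurable_fun setT u ->
  (forall s, `|u s| <= M) -> L2 (fun s => ((u s)%:C)%C * gsn s).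
Proof.
move=> mu_ uM; apply/L2P.
have mf : measurable_cfun (fun s => ((u s)%:C)%C * gsn s).
  by apply: mcfunM; [exact: mcfun_real|exact: mcfun_gaussian].
split=> //.
have gi : mu.-integrable setT (fun s => (M ^+ 2)%:E * (gw s)%:E)%E.
  by apply: integrableZl => //; exact: gw_int.
apply: (le_integrable measurableT) gi; first by apply/measurable_EFinP; exact: mcfun_sq.
move=> s _; rewrite /= lee_fin (ger0_norm (sq_ge0 _)) sq_real_gaussian.
have g0 := ltW (gw_gt0 s).
have M0 : 0 <= M := le_trans (normr_ge0 _) (uM s).
rewrite [leRHS]ger0_norm ?mulr_ge0 ?sqr_ge0//; apply: ler_wpM2r => //.
by rewrite -(real_normK (num_real (u s))); apply: lerXn2r; rewrite ?nnegrE.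
Qed.

Lemma cvg_invS : n.+1%:R^-1 @[n --> \oo] --> (0 : R).
Proof. exact: cvg_harmonic. Qed.

Lemma cvg_scaled_sin (s : R) : n.+1%:R * sin (n.+1%:R^-1 * s) @[n --> \oo] --> s.
Proof.
have [->|s0] := eqVneq s 0.
  by under eq_fun do rewrite mulr0 sin0 mulr0; exact: cvg_cst.
pose h (n : nat) : R := n.+1%:R^-1 * s.
have hn n : h n != 0 by rewrite mulf_neq0// invr_neq0.
have h0 : h n @[n --> \oo] --> (0 : R).
  by rewrite -(mul0r s); apply: cvgM; [exact: cvg_invS|exact: cvg_cst].
have h0' : h n @[n --> \oo] --> (0 : R)^'.
  move=> U /= /h0 [N _ hN]; exists N => // n /= Nn; exact: hN.
have [ds dv] := is_derive_sin (0 : R).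
have c1 : (h n)^-1 *: (sin (h n *: 1 + 0) - sin 0) @[n --> \oo] --> 'D_1 sin (0 : R).
  exact: cvg_comp _ _ h0' ds.
rewrite dv cos0 in c1.
have E1 : (fun n => (h n)^-1 * sin (h n)) =
    (fun n => (h n)^-1 *: (sin (h n *: 1 + 0) - sin 0)).
  by apply/funext => n; rewrite /GRing.scale /= mulr1 addr0 sin0 subr0.
rewrite -E1 in c1.
have E2 : (fun n => n.+1%:R * sin (n.+1%:R^-1 * s)) = (fun n => s * ((h n)^-1 * sin (h n))).
  by apply/funext => n; rewrite /h; field; rewrite s0 addrC natr1 pnatr_eq0.
rewrite E2 -[X in _ --> X](mulr1 s); apply: cvgM; [exact: cvg_cst|exact: c1].
Qed.

(** Bernstein polynomials in sin (s / (n + 1)), for the interval of half-length n + 1, are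
    trigonometric polynomials bounded by [M] on the whole line. Dominated convergence against the
    Gaussian then asks only for pointwise convergence, which follows from (n + 1) sin (s / (n + 1))
    -> s. *)
Lemma continuous_closed_span (g : R -> R) (M : R) : continuous g -> (forall s, `|g s| <= M) ->
  closed_span modulations (fun s => ((g s)%:C)%C * gsn s).
Proof.
move=> cg gM.
have M0 : 0 <= M := le_trans (normr_ge0 _) (gM 0).
have mg : measurable_fun setT g by exact: continuous_measurable_fun.
pose x n (s : R) : R := (1 + sin (n.+1%:R^-1 * s)) / 2.
have x01 n s : 0 <= x n s <= 1.
  by rewrite /x; have := sin_geN1 (n.+1%:R^-1 * s); have := sin_le1 (n.+1%:R^-1 * s); lra.
(* Degree (n + 1)^3 pushes the variance, of order (n + 1)^2 over the degree, to 0. *)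
pose Q n s := bern_approx g n.+1%:R (n.+1 ^ 3) (x n s).
have QM n s : `|Q n s| <= M by apply: bern_approx_le.
have Qs n : lin_span modulations (fun s => ((Q n s)%:C)%C * gsn s).
  apply: trig_lin_span; rewrite /Q /bern_approx.
  under eq_fun do rewrite rmorph_sum; apply: trig_sum => k.
  have tx : trig (fun s => ((x n s)%:C)%C).
    rewrite /x; under eq_fun do rewrite rmorphM rmorphD /=.
    by apply: trigM; [apply: trigD; [exact: trig_cst|exact: trig_sin]|exact: trig_cst].
  have tx' : trig (fun s => ((1 - x n s)%:C)%C).
    under eq_fun do rewrite rmorphB -mulN1r /=.
    by apply: trigD; [exact: trig_cst|apply: trigM => //; exact: trig_cst].
  rewrite /bern; under eq_fun do rewrite !rmorphM !rmorphXn /=.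
  apply: trigM; first exact: trig_cst.
  apply: trigM; first exact: trig_cst.
  by apply: trigM; exact: trigX.
have cx n : continuous (x n).
  move=> s; apply/differentiable_continuous/derivable1_diffP; exact: ex_derive.
have mQ n : measurable_fun setT (Q n).
  rewrite /Q /bern_approx; apply: measurable_sum => k; apply: measurable_funM => //.
  apply: measurable_funM => //; apply: measurable_funM; apply: measurable_funX.
    exact: continuous_measurable_fun.
  apply: measurable_funB => //; exact: continuous_measurable_fun.
have LQ n := L2_bounded_gaussian (mQ n) (QM n).
have Lg := L2_bounded_gaussian mg gM.
have L2M : L2 (fun s => ((2 * M)%:C)%C * gsn s).
  by apply: (L2_bounded_gaussian (u := cst (2 * M)) (M := `|2 * M|)).
apply: (closed_span_lim modulations_L2) => // e e0.
have mD n : measurable_cfun (fun s => ((g s - Q n s)%:C)%C * gsn s).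
  by apply: mcfunM; [apply: mcfun_real; exact: measurable_funB|exact: mcfun_gaussian].
have dD n s : sq (((g s - Q n s)%:C)%C * gsn s) <= sq (((2 * M)%:C)%C * gsn s).
  rewrite !sq_real_gaussian; apply: ler_wpM2r; first exact/ltW/gw_gt0.
  rewrite -(real_normK (num_real (g s - _))); apply: lerXn2r; rewrite ?nnegrE ?mulr_ge0//.
  by apply: (le_trans (ler_normB _ _)); have := gM s; have := QM n s; lra.
have cD s : sq (((g s - Q n s)%:C)%C * gsn s) @[n --> \oo] --> (0 : R).
  under eq_fun do rewrite sq_real_gaussian.
  rewrite -(mul0r (gw s)); apply: cvgM; last exact: cvg_cst.
  suff c : Q n s @[n --> \oo] --> g s.
    rewrite -(mulr0 (0 : R)); under eq_fun do rewrite expr2.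
    by apply: cvgM; rewrite -[X in _ --> X](subrr (g s)); apply: cvgB => //; exact: cvg_cst.
  apply/cvgrPdist_le => /= d d0.
  have d20 : 0 < d / 2 by rewrite divr_gt0.
  have /cvgrPdist_le /(_ _ d20) [r /= r0 hr] := cg s.
  pose err n := n.+1%:R^-1 + (n.+1%:R * sin (n.+1%:R^-1 * s) - s) ^+ 2.
  have cerr : 2 * M / r ^+ 2 * err n @[n --> \oo] --> (0 : R).
    rewrite -(mulr0 (2 * M / r ^+ 2)); apply: cvgM; first exact: cvg_cst.
    rewrite -[X in _ --> X]addr0; apply: cvgD; first exact: cvg_invS.
    rewrite -(mulr0 (0 : R)); under eq_fun do rewrite expr2.
    have c1 : n.+1%:R * sin (n.+1%:R^-1 * s) - s @[n --> \oo] --> (0 : R).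
      by rewrite -[X in _ --> X](subrr s); apply: cvgB; [exact: cvg_scaled_sin|exact: cvg_cst].
    exact: cvgM.
  have [N _ hN] := cvgr_lt _ cerr _ d20.
  exists N => // n /= /hN /= hn; rewrite distrC.
  apply: le_trans (bern_approx_err (n.+1%:R) _ (x01 n s) gM r0 (e := d / 2) _) _.
  - by rewrite expn_gt0.
  - by move=> t ts; rewrite distrC; apply: hr; rewrite /ball_ /= distrC.
  rewrite [leRHS](splitr d); apply: lerD => //; apply: le_trans (ltW hn).
  apply: ler_wpM2l; first by rewrite divr_ge0 ?mulr_ge0 ?exprn_ge0// ltW.
  apply: lerD; last by rewrite /x (_ : 2 * _ - 1 = sin (n.+1%:R^-1 * s))//; field.
  have n0 : 0 < n.+1%:R :> R by rewrite ltr0n.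
  rewrite natrX ler_pdivrMr ?exprn_gt0//.
  have -> : n.+1%:R^-1 * n.+1%:R ^+ 3 = n.+1%:R ^+ 2 :> R by field; rewrite addrC natr1 gt_eqF.
  have := x01 n s; have := sqr_ge0 (2 * x n s - 1); have := sqr_ge0 (n.+1%:R : R); nra.
have [n hn] := dominated_nrm mD L2M dD cD e0.
exists (fun s => ((Q n s)%:C)%C * gsn s); first exact: lin_span_closed modulations_L2 (Qs n).
move: hn; congr (_ < _); congr nrm; apply/funext => s.
by rewrite -mulrBl -rmorphB.
Qed.

Lemma bounded_closed_span (v : R -> R) (M m : R) : measurable_fun setT v ->
  (forall s, `|v s| <= M) -> (forall s, m < `|s| -> v s = 0) ->
  closed_span modulations (fun s => ((v s)%:C)%C * gsn s).
Proof.
move=> mv vM vm.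
have M0 : 0 <= M := le_trans (normr_ge0 _) (vM 0).
have Lv := L2_bounded_gaussian mv vM.
apply: (closed_span_lim modulations_L2) => // e e0.
pose E (n : nat) : set R := `[- n%:R, n%:R]%classic.
have mE n : measurable (E n) by exact: measurable_itv.
have e20 : 0 < e / 2 by rewrite divr_gt0.
have mI n : measurable_fun setT (\1_(~` E n) : R -> R).
  by apply: measurable_indic; exact: measurableC.
have LM : L2 (fun s => (M%:C)%C * gsn s).
  by apply: (L2_bounded_gaussian (u := cst M) (M := M)) => // s; rewrite ger0_norm.
have tail (k : nat) : exists n, (k <= n)%N /\ nrm (fun s => ((M * \1_(~` E n) s)%:C)%C * gsn s) < e / 2.
  have mD n : measurable_cfun (fun s => ((M * \1_(~` E (n + k)%N) s)%:C)%C * gsn s).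
    by apply: mcfunM; [apply: mcfun_real; apply: measurable_funM|exact: mcfun_gaussian].
  have dD n s : sq (((M * \1_(~` E (n + k)%N) s)%:C)%C * gsn s) <= sq ((M%:C)%C * gsn s).
    rewrite !sq_real_gaussian; apply: ler_wpM2r; first exact/ltW/gw_gt0.
    rewrite indicE; case: (_ \in _); rewrite ?mulr1// mulr0 expr0n sqr_ge0//.
  have cD s : sq (((M * \1_(~` E (n + k)%N) s)%:C)%C * gsn s) @[n --> \oo] --> (0 : R).
    apply: cvg_near_cst; exists (Num.truncn `|s|).+1 => // n /= sn.
    rewrite sq_real_gaussian indicE memNset ?mulr0 ?expr0n ?mul0r//=.
    rewrite /E /= in_itv /= -ler_norml; apply; apply/ltW/(lt_le_trans (truncnS_gt _)).
    by rewrite ler_nat (leq_trans sn)// leq_addr.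
  have [n hn] := dominated_nrm mD LM dD cD e20.
  by exists (n + k)%N; split => //; rewrite leq_addl.
have [n [mn tn]] := tail (Num.truncn `|m|).+1.
have vE s : ~ E n s -> v s = 0.
  move=> nE; apply: vm; rewrite ltNge; apply/negP => sm; apply: nE.
  rewrite /E /= in_itv /= -ler_norml; apply: (le_trans sm).
  apply: (le_trans (ler_norm m)); apply/ltW/(lt_le_trans (truncnS_gt _)).
  by rewrite ler_nat.
have muE : (mu (E n) < +oo)%E.
  by rewrite /E lebesgue_measure_itv/=; case: ifP => // _; rewrite -EFinB ltry.
have vi : mu.-integrable (E n) (EFin \o v).
  apply: measurable_bounded_integrable => //.
  - exact: mE.
  - exact: measurable_funTS.
  - by exists M; split; [exact: num_real|move=> x Mx s _; exact: le_trans (vM s) (ltW Mx)].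
have [h_ [ch ih lim]] := approximation_continuous_integrable (mE n) muE vi.
(* An L1 approximation suffices: after clipping, the squared difference is at most 2 M times its
   modulus. *)
have d0 : 0 < (e / 2) ^+ 2 / (2 * M + 1) by rewrite divr_gt0 ?exprn_gt0// ltr_wpDl ?mulr_ge0.
have [k _ /(_ k (leqnn k)) /=] := cvgr_lt _ (fine_cvg lim) _ d0.
set h := h_ k => hk.
(* Clipping to [-M, M] moves [h] no farther from [v], whose values lie in this interval. *)
pose g s := Num.max (- M) (Num.min M (h s)).
have cg : continuous g.
  apply: (max_fun_continuous (f := cst (- M)) (g := (cst M) \min h)); first exact: cst_continuous.
  by apply: min_fun_continuous; [exact: cst_continuous|exact: ch].
have gM s : `|g s| <= M.
  rewrite /g ler_norml le_max lexx /= ge_max ge_min lexx /= andbT; lra.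
have vg s : `|v s - g s| <= `|v s - h s|.
  have := vM s; rewrite ler_norml => /andP[v1 v2]; rewrite /g.
  have [hM|hM] := leP M (h s).
    rewrite (max_idPr _); last by lra.
    by rewrite ler0_norm ?subr_le0// ler0_norm; lra.
  have [hm|hm] := leP (h s) (- M); last by [].
  by rewrite ger0_norm ?opprK ?ger0_norm; lra.
have mg := continuous_measurable_fun cg.
have Lg := L2_bounded_gaussian mg gM.
exists (fun s => ((g s)%:C)%C * gsn s); first exact: continuous_closed_span gM.
have mIE : measurable_fun setT (\1_(E n) : R -> R) by exact: measurable_indic.
have vg2 s : `|v s - g s| <= 2 * M.
  by apply: (le_trans (ler_normB _ _)); have := vM s; have := gM s; lra.
have mvg : measurable_fun setT (fun s => v s - g s) by exact: measurable_funB.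
pose u1 s := ((((v s - g s) * \1_(E n) s))%:C)%C * gsn s.
pose u2 s := ((((v s - g s) * \1_(~` E n) s))%:C)%C * gsn s.
have L1 : L2 u1.
  apply: (L2_bounded_gaussian (M := 2 * M)); first exact: measurable_funM.
  move=> s; rewrite indicE; case: (_ \in _); rewrite ?mulr1// mulr0 normr0 mulr_ge0//.
have Lu2 : L2 u2.
  apply: (L2_bounded_gaussian (M := 2 * M)); first exact: measurable_funM.
  move=> s; rewrite indicE; case: (_ \in _); rewrite ?mulr1// mulr0 normr0 mulr_ge0//.
rewrite (_ : (fun s => _) = (fun s => u1 s + u2 s)); last first.
  apply/funext => s; rewrite /u1 /u2 -mulrDl -rmorphD /= -mulrDr -mulrBl -rmorphB /=.
  congr (_ * _); rewrite !indicE in_setC; case: (_ \in _); rewrite /= ?addr0 ?add0r mulr1//.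
apply: le_lt_trans (nrmD L1 Lu2) _; rewrite (splitr e); apply: ltrD; last first.
  apply: le_lt_trans tn; apply: nrm_mono => //; first exact: L2m.
    apply: (L2_bounded_gaussian (M := M)); first exact: measurable_funM.
    move=> s; rewrite indicE; case: (_ \in _); rewrite ?mulr1 ?ger0_norm// mulr0//.
  move=> s; rewrite /u2 !sq_real_gaussian; apply: ler_wpM2r; first exact/ltW/gw_gt0.
  rewrite indicE; have [sE|sE] := boolP (s \in _); last by rewrite !mulr0.
  rewrite !mulr1 vE; last by move: sE; rewrite inE.
  rewrite sub0r sqrrN -(real_normK (num_real (g s))); apply: lerXn2r; rewrite ?nnegrE//.
rewrite -(ltr_pXn2r (n := 2))// ?nnegrE ?nrm_ge0 ?(ltW e20)//.
have hE : mu.-integrable (E n) (EFin \o (fun s => `|v s - h s|)).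
  have ihk : mu.-integrable (E n) (EFin \o h).
    apply: continuous_compact_integrable; first exact: segment_compact.
    by apply: continuous_subspaceT; exact: ch.
  have H : mu.-integrable (E n) ((EFin \o v) \- (EFin \o h))%E by apply: integrableB; [exact: mE|exact: vi|exact: ihk].
  by apply: integrable_norm; rewrite (_ : EFin \o _ = ((EFin \o v) \- (EFin \o h))%E).
have M1 : 0 < 2 * M + 1 by rewrite ltr_wpDl// mulr_ge0.
apply: (@le_lt_trans _ _ ((2 * M + 1) * \int[mu]_(s in E n) `|v s - h s|)); last first.
  rewrite mulrC -ltr_pdivlMr//; exact: hk.
rewrite nrm_sq -[leRHS]RintegralZl; [|exact: mE|exact: hE].
rewrite (_ : \int[mu]_s sq (u1 s) = \int[mu]_(s in E n) sq (u1 s)); last first.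
  rewrite [RHS]Rintegral_mkcond; apply: eq_Rintegral => s _; rewrite patchE.
  case: ifPn => // sE; rewrite /u1 indicE (negbTE sE) mulr0 rmorph0 mul0r /sq /= expr0n addr0//.
apply: le_Rintegral; first exact: mE.
- have /L2P[_ i1] := L1; apply: (integrableS measurableT) i1 => //; exact: mE.
- rewrite /comp; under eq_fun do rewrite EFinM; apply: integrableZl; [exact: mE|exact: hE].
- move=> s sE; rewrite /u1 sq_real_gaussian indicE mem_set// mulr1.
  have g1 : gw s <= 1.
    rewrite /gw -[leRHS]expR0 ler_expR oppr_le0; apply: mulr_ge0; last exact: sqr_ge0.
    by rewrite mulr_ge0// pi_ge0.
  have g0 := gw_gt0 s; have := vg2 s; have := vg s; have := normr_ge0 (v s - g s).
  rewrite -(real_normK (num_real (v s - g s))); set a := `|v s - g s|; set b := `|v s - h s| => a0 ab a2.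
  apply: (@le_trans _ _ (a ^+ 2)); first exact: ler_piMr (sqr_ge0 a) g1.
  by nra.
Qed.

Lemma L2_closed_span : L2 `<=` closed_span modulations.
Proof.
move=> f Lf; have [mfr mfi] := L2m Lf.
pose ig s : R := expR (pi * s ^+ 2).
have igE s : ((ig s)%:C)%C * gsn s = 1.
  by rewrite /gaussian -rmorphM /= /ig -expRD subrr expR0.
(* On [A n] the quotient of [f] by the Gaussian is bounded and lives on a bounded set, so
   [bounded_closed_span] applies; these sets exhaust the line. *)
pose A (n : nat) : set R := [set s | `|s| <= n%:R] `&` [set s | ig s * nc (f s) <= n%:R].
have mig : measurable_fun setT ig.
  apply: continuous_measurable_fun => x.
  by apply/differentiable_continuous/derivable1_diffP; exact: ex_derive.
have mnc : measurable_fun setT (fun s => nc (f s)).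
  under eq_fun do rewrite ncE.
  exact: (measurableT_comp (continuous_measurable_fun (@sqrt_continuous R)) (mcfun_sq (L2m Lf))).
have mA n : measurable (A n).
  apply: measurableI.
    rewrite (_ : [set s | _] = `[- n%:R, n%:R]%classic); first exact: measurable_itv.
    by apply/seteqP; split => s /=; rewrite in_itv /= -ler_norml.
  rewrite -[X in measurable X]setTI.
  apply: measurable_fun_ler => //; exact: measurable_funM.
have mI n : measurable_fun setT (\1_(A n) : R -> R) by exact: measurable_indic.
have comp n : closed_span modulations (fun s => ((\1_(A n) s)%:C)%C * f s).
  have part (w : R -> R) : measurable_fun setT w -> (forall s, `|w s| <= nc (f s)) ->
      closed_span modulations (fun s => ((\1_(A n) s * ig s * w s)%:C)%C * gsn s).
    move=> mw wf; apply: (bounded_closed_span (M := n%:R) (m := n%:R)).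
    - by apply: measurable_funM => //; exact: measurable_funM.
    - move=> s; rewrite indicE; have [sA|sA] := boolP (s \in _); last by rewrite !mul0r normr0.
      rewrite mul1r normrM (ger0_norm (expR_ge0 _)).
      move: sA; rewrite inE => -[_ /=]; apply: le_trans; apply: ler_wpM2l; [exact: expR_ge0|exact: wf].
    - move=> s ns; rewrite indicE memNset ?mul0r// => -[/= + _].
      by rewrite leNgt ns.
  have fE : (fun s => ((\1_(A n) s)%:C)%C * f s) = (fun s =>
     ((\1_(A n) s * ig s * complex.Re (f s))%:C)%C * gsn s +
     (0 +i* 1)%C * (((\1_(A n) s * ig s * complex.Im (f s))%:C)%C * gsn s)).
    apply/funext => s; have := igE s; rewrite /gaussian => /eqP; rewrite eq_complex /=.
    move=> /andP[/eqP h _]; case: (f s) => a b.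
    have h1 : ig s * expR (- (pi * s ^+ 2)) = 1 by rewrite -[RHS]h; ring.
    apply/eqP; rewrite eq_complex /=; apply/andP; split; apply/eqP.
      transitivity (\1_(A n) s * (ig s * expR (- (pi * s ^+ 2))) * a); last by ring.
      by rewrite h1; ring.
    transitivity (\1_(A n) s * (ig s * expR (- (pi * s ^+ 2))) * b); last by ring.
    by rewrite h1; ring.
  rewrite fE; apply: (closed_spanD modulations_L2).
    by apply: part => // s; exact: Re_le_nc.
  by apply: (closed_spanZ _ modulations_L2); apply: part => // s; exact: Im_le_nc.
have mIC n : measurable_fun setT (\1_(~` A n) : R -> R).
  by apply: measurable_indic; exact: measurableC.
apply: (closed_span_lim modulations_L2) => // e e0.
have mD n : measurable_cfun (fun s => ((\1_(~` A n) s)%:C)%C * f s).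
  by apply: mcfunM; [exact: mcfun_real|exact: L2m].
have dD n s : sq (((\1_(~` A n) s)%:C)%C * f s) <= sq (f s).
  rewrite indicE; case: (_ \in _); rewrite ?mul1r// mul0r {1}/sq /= expr0n addr0 sq_ge0//.
have cD s : sq (((\1_(~` A n) s)%:C)%C * f s) @[n --> \oo] --> (0 : R).
  apply: cvg_near_cst; exists (Num.truncn (`|s| + ig s * nc (f s))).+1 => // n /= sn.
  have h0 : 0 <= ig s * nc (f s) by rewrite mulr_ge0 ?expR_ge0 ?nc_ge0.
  have h1 : `|s| + ig s * nc (f s) <= n%:R.
    apply/ltW/(lt_le_trans (truncnS_gt _)); rewrite ler_nat//.
  rewrite indicE memNset ?mul0r /sq /= ?expr0n ?addr0//; apply; split => /=.
    by apply: le_trans h1; rewrite lerDl.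
  by apply: le_trans h1; rewrite lerDr.
have [n hn] := dominated_nrm mD Lf dD cD e0.
exists (fun s => ((\1_(A n) s)%:C)%C * f s) => //.
move: hn; congr (_ < _); congr nrm; apply/funext => s.
rewrite !indicE in_setC; case: (_ \in _) => /=; rewrite ?mul0r ?mul1r ?subrr ?subr0//.
Qed.

Lemma gabor_span_sub (S : set (R -> R[i])) : S `<=` L2 ->
  (forall p, closed_span S (gabor p)) -> L2 `<=` closed_span S.
Proof.
move=> SL Sg; apply: (subset_trans L2_closed_span).
apply: closed_span_trans => //; first exact: modulations_L2.
by move=> _ [p _ <-].
Qed.

End density.

(** * Polynomials in the Bargmann picture *)

Section bargmann.
Context {R : realType}.
Local Notation nc := (@Normc.normc R).
Implicit Types (p q : {poly R[i]}) (z : R[i]).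

Definition kap (n : nat) : R := Num.sqrt (kap2 n).

Lemma kap_gt0 n : 0 < kap n. Proof. by rewrite sqrtr_gt0 kap2_gt0. Qed.

Lemma kap_sq n : kap n ^+ 2 = kap2 n. Proof. by rewrite sqr_sqrtr// ltW// kap2_gt0. Qed.

(* Inverse Bargmann transform, antilinear in [p]: pairing [gabor a] with [bg p] evaluates
   [omega a * p] at the point [a] of the complex plane. *)
Definition bg_coef p (n : nat) : R[i] := ((p`_n)^*)%C * ((kap2 n / c0)%:C)%C.

Definition bg p : R -> R[i] := phi_sum (bg_coef p) (size p).

Lemma bgE p N : (size p <= N)%N -> bg p = phi_sum (bg_coef p) N.
Proof.
move=> pN; apply/funext => s; rewrite /bg /phi_sum (big_cat_nat (leq0n (size p)) pN)//=.
rewrite [X in _ = _ + X]big_nat_cond [X in _ = _ + X]big1 ?addr0// => i /andP[/andP[pi _] _].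
by rewrite /bg_coef nth_default// rmorph0 !mul0r.
Qed.

Lemma L2_bg p : L2 (bg p). Proof. exact: L2_phi_sum. Qed.

Lemma bgD p q : bg (p + q) = (fun s => bg p s + bg q s).
Proof.
set N := maxn (size p) (size q).
rewrite (@bgE _ N) ?size_polyD// (@bgE p N) ?leq_maxl// (@bgE q N) ?leq_maxr//.
apply/funext => s; rewrite /phi_sum -big_split /=; apply: eq_bigr => i _.
by rewrite /bg_coef coefD rmorphD !mulrDl.
Qed.

Lemma bgZ (c : R[i]) p : bg (c *: p) = (fun s => (c^*)%C * bg p s).
Proof.
rewrite (@bgE _ (size p)) ?size_scale_leq//; apply/funext => s.
rewrite /bg /phi_sum mulr_sumr; apply: eq_bigr => i _.
by rewrite /bg_coef coefZ rmorphM -!mulrA.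
Qed.

Lemma bgB p q : bg (p - q) = (fun s => bg p s - bg q s).
Proof.
rewrite -scaleN1r bgD bgZ; apply/funext => s.
by rewrite rmorphN rmorph1 mulN1r.
Qed.

Lemma inner_phi_suml (c : nat -> R[i]) N f : L2 f ->
  inner (phi_sum c N) f = \sum_(0 <= n < N) c n * inner (phi n) f.
Proof.
move=> Lf; rewrite /phi_sum inner_suml//; last by move=> i; apply: L2Z; exact: L2_phi.
by apply: eq_bigr => i _; rewrite innerZl//; exact: L2_phi.
Qed.

Lemma inner_gabor_bg (a : R * R) p : inner (gabor a) (bg p) = omega a * p.[cpx a].
Proof.
have Lg := L2_gabor a; have LB := L2_bg p.
rewrite (inner_conj LB Lg) /bg inner_phi_suml// big_mkord horner_coef mulr_sumr rmorph_sum.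
apply: eq_bigr => i _ /=.
rewrite (inner_conj Lg (L2_phi i)) inner_gabor_phi -[RHS]conjcK; congr (_^*)%C.
have k0 := @kap2_gt0 R i; have c00 := @c0_gt0 R.
have e1 : ((kap2 i / c0)%:C)%C * ((c0 / kap2 i)%:C)%C = 1 :> R[i].
  rewrite -rmorphM /= (_ : _ * _ = 1) ?rmorph1//.
  by field; rewrite !gt_eqF.
have gen (u v w K1 K2 : R[i]) : K1 * K2 = 1 -> (K2^*)%C = K2 ->
    ((v * (u * w))^*)%C = (u^*)%C * K1 * ((v * w * K2)^*)%C.
  move=> h1 h2; rewrite !rmorphM /= h2.
  transitivity ((u^*)%C * ((v^*)%C * (w^*)%C) * (K1 * K2)); last by ring.
  by rewrite h1; ring.
by apply/esym/gen => //; rewrite conjc_real.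
Qed.

Lemma nrm_bg_sq p : nrm (bg p) ^+ 2 = c0^-1 * \sum_(0 <= n < size p) sq p`_n * kap2 n.
Proof.
rewrite nrm_phi_sum !mulr_sumr; apply: eq_bigr => i _.
have c0n := @c0_gt0 R; have kn := @kap2_gt0 R i.
rewrite /bg_coef sqM -(nc_sq (_^*)%C) nc_conj nc_sq.
rewrite {2}/sq /= expr0n addr0; field; rewrite !gt_eqF//.
Qed.

Lemma nrm_bg_monomial n : nrm (bg 'X^n) = kap n / Num.sqrt c0.
Proof.
have c0n := @c0_gt0 R.
rewrite -[RHS]ger0_norm ?divr_ge0 ?sqrtr_ge0// -sqrtr_sqr expr_div_n kap_sq sqr_sqrtr ?ltW//.
rewrite -[LHS]ger0_norm ?nrm_ge0// -sqrtr_sqr nrm_bg_sq size_polyXn big_nat_recr//= big_nat big1 ?add0r.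
  by rewrite coefXn eqxx {1}/sq /= expr1n expr0n addr0 mul1r mulrC.
move=> i /andP[_ ni]; rewrite coefXn ltn_eqF// {1}/sq /= expr0n addr0 mul0r//.
Qed.

Lemma nrm_bgD p q : nrm (bg (p + q)) <= nrm (bg p) + nrm (bg q).
Proof. by rewrite bgD; apply: nrmD; exact: L2_bg. Qed.

Lemma nrm_bgZ c p : nrm (bg (c *: p)) = nc c * nrm (bg p).
Proof. by rewrite bgZ nrmZ ?nc_conj//; exact: L2_bg. Qed.

Lemma nrm_bg0 : nrm (bg 0) = 0.
Proof. by rewrite -(scale0r 0) nrm_bgZ nc0 mul0r. Qed.

Lemma nrm_bg_sum I (r : seq I) (F : I -> {poly R[i]}) :
  nrm (bg (\sum_(i <- r) F i)) <= \sum_(i <- r) nrm (bg (F i)).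
Proof.
elim: r => [|i r ih]; first by rewrite !big_nil nrm_bg0.
by rewrite !big_cons; apply: (le_trans (nrm_bgD _ _)); rewrite lerD2l.
Qed.

(** Weighted l1 norms of the coefficients: with weights [kap] they dominate the norm of [bg p], with
    powers of r they are submultiplicative, and most estimates pass between the two. *)
Definition wnorm (w : nat -> R) p : R := \sum_(i < size p) nc p`_i * w i.

Lemma wnorm_ge0 w p : (forall i, 0 <= w i) -> 0 <= wnorm w p.
Proof. by move=> w0; apply: sumr_ge0 => i _; rewrite mulr_ge0 ?nc_ge0. Qed.

Lemma wnorm_widen w p N : (size p <= N)%N -> wnorm w p = \sum_(i < N) nc p`_i * w i.
Proof.
move=> pN; rewrite /wnorm (big_ord_widen _ (fun i => nc p`_i * w i) pN) big_mkcond /=.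
apply: eq_bigr => i _; case: ltnP => // h.
by rewrite nth_default// nc0 mul0r.
Qed.

Lemma nrm_bg_le p : nrm (bg p) <= wnorm kap p / Num.sqrt c0.
Proof.
rewrite -{1}[p]coefK poly_def.
rewrite -(big_mkord xpredT (fun i => p`_i *: 'X^i)).
apply: (le_trans (nrm_bg_sum _ _)); rewrite big_mkord /wnorm mulr_suml.
by apply: ler_sum => i _; rewrite nrm_bgZ nrm_bg_monomial mulrA.
Qed.

Lemma wnormD w p q : (forall i, 0 <= w i) -> wnorm w (p + q) <= wnorm w p + wnorm w q.
Proof.
move=> w0; set N := maxn (size p) (size q).
rewrite (@wnorm_widen w _ N) ?size_polyD// (@wnorm_widen w p N) ?leq_maxl//.
rewrite (@wnorm_widen w q N) ?leq_maxr// -big_split /=; apply: ler_sum => i _.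
by rewrite coefD -mulrDl ler_wpM2r// ncD.
Qed.

Lemma wnorm0 w : wnorm w 0 = 0. Proof. by rewrite /wnorm size_poly0 big_ord0. Qed.

Lemma wnormZ w c p : wnorm w (c *: p) = nc c * wnorm w p.
Proof.
rewrite (wnorm_widen w (size_scale_leq c p)) mulr_sumr; apply: eq_bigr => i _.
by rewrite coefZ ncM mulrA.
Qed.

Lemma wnorm_sum w I (r : seq I) (F : I -> {poly R[i]}) : (forall i, 0 <= w i) ->
  wnorm w (\sum_(i <- r) F i) <= \sum_(i <- r) wnorm w (F i).
Proof.
move=> w0; elim: r => [|i r ih]; first by rewrite !big_nil wnorm0.
by rewrite !big_cons; apply: (le_trans (wnormD _ _ w0)); rewrite lerD2l.
Qed.

Lemma wnormMXn w p n : wnorm w (p * 'X^n) = wnorm (fun i => w (i + n)%N) p.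
Proof.
have [->|p0] := eqVneq p 0; first by rewrite mul0r !wnorm0.
rewrite {1}/wnorm size_Mmonic ?monicXn// size_polyXn addnS /= addnC big_split_ord /=.
rewrite big1 ?add0r => [|i _]; last by rewrite coefMXn ltn_ord nc0 mul0r.
by apply: eq_bigr => i _; rewrite coefMXn ltnNge leq_addr /= addKn addnC.
Qed.

Definition pnorm (r : R) p : R := wnorm (fun i => r ^+ i) p.

Lemma pnorm_ge0 r p : 0 <= r -> 0 <= pnorm r p.
Proof. by move=> r0; apply: wnorm_ge0 => i; rewrite exprn_ge0. Qed.

Lemma pnormXn r n : pnorm r 'X^n = r ^+ n.
Proof.
rewrite /pnorm /wnorm size_polyXn big_ord_recr /= coefXn eqxx nc1 mul1r big1 ?add0r// => i _.
by rewrite coefXn ltn_eqF// nc0 mul0r.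
Qed.

Lemma pnorm1 r : pnorm r 1 = 1. Proof. by rewrite -[X in pnorm _ X](expr0 'X) pnormXn expr0. Qed.

Lemma pnormMXn r p n : pnorm r (p * 'X^n) = pnorm r p * r ^+ n.
Proof.
rewrite /pnorm wnormMXn /wnorm mulr_suml; apply: eq_bigr => i _.
by rewrite exprD mulrA.
Qed.

Lemma pnormM r p q : 0 <= r -> pnorm r (p * q) <= pnorm r p * pnorm r q.
Proof.
move=> r0; rewrite -{1}[q]coefK poly_def mulr_sumr.
rewrite -(big_mkord xpredT (fun i => p * (q`_i *: 'X^i))).
apply: (le_trans (wnorm_sum _ _ _)) => [i|]; first by rewrite exprn_ge0.
rewrite big_mkord [X in _ <= _ * X]/pnorm [X in _ <= _ * X]/wnorm mulr_sumr; apply: ler_sum => i _.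
by rewrite -scalerAr wnormZ -/(pnorm r _) pnormMXn mulrCA.
Qed.

Lemma horner_le_pnorm p z : nc p.[z] <= pnorm (nc z) p.
Proof.
rewrite horner_coef; apply: (le_trans (nc_sum _ _ _)).
by apply: ler_sum => i _; rewrite ncM ncX.
Qed.

Lemma pnorm_mono r r' p : 0 <= r <= r' -> pnorm r p <= pnorm r' p.
Proof.
move=> /andP[r0 rr]; apply: ler_sum => i _; apply: ler_wpM2l; first exact: nc_ge0.
by apply: lerXn2r; rewrite ?nnegrE// (le_trans r0).
Qed.

End bargmann.

(** * Growth of the Bargmann weights *)

Section factorial_estimates.
Context {R : realType}.
Implicit Types (n m k d i j : nat).

Lemma exp_nn_le_fact n : n%:R ^+ n <= n`!%:R * expR n%:R :> R.
Proof.
case: n => [|n]; first by rewrite expr0 fact0 mul1r expR0.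
have fp : 0 < n.+1`!%:R :> R by rewrite ltr0n fact_gt0.
rewrite mulrC -ler_pdivrMr//; apply: le_trans (expR_ge1Dxn n _) => //.
by rewrite lerDr.
Qed.

(** This says 2 y <= log ((1 + y) / (1 - y)) when y < 1; at y = 1 / (2 n + 1) the quotient is (n +
    1) / n, the increment that Stirling's bound needs. *)
Lemma expR2_le (y : R) : 0 <= y -> expR (2 * y) * (1 - y) <= 1 + y.
Proof.
move=> y0.
pose psi (u : R) := expR (- u) * (1 + u) - expR u * (1 - u).
have dpsi (u : R) : is_derive u 1 psi (u * (expR u - expR (- u))).
  by apply: is_derive_eq; rewrite /GRing.scale /=; ring.
have : psi 0 <= psi y.
  have [->//|y1] := eqVneq y 0.
  have yp : 0 < y by rewrite lt_def y1.
  apply: (@ger0_derive1_le_cc _ psi 0 y) => [u _|u| | | |//]; rewrite ?in_itv /= ?lexx ?y0//.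
  - rewrite derive1E; have [_ ->] := dpsi u => /andP[u0 _].
    by rewrite mulr_ge0 ?(ltW u0)// subr_ge0 ler_expR; lra.
  - apply: continuous_subspaceT => u; apply/differentiable_continuous/derivable1_diffP.
    by have [] := dpsi u.
rewrite /psi oppr0 expR0 addr0 subrr subr_ge0 => h.
rewrite mulr_natl mulr2n expRD -mulrA.
apply: le_trans (ler_wpM2l (expR_ge0 _) h) _.
by rewrite mulrA -expRD subrr expR0 mul1r.
Qed.

(** The bound n! <= e sqrt n (n / e)^n at n + 1, squared so that only integer powers occur. *)
Lemma stirling_upper n :
  n.+1`!%:R ^+ 2 * expR (2 * n.+1%:R) <= expR 2 * n.+1%:R ^+ (2 * n.+1).+1 :> R.
Proof.
elim: n => [|n ih]; first by rewrite (_ : 1`! = 1%N)// !expr1n !mulr1 mul1r.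
set x : R := n.+1%:R in ih *.
have x0 : 0 < x by rewrite ltr0n.
have xS : n.+2%:R = x + 1 by rewrite /x natr1.
have key : expR 2 * x ^+ (2 * n.+1).+1 <= (x + 1) ^+ (2 * n.+1).+1.
  pose y := (2 * x + 1)^-1.
  have xp : 0 < 2 * x + 1 by lra.
  have y0 : 0 <= y by rewrite invr_ge0 ltW.
  have h : expR (2 * y) * x <= x + 1.
    have := expR2_le y0.
    have -> : 1 - y = x * (2 * y) by rewrite /y; field; rewrite gt_eqF.
    have -> : 1 + y = (x + 1) * (2 * y) by rewrite /y; field; rewrite gt_eqF.
    have yp : 0 < 2 * y by rewrite mulr_gt0// invr_gt0.
    by rewrite mulrA ler_pM2r.
  have -> : expR 2 = expR (2 * y) ^+ (2 * n.+1).+1.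
    rewrite -expRM_natl; congr expR.
    have -> : (2 * n.+1).+1%:R = 2 * x + 1 by rewrite -natr1 natrM.
    by rewrite /y; field; rewrite gt_eqF.
  rewrite -exprMn; apply: lerXn2r; rewrite ?nnegrE//; first by rewrite mulr_ge0 ?expR_ge0 ?ltW.
  by rewrite addr_ge0// ltW.
have -> : n.+2`!%:R ^+ 2 * expR (2 * n.+2%:R) =
    (x + 1) ^+ 2 * expR 2 * (n.+1`!%:R ^+ 2 * expR (2 * x)) :> R.
  rewrite factS natrM xS mulrDr mulr1 expRD; ring.
have -> : expR 2 * n.+2%:R ^+ (2 * n.+2).+1 =
    (x + 1) ^+ 2 * expR 2 * (x + 1) ^+ (2 * n.+1).+1.
  rewrite xS (_ : (2 * n.+2).+1 = (2 + (2 * n.+1).+1)%N); last by lia.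
  by rewrite exprD; ring.
apply: ler_wpM2l; first by rewrite mulr_ge0 ?expR_ge0 ?exprn_ge0 ?addr_ge0 ?ltW.
exact: le_trans ih key.
Qed.

Lemma fact_addn_le m j M : (m + j <= M)%N -> ((m + j)`! <= m`! * M ^ j)%N.
Proof.
elim: j => [|j ih] h; first by rewrite addn0 expn0 muln1.
rewrite addnS factS expnS mulnCA mulnC [leqRHS]mulnC; apply: leq_mul; last by lia.
by apply: ih; lia.
Qed.

Lemma fact_addn_ge m j : (m`! * m.+1 ^ j <= (m + j)`!)%N.
Proof.
elim: j => [|j ih]; first by rewrite addn0 expn0 muln1.
by rewrite addnS factS expnS mulnCA; apply: leq_mul => //; lia.
Qed.

Lemma expR_ge2 : 2 <= expR 6 :> R.
Proof. by apply: le_trans (expR_ge1Dx _); lra. Qed.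

(** Above n each of the at most 2k + 1 extra factors is at most (k + 1)^2 = n (1 + 1/k)^2, which
    accumulates to at most exp 6. Below n the loss over at most d factors is at most 2, because 2
    d^2 <= n. *)
Lemma fact_window d k m (n := (k ^ 2)%N) : (0 < k)%N -> (2 * d ^ 2 <= n)%N ->
  (n <= m + d)%N -> (m <= n + (2 * k).+1)%N ->
  m`!%:R * n%:R ^+ n <= expR 6 * n`!%:R * n%:R ^+ m :> R.
Proof.
move=> k0 dn nm mn.
have n0 : (0 < n)%N by rewrite expn_gt0 k0.
have nR : 0 < n%:R :> R by rewrite ltr0n.
have kR : 0 < k%:R :> R by rewrite ltr0n.
have [le_nm|lt_mn] := leqP n m.
  have [j jm] : exists j, m = (n + j)%N by exists (m - n)%N; lia.
  rewrite jm exprD mulrCA [leLHS]mulrC.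
  apply: ler_wpM2l; first by rewrite exprn_ge0// ltW.
  have h : ((n + j)`! <= n`! * (k.+1 ^ 2) ^ j)%N.
    by apply: fact_addn_le; rewrite jm in mn; rewrite /n in mn *; nia.
  have {}h : (n + j)`!%:R <= n`!%:R * (k.+1%:R ^+ 2) ^+ j :> R.
    by rewrite -!natrX -natrM ler_nat.
  apply: (le_trans h); rewrite [expR 6 * _]mulrC -mulrA; apply: ler_wpM2l; first by rewrite ler0n.
  have -> : k.+1%:R ^+ 2 = n%:R * (1 + k%:R^-1) ^+ 2 :> R.
    by rewrite /n natrX -natr1 -exprMn mulrDr mulr1 mulfV ?gt_eqF// addrC.
  rewrite exprMn mulrC; apply: ler_wpM2r; first by rewrite exprn_ge0// ltW.
  have -> : expR 6 = expR (k%:R^-1) ^+ (6 * k) :> R.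
    rewrite -expRM_natl; congr expR; rewrite natrM.
    by field; rewrite gt_eqF.
  rewrite -exprM; apply: (@le_trans _ _ (expR (k%:R^-1) ^+ (2 * j))).
    apply: lerXn2r; [rewrite nnegrE|by rewrite nnegrE expR_ge0|exact: expR_ge1Dx].
    by apply: addr_ge0 => //; rewrite invr_ge0 ltW.
  apply: ler_weXn2l; first by rewrite -[leLHS]expR0 ler_expR invr_ge0 (ltW kR).
  by rewrite jm /n in mn; lia.
have [j jm] : exists j, n = (m + j)%N by exists (n - m)%N; lia.
have jd : (j <= d)%N by lia.
have hn : (m`! * m.+1 ^ j <= n`!)%N by rewrite jm; exact: fact_addn_ge.
have bern : n%:R ^+ j <= 2 * m.+1%:R ^+ j :> R.
  have [->|j0] := posnP j; first by rewrite !expr0; lra.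
  have /ler_wpM2r h : 2^-1 <= (1 - d%:R / n%:R) ^+ j :> R.
    have dn1 : d%:R / n%:R <= 1 :> R by rewrite ler_pdivrMr// mul1r ler_nat; nia.
    apply: (@le_trans _ _ (1 - j%:R * (d%:R / n%:R))).
      have : j%:R * (d%:R / n%:R) <= 2^-1 :> R.
        rewrite mulrA ler_pdivrMr// ler_pdivlMl// -!natrM ler_nat; nia.
      by lra.
    have dn0 : 0 <= d%:R / n%:R :> R by rewrite divr_ge0.
    elim: (j) => [|i ih]; first by rewrite mul0r subr0 expr0.
    rewrite exprS; apply: (@le_trans _ _ ((1 - d%:R / n%:R) * (1 - i%:R * (d%:R / n%:R)))).
      rewrite -natr1 -subr_ge0; set z := d%:R / n%:R in dn0 *.
      have -> : (1 - z) * (1 - i%:R * z) - (1 - (i%:R + 1) * z) = i%:R * z ^+ 2 by ring.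
      by rewrite mulr_ge0// exprn_ge0.
    by apply: ler_wpM2l => //; lra.
  have {h} := h (n%:R ^+ j) (exprn_ge0 _ (ltW nR)).
  rewrite -exprMn mulrBl mul1r divfK ?gt_eqF// => h.
  apply: (@le_trans _ _ (2 * (n%:R - d%:R) ^+ j)).
    by rewrite -ler_pdivrMl//; apply: le_trans h _; rewrite lexx.
  apply: ler_wpM2l => //; apply: lerXn2r; rewrite ?nnegrE//.
    by rewrite subr_ge0 ler_nat; nia.
  by rewrite lerBlDr -natrD ler_nat; lia.
rewrite {2}jm exprD mulrCA [leRHS]mulrC; apply: ler_wpM2l; first by rewrite exprn_ge0// ltW.
apply: (@le_trans _ _ (2 * (m`!%:R * m.+1%:R ^+ j))).
  by rewrite mulrCA; apply: ler_wpM2l => //; rewrite ler0n.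
apply: ler_pM => //.
  exact: expR_ge2.
by rewrite -natrX -natrM ler_nat.
Qed.

End factorial_estimates.

(** * The weights near degree k ^ 2 *)

Section kap_estimates.
Context {R : realType}.
Implicit Types (n m k d i j : nat).
Local Notation kap := (@kap R).

Lemma ler_of_sq (x y : R) : 0 <= x -> 0 <= y -> x ^+ 2 <= y ^+ 2 -> x <= y.
Proof. by move=> x0 y0; rewrite ler_pXn2r ?nnegrE. Qed.

(** Consecutive weights have the ratio sqrt ((n + 1) / pi), which is close to this number when n is
    near k ^ 2. *)
Definition tk k : R := k%:R / Num.sqrt pi.

Lemma tk_ge0 k : 0 <= tk k. Proof. by rewrite divr_ge0. Qed.

Lemma tk_gt0 k : (0 < k)%N -> 0 < tk k.
Proof. by move=> k0; rewrite divr_gt0 ?ltr0n ?sqrtr_gt0 ?pi_gt0. Qed.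

Lemma tk_sq k : tk k ^+ 2 = (k ^ 2)%:R / pi.
Proof. by rewrite expr_div_n sqr_sqrtr ?pi_ge0// natrX. Qed.

Lemma tkXX k m : (tk k ^+ m) ^+ 2 = (k ^ 2)%:R ^+ m / pi ^+ m.
Proof. by rewrite -exprM mulnC exprM tk_sq expr_div_n. Qed.

Lemma kap_window d k m (n := (k ^ 2)%N) : (0 < k)%N -> (2 * d ^ 2 <= n)%N ->
  (n <= m + d)%N -> (m <= n + (2 * k).+1)%N ->
  kap m * tk k ^+ n <= expR 3 * kap n * tk k ^+ m.
Proof.
move=> k0 dn nm mn.
have t0 := tk_ge0 k; have kn (i : nat) := ltW (kap_gt0 (R := R) i).
apply: ler_of_sq.
- by rewrite mulr_ge0// exprn_ge0.
- by rewrite mulr_ge0 ?exprn_ge0// mulr_ge0// expR_ge0.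
have ppos i : 0 < pi ^+ i :> R by rewrite exprn_gt0// pi_gt0.
rewrite [leLHS]exprMn [leRHS]exprMn [(expR 3 * _) ^+ 2]exprMn !tkXX !kap_sq /kap2 -/n -expRM_natl.
have -> : m`!%:R / pi ^+ m * (n%:R ^+ n / pi ^+ n) =
  m`!%:R * n%:R ^+ n * (pi ^+ m * pi ^+ n)^-1 :> R by rewrite invfM mulrACA.
have -> : expR (2 * 3) * (n`!%:R / pi ^+ n) * (n%:R ^+ m / pi ^+ m) =
  expR 6 * n`!%:R * n%:R ^+ m * (pi ^+ m * pi ^+ n)^-1 :> R.
  by rewrite invfM (_ : 2 * 3 = 6)//; [ring|ring].
apply: ler_wpM2r; first by rewrite invr_ge0 mulr_ge0// ltW.
exact: fact_window dn nm mn.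
Qed.

Lemma kap_add_le i j M : (i + j <= M)%N -> kap (i + j) <= kap i * Num.sqrt (M%:R / pi) ^+ j.
Proof.
move=> ijM; have kn (i : nat) := ltW (kap_gt0 (R := R) i).
have pp : 0 < pi :> R by exact: pi_gt0.
apply: ler_of_sq => //.
  by apply: mulr_ge0 => //; rewrite exprn_ge0// sqrtr_ge0.
rewrite exprMn !kap_sq -exprM mulnC exprM sqr_sqrtr ?divr_ge0 ?(ltW pp)// /kap2.
rewrite expr_div_n mulrACA -invfM -exprD; apply: ler_wpM2r; first by rewrite invr_ge0 exprn_ge0// ltW.
by rewrite -natrX -natrM ler_nat; exact: fact_addn_le.
Qed.

Lemma kap_add_ge i j (r : R) : 0 <= r -> r ^+ 2 <= i.+1%:R / pi ->
  kap i * r ^+ j <= kap (i + j).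
Proof.
move=> r0 rM; have kn (i : nat) := ltW (kap_gt0 (R := R) i).
have pp : 0 < pi :> R by exact: pi_gt0.
apply: ler_of_sq => //.
  by apply: mulr_ge0 => //; rewrite exprn_ge0.
rewrite exprMn -exprM mulnC exprM !kap_sq /kap2.
apply: (@le_trans _ _ (i`!%:R / pi ^+ i * (i.+1%:R / pi) ^+ j)).
  apply: ler_wpM2l; first by rewrite divr_ge0// exprn_ge0// ltW.
  by apply: lerXn2r; rewrite ?nnegrE ?exprn_ge0// divr_ge0// ltW.
rewrite expr_div_n mulrACA -invfM -exprD; apply: ler_wpM2r; first by rewrite invr_ge0 exprn_ge0// ltW.
by rewrite -natrX -natrM ler_nat; exact: fact_addn_ge.
Qed.

Lemma kap_lower k (n := (k ^ 2)%N) : tk k ^+ n <= kap n * expR (n%:R / 2).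
Proof.
have pp : 0 < pi :> R by exact: pi_gt0.
have t0 := tk_ge0 k; have kn (i : nat) := ltW (kap_gt0 (R := R) i).
apply: ler_of_sq; rewrite ?exprn_ge0// ?mulr_ge0 ?expR_ge0//.
rewrite tkXX exprMn kap_sq -expRM_natl [2 * _]mulrC divfK// /kap2 mulrAC.
apply: ler_wpM2r; first by rewrite invr_ge0 exprn_ge0// ltW.
exact: exp_nn_le_fact.
Qed.

(** The exponential is the inverse modulus of [omega] at the real point [tk k]. The factor sqrt k is
    n^(1/4), left by Stirling's formula after the square root in [kap]. *)
Lemma kap_upper k (n := (k ^ 2)%N) : (0 < k)%N ->
  kap n * expR (n%:R / 2) <= expR 1 * Num.sqrt k%:R * tk k ^+ n.
Proof.
move=> k0; have pp : 0 < pi :> R by exact: pi_gt0.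
have t0 := tk_ge0 k; have kn (i : nat) := ltW (kap_gt0 (R := R) i).
apply: ler_of_sq.
- by rewrite mulr_ge0 ?expR_ge0.
- by apply: mulr_ge0; rewrite ?exprn_ge0// mulr_ge0 ?expR_ge0 ?sqrtr_ge0.
rewrite [leLHS]exprMn [leRHS]exprMn [(expR 1 * _) ^+ 2]exprMn tkXX kap_sq sqr_sqrtr// -!expRM_natl [2 * (_ / 2)]mulrC divfK// mulr1 /kap2 [leLHS]mulrAC [leRHS]mulrA.
apply: ler_wpM2r; first by rewrite invr_ge0 exprn_ge0// ltW.
apply: ler_of_sq.
- by rewrite mulr_ge0 ?expR_ge0.
- by apply: mulr_ge0; rewrite ?exprn_ge0// mulr_ge0 ?exprn_ge0 ?expR_ge0.
have := @stirling_upper R n.-1; rewrite prednK ?expn_gt0 ?k0// => h.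
rewrite [leLHS]exprMn -expRM_natl; apply: (le_trans h).
have -> : n%:R ^+ (2 * n).+1 = (k%:R * n%:R ^+ n) ^+ 2 :> R.
  by rewrite exprMn -exprM exprS mulnC; congr (_ * _); rewrite /n natrX.
rewrite -[X in _ <= X ^+ 2]mulrA [leRHS]exprMn; apply: ler_wpM2r; first by rewrite exprn_ge0// mulr_ge0// exprn_ge0.
by rewrite -expRM_natl ler_expR; lra.
Qed.

End kap_estimates.

(** * The factors of a stage and their asymptotics *)

Section real_monomials.
Context {R : realType}.
Local Notation nc := (@Normc.normc R).
Local Notation kap := (@kap R).
Implicit Types (p q P Q : {poly R[i]}) (r t x c : R).

Definition rX c (n : nat) : {poly R[i]} := (c%:C)%C *: 'X^n.

Lemma rXM c c' n n' : rX c n * rX c' n' = rX (c * c') (n + n').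
Proof. by rewrite /rX -scalerAl -scalerAr scalerA exprD rmorphM. Qed.

Lemma rX0 : rX 1 0 = 1. Proof. by rewrite /rX expr0 scale1r. Qed.

Lemma rXX c n j : rX c n ^+ j = rX (c ^+ j) (n * j).
Proof.
elim: j => [|j ih]; first by rewrite !expr0 muln0 rX0.
by rewrite !exprS ih rXM mulnS.
Qed.

Lemma horner_rX c n z : (rX c n).[z] = (c%:C)%C * z ^+ n.
Proof. by rewrite hornerZ hornerXn. Qed.

Lemma pnorm_rX r c n : pnorm r (rX c n) = `|c| * r ^+ n.
Proof. by rewrite /pnorm wnormZ nc_real -/(pnorm _ _) pnormXn. Qed.

Lemma pnormD r p q : 0 <= r -> pnorm r (p + q) <= pnorm r p + pnorm r q.
Proof. by move=> r0; apply: wnormD => i; rewrite exprn_ge0. Qed.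

Lemma pnormN r p : pnorm r (- p) = pnorm r p.
Proof. by rewrite /pnorm -scaleN1r wnormZ ncN nc1 mul1r. Qed.

Lemma pnormB r p q : 0 <= r -> pnorm r (p - q) <= pnorm r p + pnorm r q.
Proof. by move=> r0; rewrite -(pnormN r q); apply: pnormD. Qed.

Lemma pnormB1_le r P : 0 <= r -> pnorm r P <= 1 + pnorm r (P - 1).
Proof.
move=> r0; rewrite -{1}(subrK 1 P) addrC; apply: (le_trans (pnormD _ _ r0)).
by rewrite pnorm1.
Qed.

Lemma pnormM1 r P Q a b : 0 <= r -> pnorm r (P - 1) <= a -> pnorm r (Q - 1) <= b ->
  pnorm r (P * Q - 1) <= (1 + a) * (1 + b) - 1.
Proof.
move=> r0 ha hb.
have -> : P * Q - 1 = (P - 1) * Q + (Q - 1) by rewrite mulrBl mul1r addrA subrK.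
apply: (le_trans (pnormD _ _ r0)).
have -> : (1 + a) * (1 + b) - 1 = a * (1 + b) + b by ring.
apply: lerD => //; apply: (le_trans (pnormM _ _ r0)).
apply: ler_pM; rewrite ?pnorm_ge0//.
by apply: (le_trans (pnormB1_le _ r0)); rewrite lerD2l.
Qed.

Definition upol r N := 1 + rX r N.
Definition lpol x := 1 + rX x^-1 1.
Definition qpol t m : {poly R[i]} := \sum_(j < m) rX t^-1 1 ^+ j.
Definition vpol t m := 1 - rX (t^-1 ^+ m) m.

Lemma qpol_vpol t m : (1 - rX t^-1 1) * qpol t m = vpol t m.
Proof.
have -> : vpol t m = 1 - rX t^-1 1 ^+ m by rewrite /vpol rXX mul1n.
by rewrite -[RHS]opprB subrX1 -mulNr opprB.
Qed.

Lemma pnorm_upol r c N : 0 <= c -> pnorm r (upol c N - 1) = c * r ^+ N.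
Proof. by move=> c0; rewrite /upol addrC addKr pnorm_rX ger0_norm. Qed.

Lemma pnorm_lpol r x : 0 <= x -> pnorm r (lpol x - 1) = r / x.
Proof. by move=> x0; rewrite /lpol addrC addKr pnorm_rX ger0_norm ?invr_ge0// expr1 mulrC. Qed.

Lemma pnorm_vpol r t m : 0 <= t -> pnorm r (vpol t m - 1) = (r / t) ^+ m.
Proof.
move=> t0; rewrite /vpol addrC addKr pnormN pnorm_rX ger0_norm; last by rewrite exprn_ge0 ?invr_ge0.
by rewrite -exprMn mulrC.
Qed.

Lemma pnorm_sum r I (s : seq I) (F : I -> {poly R[i]}) : 0 <= r ->
  pnorm r (\sum_(i <- s) F i) <= \sum_(i <- s) pnorm r (F i).
Proof. by move=> r0; apply: wnorm_sum => i; rewrite exprn_ge0. Qed.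

Lemma pnorm_yX r t j : 0 <= t -> pnorm r (rX t^-1 1 ^+ j) = (r / t) ^+ j.
Proof.
by move=> t0; rewrite rXX mul1n pnorm_rX ger0_norm ?exprn_ge0 ?invr_ge0// -exprMn mulrC.
Qed.

Lemma pnorm_qpol r t m : 0 <= r -> 0 <= t -> (0 < m)%N -> r / t <= 2^-1 ->
  pnorm r (qpol t m - 1) <= 2 * (r / t).
Proof.
move=> r0 t0; case: m => // m _ h.
have d0 : 0 <= r / t by rewrite divr_ge0.
rewrite /qpol big_ord_recl expr0 addrC addKr.
apply: (le_trans (pnorm_sum _ _ r0)).
apply: (@le_trans _ _ (\sum_(i < m) (r / t) * 2^-1 ^+ i)).
  apply: ler_sum => i _; rewrite pnorm_yX// exprS; apply: ler_wpM2l => //.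
  by apply: lerXn2r; rewrite ?nnegrE.
rewrite -mulr_sumr mulrC; apply: ler_wpM2r => //.
by rewrite -(big_mkord xpredT (fun i => 2^-1 ^+ i)); exact: sum_half_pow.
Qed.

Lemma size_rX c n : (size (rX c n) <= n.+1)%N.
Proof. by apply: leq_trans (size_scale_leq _ _) _; rewrite size_polyXn. Qed.

Lemma size_lpol_le x : (size (lpol x) <= 2)%N.
Proof. by rewrite (leq_trans (size_polyD _ _))// geq_max size_poly1 size_rX. Qed.

Lemma size_vpol_le t m : (size (vpol t m) <= m.+1)%N.
Proof. by rewrite (leq_trans (size_polyD _ _))// geq_max size_poly1 size_polyN size_rX. Qed.

Lemma size_qpol_le t m : (size (qpol t m) <= m)%N.
Proof.
apply: (leq_trans (size_sum _ _ _)); apply/bigmax_leqP => i _.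
by rewrite rXX mul1n (leq_trans (size_rX _ _)).
Qed.

Lemma coef_qpol t m j : (j < m)%N -> (qpol t m)`_j = (((t^-1) ^+ j)%:C)%C.
Proof.
move=> jm; rewrite coef_sum (bigD1 (Ordinal jm)) //= rXX mul1n coefZ coefXn eqxx mulr1.
rewrite big1 ?addr0// => i ij; rewrite rXX mul1n coefZ coefXn.
by rewrite (_ : (j == i) = false) ?mulr0//; apply: contraNF ij => /eqP h; apply/eqP/val_inj.
Qed.

Lemma size_mul_bound p q a b : (size p <= a.+1)%N -> (size q <= b.+1)%N ->
  (size (p * q)%R <= (a + b).+1)%N.
Proof. by move=> pa qb; apply: (leq_trans (size_polyMleq _ _)); lia. Qed.

(** Up to degree M one more power of X raises the weight by at most sqrt (M / pi), so the second
    factor may be measured by a geometric norm. *)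
Lemma wnorm_kapM Q P M : (size Q + size P <= M.+2)%N ->
  wnorm kap (Q * P) <= wnorm kap Q * pnorm (Num.sqrt (M%:R / pi)) P.
Proof.
move=> h; have k0 i : 0 <= kap i by rewrite ltW// kap_gt0.
rewrite -{1}[P]coefK poly_def mulr_sumr.
rewrite -(big_mkord xpredT (fun i => Q * (P`_i *: 'X^i))).
apply: (le_trans (wnorm_sum _ _ k0)).
rewrite big_mkord [pnorm _ P]/pnorm [X in _ <= _ * X]/wnorm mulr_sumr; apply: ler_sum => j _.
rewrite -scalerAr wnormZ [leRHS]mulrCA; apply: ler_wpM2l; first exact: nc_ge0.
rewrite wnormMXn mulr_suml; apply: ler_sum => i _.
rewrite -mulrA; apply: ler_wpM2l; first exact: nc_ge0.
by apply: kap_add_le; have := ltn_ord i; have := ltn_ord j; lia.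
Qed.

Lemma wnorm_kap_window d k P (n := (k ^ 2)%N) : (0 < k)%N -> (2 * d ^ 2 <= n)%N -> (d <= n)%N ->
  (size P <= d + (2 * k).+2)%N ->
  wnorm kap (P * 'X^(n - d)) * tk k ^+ n <= expR 3 * kap n * tk k ^+ (n - d) * pnorm (tk k) P.
Proof.
move=> k0 dn ln sP; rewrite wnormMXn mulr_suml mulr_sumr; apply: ler_sum => i _.
rewrite -[leLHS]mulrA [leRHS]mulrCA; apply: ler_wpM2l; first exact: nc_ge0.
rewrite -[leRHS]mulrA -exprD addnC; apply: (@kap_window _ d) => //; first by lia.
by have := ltn_ord i; lia.
Qed.

(** After weighting, the 2k coefficients of q obey one common bound, and orthogonality of the
    Hermite functions makes the norm only sqrt (2k) times larger. The l1 bound 2k would be of the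
    order of [tk k], too large for [near_dual]. *)
Lemma nrm_bg_qpol k d i (n := (k ^ 2)%N) : (0 < k)%N -> (2 * d ^ 2 <= n)%N -> (d <= n)%N ->
  (i <= d.+1)%N ->
  nrm (bg (qpol (tk k) (2 * k) * 'X^(n - d + i))) * tk k ^+ n <=
  expR 3 * kap n * tk k ^+ (n - d + i) * Num.sqrt (2 * k)%:R / Num.sqrt c0.
Proof.
move=> k0 dn ln id; set t := tk k; have t0 : 0 < t by exact: tk_gt0.
have ck : 0 < c0 :> R by exact: c0_gt0.
set E := expR 3 * kap n * t ^+ (n - d + i).
have E0 : 0 <= E by rewrite !mulr_ge0 ?expR_ge0 ?exprn_ge0 ?ltW ?kap_gt0.
apply: ler_of_sq.
- by rewrite mulr_ge0 ?nrm_ge0 ?exprn_ge0 ?ltW.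
- by rewrite divr_ge0 ?sqrtr_ge0// mulr_ge0 ?sqrtr_ge0.
rewrite [leLHS]exprMn nrm_bg_sq -[leLHS]mulrA [leLHS]mulrC.
have -> : (E * Num.sqrt (2 * k)%:R / Num.sqrt c0) ^+ 2 = (2 * k)%:R * E ^+ 2 / c0.
  by rewrite expr_div_n [(E * _) ^+ 2]exprMn !sqr_sqrtr ?(ltW ck)// [E ^+ 2 * (2 * k)%:R]mulrC.
apply: ler_wpM2r; first by rewrite invr_ge0 ltW.
set P := qpol t (2 * k) * 'X^(n - d + i).
have sz : (size P <= (n - d + i) + 2 * k)%N.
  apply: (leq_trans (size_polyMleq _ _)); rewrite size_polyXn addnS /= addnC leq_add2l.
  exact: size_qpol_le.
rewrite mulr_suml.
have term m : (m < size P)%N -> sq P`_m * kap2 m * (t ^+ n) ^+ 2 <= (n - d + i <= m)%N%:R * E ^+ 2.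
  move=> mP; have {}mP := leq_trans mP sz.
  rewrite coefMXn; case: ltnP => h /=; first by rewrite -nc_sq nc0 expr0n /= !mul0r.
  rewrite mul1r -nc_sq -kap_sq -!exprMn.
  have -> : nc (qpol t (2 * k))`_(m - (n - d + i)) = t^-1 ^+ (m - (n - d + i)).
    rewrite coef_qpol; last by lia.
    by rewrite nc_real ger0_norm// exprn_ge0// invr_ge0 ltW.
  apply: lerXn2r; rewrite ?nnegrE//.
    by apply: mulr_ge0; rewrite ?exprn_ge0 ?(ltW t0)// mulr_ge0 ?ltW ?kap_gt0// exprn_gt0// invr_gt0.
  have h2 : kap m * t ^+ n <= expR 3 * kap n * t ^+ m by apply: (@kap_window _ d) => //; lia.
  rewrite -[leLHS]mulrA exprVn; rewrite ler_pdivrMl; last by rewrite exprn_gt0.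
  apply: (le_trans h2); rewrite /E mulrCA -mulrA -[leRHS]mulrA; apply: ler_wpM2l; first exact: expR_ge0.
  apply: ler_wpM2l; first by rewrite ltW// kap_gt0.
  by rewrite -exprD subnK.
apply: (@le_trans _ _ (\sum_(0 <= m < size P) (n - d + i <= m)%N%:R * E ^+ 2)).
  rewrite !big_mkord; apply: ler_sum => m _; exact: term.
have E20 : 0 <= E ^+ 2 by rewrite exprn_ge0.
apply: (@le_trans _ _ (\sum_(0 <= m < (n - d + i) + 2 * k) (n - d + i <= m)%N%:R * E ^+ 2)).
  rewrite [leRHS](big_cat_nat (leq0n _) sz) /= lerDl; apply: sumr_ge0 => m _.
  by rewrite mulr_ge0.
rewrite (big_cat_nat (leq0n _) (leq_addr _ _)) /= big_nat_cond big1 => [|m]; last first.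
  by rewrite andbT => /andP[_ h]; rewrite leqNgt h mul0r.
rewrite add0r big_nat_cond (eq_bigr (fun=> E ^+ 2)); last first.
  by move=> m /andP[/andP[h _] _]; rewrite h mul1r.
by rewrite -big_nat_cond sumr_const_nat addKn mulr_natl.
Qed.

End real_monomials.

(** * Bounds for all large stage parameters *)

Section near_estimates.
Context {R : realType}.
Local Notation kap := (@kap R).
Local Notation tk := (@tk R).
Implicit Types (p q P Q : {poly R[i]}) (r t x c e : R) (k : nat).

Lemma near_ge m : \forall k \near \oo, (m <= k)%N.
Proof. exact: nbhs_infty_ge. Qed.

Lemma near_geR (M : R) : \forall k \near \oo, M <= k%:R.
Proof. exact: nbhs_infty_ger. Qed.

Lemma near_tk (M : R) : \forall k \near \oo, M <= tk k.
Proof.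
near=> k; rewrite ler_pdivlMr ?sqrtr_gt0 ?pi_gt0//.
by near: k; exact: near_geR.
Unshelve. all: end_near. Qed.

Definition window d k := [/\ (0 < k)%N, (2 * d ^ 2 <= k ^ 2)%N & (d < k ^ 2)%N].

Lemma near_window d : \forall k \near \oo, window d k.
Proof.
near=> k; have k1 : (2 * d + 1 <= k)%N by near: k; exact: near_ge.
by split; nia.
Unshelve. all: end_near. Qed.

Lemma sqrt_pi_ge1 : 1 <= Num.sqrt pi :> R.
Proof. by rewrite -[leLHS]sqrtr1 ler_sqrt ?pi_gt0// (le_trans _ (pi_ge2 R))//; lra. Qed.

Lemma tk_le k : tk k <= k%:R.
Proof.
rewrite ler_pdivrMr ?sqrtr_gt0 ?pi_gt0//.
by rewrite -[leLHS]mulr1; apply: ler_wpM2l => //; exact: sqrt_pi_ge1.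
Qed.

(** The numerator bounds the growth of the weights at degrees O(k) and is of order sqrt k, against t
    of order k. Hence the factors other than u, of degree at most 2k, change a fixed polynomial
    little. *)
Lemma near_delta d e : 0 < e ->
  \forall k \near \oo, Num.sqrt ((d + (2 * k).+2)%:R / pi) / tk k <= e.
Proof.
move=> e0; near=> k.
have k0 : (0 < k)%N by near: k; exact: near_ge.
have kR : 0 < k%:R :> R by rewrite ltr0n.
have kd : (d + 4)%:R / e ^+ 2 <= k%:R by near: k; exact: near_geR.
have pp : 0 < pi :> R by exact: pi_gt0.
rewrite ler_pdivrMr ?tk_gt0//; apply: ler_of_sq; rewrite ?sqrtr_ge0 ?mulr_ge0 ?tk_ge0 ?(ltW e0)//.
rewrite sqr_sqrtr ?divr_ge0 ?(ltW pp)// exprMn tk_sq [leRHS]mulrA; apply: ler_wpM2r.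
  by rewrite invr_ge0 ltW.
rewrite ler_pdivrMr ?exprn_gt0// in kd.
have : (d + (2 * k).+2)%:R <= (d + 4)%:R * k%:R :> R by rewrite -natrM ler_nat; nia.
move=> /le_trans -> //; rewrite natrX expr2 mulrA; apply: ler_wpM2r; first exact: ltW.
by rewrite mulrC.
Unshelve. all: end_near. Qed.

Section rho.
Context (d : nat) (b tau : R) (b0 : 0 < b) (tau0 : 0 < tau).

(** Chosen so that the leading monomial of u g, for g of degree d with leading modulus b, has
    weighted size exactly tau: its degree is k ^ 2. *)
Definition stage_rho k : R := tau / (b * kap (k ^ 2)).

Lemma rhok_gt0 k : 0 < stage_rho k.
Proof. by rewrite divr_gt0// mulr_gt0// kap_gt0. Qed.

(** By Stirling [tk k ^+ (k ^ 2)] exceeds [kap (k ^ 2)] by exp (k ^ 2 / 2) up to a power of k, and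
    this also beats the missing [tk k ^+ d]. Together with [near_rho_small] it confines the zeros of
    u to moduli between t / 4 and t, apart from all other zeros. *)
Lemma near_rho_large (L : R) : \forall k \near \oo, L <= stage_rho k * tk k ^+ (k ^ 2 - d).
Proof.
near=> k.
have [k0 _ dk] : window d k by near: k; exact: near_window.
have k2 : (2 <= k)%N by near: k; exact: near_ge.
have kR : 0 < k%:R :> R by rewrite ltr0n.
pose A : R := expR 1 * (d.+2)`!%:R * b / tau.
have A0 : 0 < A by rewrite divr_gt0// mulr_gt0// mulr_gt0 ?expR_gt0// ltr0n fact_gt0.
have kL : L * A <= k%:R by near: k; exact: near_geR.
have t0 := tk_gt0 (R := R) k0; set t := tk k in t0 *.
have kn := kap_gt0 (R := R) (k ^ 2).
apply: (@le_trans _ _ (k%:R / A)); first by rewrite ler_pdivlMr.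
rewrite ler_pdivrMr//.
have h1 := kap_upper (R := R) k0.
have h2 : k%:R ^+ d.+2 <= (d.+2)`!%:R * expR ((k ^ 2)%:R / 2) :> R.
  have fp : 0 < d.+2`!%:R :> R by rewrite ltr0n fact_gt0.
  rewrite mulrC -ler_pdivrMr//; apply: (@le_trans _ _ (expR k%:R)).
    by apply: le_trans (expR_ge1Dxn d.+1 (ltW kR)); rewrite lerDr.
  rewrite ler_expR ler_pdivlMr// -natrM ler_nat; nia.
have h3 : Num.sqrt k%:R <= k%:R :> R.
  apply: ler_of_sq; rewrite ?sqrtr_ge0// sqr_sqrtr// -natrX ler_nat; nia.
have td : t ^+ d <= k%:R ^+ d by apply: lerXn2r; rewrite ?nnegrE ?(ltW t0)//; exact: tk_le.
have -> : stage_rho k * t ^+ (k ^ 2 - d) * A = (expR 1 * t ^+ (k ^ 2 - d)) * (d.+2)`!%:R / kap (k ^ 2).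
  by rewrite /stage_rho /A; field; rewrite !gt_eqF.
rewrite ler_pdivlMr//.
have e0 : 0 < expR ((k ^ 2)%:R / 2) :> R by exact: expR_gt0.
rewrite -(ler_pM2r e0) -[leLHS]mulrA.
apply: (le_trans (ler_wpM2l (ltW kR) h1)).
have -> : t ^+ (k ^ 2) = t ^+ (k ^ 2 - d) * t ^+ d by rewrite -exprD subnK// ltnW.
set T := t ^+ (k ^ 2 - d).
have T0 : 0 < T by rewrite exprn_gt0.
have -> : k%:R * (expR 1 * Num.sqrt k%:R * (T * t ^+ d)) =
  (expR 1 * T) * (k%:R * (Num.sqrt k%:R * t ^+ d)) by ring.
rewrite -[leRHS]mulrA; apply: ler_wpM2l; first by rewrite mulr_ge0 ?expR_ge0 ?ltW.
apply: le_trans h2; rewrite exprS exprS; apply: ler_wpM2l; first exact: ltW.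
by apply: ler_pM; rewrite ?sqrtr_ge0// exprn_ge0 ?ltW.
Unshelve. all: end_near. Qed.

Lemma expR_half_le2 : expR 2^-1 <= 2 :> R.
Proof.
have := @expR2_le R 4^-1; rewrite (_ : 2 * 4^-1 = 2^-1); last by field.
by move=> /(_ ltac:(lra)); lra.
Qed.

(** The excess of [tk k ^+ (k ^ 2)] over [kap (k ^ 2)] is at most exp (k ^ 2 / 2) <= 2 ^ (k ^ 2),
    too little against 4 ^ (k ^ 2). *)
Lemma near_rho_small e : 0 < e ->
  \forall k \near \oo, stage_rho k * (tk k / 4) ^+ (k ^ 2 - d) <= e.
Proof.
move=> e0; near=> k.
have [k0 _ dk] : window d k by near: k; exact: near_window.
have t1 : 1 <= tk k by near: k; exact: near_tk.
set t := tk k in t1 *; have t0 : 0 < t by exact: lt_le_trans t1.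
have kL : tau / b * 4 ^+ d / e <= k%:R by near: k; exact: near_geR.
have kn := kap_gt0 (R := R) (k ^ 2).
have h1 := kap_lower (R := R) k.
have h2 : expR ((k ^ 2)%:R / 2) <= 2 ^+ (k ^ 2) :> R.
  rewrite expRM_natl; apply: lerXn2r; rewrite ?nnegrE ?expR_ge0//.
  exact: expR_half_le2.
have h3 : t ^+ (k ^ 2 - d) <= kap (k ^ 2) * 2 ^+ (k ^ 2).
  apply: (@le_trans _ _ (t ^+ (k ^ 2))); first by apply: ler_weXn2l => //; exact: leq_subr.
  by apply: (le_trans h1); apply: ler_wpM2l => //; exact: ltW.
rewrite expr_div_n mulrA.
have -> : 4 ^+ (k ^ 2 - d) = 4 ^+ (k ^ 2) / 4 ^+ d :> R.
  by rewrite -{2}(subnK (ltnW dk)) exprD mulfK// expf_neq0.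
rewrite invf_div mulrA ler_pdivrMr ?exprn_gt0//.
apply: (@le_trans _ _ (tau / b * 4 ^+ d * 2 ^+ (k ^ 2))).
  have h4 := ler_wpM2l (ltW (rhok_gt0 k)) h3.
  rewrite [leRHS]mulrAC; apply: ler_wpM2r; first by rewrite exprn_ge0.
  by apply: (le_trans h4); rewrite le_eqVlt; apply/orP; left; apply/eqP; rewrite /stage_rho; field; rewrite !gt_eqF.
rewrite ler_pdivrMr// in kL.
have -> : 4 ^+ (k ^ 2) = 2 ^+ (k ^ 2) * 2 ^+ (k ^ 2) :> R by rewrite -exprMn; congr (_ ^+ _); ring.
rewrite mulrA; apply: ler_wpM2r; first by rewrite exprn_ge0.
apply: (le_trans kL); rewrite mulrC; apply: ler_wpM2l; first exact: ltW.
by rewrite -natrX ler_nat; apply: leq_trans (ltnW (ltn_expl _ _)) => //; nia.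
Unshelve. all: end_near. Qed.

End rho.
End near_estimates.

Section stage_factors.
Context {R : realType}.
Local Notation nc := (@Normc.normc R).
Local Notation kap := (@kap R).
Local Notation tk := (@tk R).
Implicit Types (p q g P Q : {poly R[i]}) (r t x c e : R) (k : nat).

Context (d : nat) (b tau : R) (b0 : 0 < b) (tau0 : 0 < tau).
Local Notation rhok := (stage_rho b tau).

Definition stage_u k : {poly R[i]} := upol (rhok k) (k ^ 2 - d).
Definition stage_q k : {poly R[i]} := qpol (tk k) (2 * k).
Definition stage_l k : {poly R[i]} := lpol (tk k / 4).
Definition stage_v k : {poly R[i]} := vpol (tk k) (2 * k).
Definition stage_s k := stage_u k * stage_q k * stage_l k.
Definition stage_f k := stage_u k * stage_v k.

Let E : R := expR 3 * tau / b.
Let E0 : 0 < E. Proof. by rewrite divr_gt0// mulr_gt0// expR_gt0. Qed.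

(** This top block stays in the window where the weights are geometric of ratio [tk k], and the
    normalisation of rho leaves only the geometric norm of P relative to t^d. *)
Lemma wnorm_top k P : window d k ->
  (size P <= d + (2 * k).+2)%N ->
  wnorm kap (rX (rhok k) (k ^ 2 - d) * P) <= E * pnorm (tk k) P / tk k ^+ d.
Proof.
move=> [k0 dn dk] sP; have t0 := tk_gt0 (R := R) k0; have kn := kap_gt0 (R := R) (k ^ 2).
have h := wnorm_kap_window k0 dn (ltnW dk) sP.
rewrite -scalerAl wnormZ nc_real ger0_norm ?(ltW (rhok_gt0 _ _ _))// mulrC.
rewrite ler_pdivlMr ?exprn_gt0//.
have tn0 : 0 < tk k ^+ (k ^ 2 - d) by rewrite exprn_gt0.
rewrite -(ler_pM2r tn0) -(ler_pM2r kn).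
have -> : wnorm kap ('X^(k ^ 2 - d) * P) * rhok k * tk k ^+ d * tk k ^+ (k ^ 2 - d) * kap (k ^ 2)
   = (tau / b) * (wnorm kap (P * 'X^(k ^ 2 - d)) * tk k ^+ (k ^ 2)).
  have -> : tk k ^+ (k ^ 2) = tk k ^+ d * tk k ^+ (k ^ 2 - d) by rewrite -exprD subnKC// ltnW.
  by rewrite [P * _]mulrC /rhok; field; rewrite !gt_eqF.
have -> : E * pnorm (tk k) P * tk k ^+ (k ^ 2 - d) * kap (k ^ 2) =
  (tau / b) * (expR 3 * kap (k ^ 2) * tk k ^+ (k ^ 2 - d) * pnorm (tk k) P).
  by rewrite /E; field; rewrite gt_eqF.
by apply: ler_wpM2l; [rewrite divr_ge0// ltW|exact: h].
Qed.

Lemma nrm_bg_top k i : window d k -> (i <= d.+1)%N ->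
  nrm (bg (rX (rhok k) (k ^ 2 - d) * (stage_q k * 'X^i))) <=
  E * Num.sqrt (2 * k)%:R / Num.sqrt c0 * (tk k ^+ i / tk k ^+ d).
Proof.
move=> [k0 dn dk] id; have t0 := tk_gt0 (R := R) k0; have kn := kap_gt0 (R := R) (k ^ 2).
have h := nrm_bg_qpol k0 dn (ltnW dk) id.
rewrite -scalerAl nrm_bgZ nc_real ger0_norm ?(ltW (rhok_gt0 _ _ _))// mulrCA -exprD -/(stage_q k).
have tn0 : 0 < tk k ^+ (k ^ 2) by rewrite exprn_gt0.
have ck : 0 < Num.sqrt c0 :> R by rewrite sqrtr_gt0 c0_gt0.
rewrite -(ler_pM2r tn0) -(ler_pM2r kn).
have -> : rhok k * nrm (bg (stage_q k * 'X^(k ^ 2 - d + i))) * tk k ^+ (k ^ 2) * kap (k ^ 2) =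
  tau / b * (nrm (bg (qpol (tk k) (2 * k) * 'X^(k ^ 2 - d + i))) * tk k ^+ (k ^ 2)).
  by rewrite /rhok /stage_q; field; rewrite !gt_eqF.
have -> : E * Num.sqrt (2 * k)%:R / Num.sqrt c0 * (tk k ^+ i / tk k ^+ d) * tk k ^+ (k ^ 2) * kap (k ^ 2)
  = tau / b * (expR 3 * kap (k ^ 2) * tk k ^+ (k ^ 2 - d + i) * Num.sqrt (2 * k)%:R / Num.sqrt c0).
  have -> : tk k ^+ (k ^ 2) = tk k ^+ d * tk k ^+ (k ^ 2 - d) by rewrite -exprD subnKC// ltnW.
  by rewrite /E exprD; field; rewrite !gt_eqF ?exprn_gt0.
by apply: ler_wpM2l; [rewrite divr_ge0// ltW|exact: h].
Qed.

Lemma near_sqrt_small e : 0 < e -> \forall k \near \oo, Num.sqrt (2 * k)%:R / tk k <= e.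
Proof.
have pp : 0 < pi :> R by exact: pi_gt0.
have sp : 0 < Num.sqrt pi :> R by rewrite sqrtr_gt0.
move=> e0; near=> k.
have k0 : (0 < k)%N by near: k; exact: near_ge.
have h : Num.sqrt ((d + (2 * k).+2)%:R / pi) / tk k <= e / Num.sqrt pi.
  by near: k; apply: near_delta; rewrite divr_gt0.
rewrite -[e](divfK (lt0r_neq0 sp)).
apply: le_trans (ler_wpM2r (ltW sp) h).
rewrite [leRHS]mulrAC; apply: ler_wpM2r; first by rewrite invr_ge0 tk_ge0.
rewrite -sqrtrM ?divr_ge0// ?(ltW pp)// divfK ?gt_eqF// ler_sqrt// ler_nat; lia.
Unshelve. all: end_near. Qed.

(** Meant for Q proportional to S / (X - z). Its degree is below d, so in the top block it gains 1 /
    t, which beats the norm sqrt (2k) of q. The part without rho has degree O(k) and is small by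
    [near_delta]. *)
Lemma near_dual Q e : (size Q <= d)%N -> 0 < e ->
  \forall k \near \oo, nrm (bg (Q * (stage_s k - 1))) <= e.
Proof.
move=> sQ e0.
have ck : 0 < Num.sqrt c0 :> R by rewrite sqrtr_gt0 c0_gt0.
pose W : R := wnorm kap Q + 1.
pose A : R := pnorm 1 Q + 1.
have W0 : 0 < W by rewrite ltr_wpDl// wnorm_ge0// => i; rewrite ltW// kap_gt0.
have A0 : 0 < A by rewrite ltr_wpDl// pnorm_ge0.
near=> k.
have win : window d k by near: k; exact: near_window.
have [k0 _ _] := win; have t0 := tk_gt0 (R := R) k0.
have t1 : 1 <= tk k by near: k; exact: near_tk.
have d1 : Num.sqrt ((d + (2 * k).+2)%:R / pi) / tk k <= 4^-1 :> R by near: k; apply: near_delta; rewrite invr_gt0.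
have d2 : Num.sqrt ((d + (2 * k).+2)%:R / pi) / tk k <= e / 2 * Num.sqrt c0 / (8 * W).
  by near: k; apply: near_delta; rewrite divr_gt0 ?mulr_gt0// divr_gt0.
set w := Num.sqrt _ in d1 d2; have w0 : 0 <= w by exact: sqrtr_ge0.
have q1 : Num.sqrt (2 * k)%:R / tk k <= e / 2 * Num.sqrt c0 / (5 * E * A).
  near: k; apply: near_sqrt_small; apply: divr_gt0; first by rewrite mulr_gt0// divr_gt0.
  by apply: mulr_gt0 => //; rewrite mulr_gt0.
have -> : Q * (stage_s k - 1) = Q * (stage_q k * stage_l k - 1) + rX (rhok k) (k ^ 2 - d) * (Q * (stage_q k * stage_l k)).
  by rewrite /stage_s /stage_u /upol; ring.
apply: (le_trans (nrm_bgD _ _)); rewrite [e in leRHS]splitr; apply: lerD.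
  apply: (le_trans (nrm_bg_le _)); rewrite ler_pdivrMr//.
  apply: (le_trans (@wnorm_kapM _ _ _ (d + (2 * k).+2) _)).
    have : (size (stage_q k * stage_l k - 1)%R <= (2 * k).+2)%N.
      rewrite (leq_trans (size_polyD _ _))// geq_max size_polyN size_poly1 /= andbT.
      rewrite (leq_trans (size_mul_bound (a := 2 * k) (b := 1) _ (size_lpol_le _))) ?addn1//.
      by rewrite (leq_trans (size_qpol_le _ _)).
    lia.
  rewrite -/w; set de := w / tk k in d1 d2.
  have de0 : 0 <= de by rewrite divr_ge0 ?(ltW t0).
  have h : pnorm w (stage_q k * stage_l k - 1) <= 8 * de.
    apply: (le_trans (@pnormM1 _ _ _ _ (2 * de) (4 * de) w0 _ _)).
    - by apply: pnorm_qpol => //; [exact: ltW|lia|rewrite -/de; lra].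
    - rewrite pnorm_lpol ?divr_ge0 ?(ltW t0)// invf_div mulrA mulrC mulrA -/de.
      by rewrite [_ * w]mulrC -/de mulrC.
    - by nra.
  apply: (@le_trans _ _ (W * (8 * de))).
    apply: ler_pM => //; rewrite ?pnorm_ge0 ?lerDl// wnorm_ge0// => i; rewrite ltW// kap_gt0//.
  by rewrite mulrCA mulrA -ler_pdivlMl ?mulr_gt0// mulrC.
(* Expanded along the monomials of Q and the two terms of 1 + X / x, so that every term is a shifted
   q and the l2 bound applies. *)
have -> : rX (rhok k) (k ^ 2 - d) * (Q * (stage_q k * stage_l k)) =
  \sum_(i < size Q) Q`_i *: (rX (rhok k) (k ^ 2 - d) * (stage_q k * 'X^i) +
     ((tk k / 4)^-1%:C)%C *: (rX (rhok k) (k ^ 2 - d) * (stage_q k * 'X^(i.+1)))).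
  rewrite -{1}[Q]coefK poly_def mulr_suml mulr_sumr; apply: eq_bigr => i _.
  by rewrite /stage_l /lpol /rX expr1 [in RHS]exprS -!mul_polyC; ring.
apply: (le_trans (nrm_bg_sum _ _)).
apply: (@le_trans _ _ (\sum_(i < size Q) nc Q`_i * (5 * (E * Num.sqrt (2 * k)%:R / Num.sqrt c0 / tk k)))).
  apply: ler_sum => i _; rewrite nrm_bgZ; apply: ler_wpM2l; first exact: nc_ge0.
  apply: (le_trans (nrm_bgD _ _)); rewrite nrm_bgZ nc_real ger0_norm; last by rewrite invr_ge0 divr_ge0 ?ltW.
  have ltd : (i < d)%N by exact: leq_trans sQ.
  set F := E * Num.sqrt (2 * k)%:R / Num.sqrt c0.
  have F0 : 0 <= F by rewrite divr_ge0 ?(ltW ck)// mulr_ge0 ?sqrtr_ge0 ?(ltW E0).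
  have h1 := nrm_bg_top win (leq_trans (ltnW ltd) (leqnSn _)).
  have h2 := @nrm_bg_top k i.+1 win (leq_trans ltd (leqnSn _)).
  have ti : tk k ^+ i / tk k ^+ d <= (tk k)^-1.
    rewrite ler_pdivrMr ?exprn_gt0// ler_pdivlMl// -exprS.
    by apply: ler_weXn2l.
  have h1' := le_trans h1 (ler_wpM2l F0 ti).
  have h2' : (tk k / 4)^-1 * nrm (bg (rX (rhok k) (k ^ 2 - d) * (stage_q k * 'X^(i.+1)))) <= 4 * (F / tk k).
    rewrite ler_pdivrMl  ?(divr_gt0 t0)//; apply: (le_trans h2).
    rewrite -/F exprS -mulrA (le_trans (ler_wpM2l F0 (ler_wpM2l (ltW t0) ti)))//.
    by rewrite le_eqVlt; apply/orP; left; apply/eqP; field; rewrite gt_eqF.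
  apply: (le_trans (lerD h1' h2')).
  by rewrite le_eqVlt; apply/orP; left; apply/eqP; ring.
rewrite -mulr_suml.
apply: (@le_trans _ _ (A * (5 * (E * Num.sqrt (2 * k)%:R / Num.sqrt c0 / tk k)))).
  apply: ler_wpM2r.
    by rewrite mulr_ge0// !divr_ge0 ?sqrtr_ge0 ?(ltW t0)// mulr_ge0 ?sqrtr_ge0 ?ltW.
  rewrite /A /pnorm /wnorm; under [X in _ <= X + 1]eq_bigr do rewrite expr1n mulr1.
  by rewrite lerDl.
have -> : A * (5 * (E * Num.sqrt (2 * k)%:R / Num.sqrt c0 / tk k)) =
   (Num.sqrt (2 * k)%:R / tk k) * (5 * E * A) / Num.sqrt c0.
  by field; rewrite !gt_eqF.
rewrite ler_pdivrMr//; rewrite ler_pdivlMr// in q1.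
by apply: mulr_gt0 => //; rewrite mulr_gt0.
Unshelve. all: end_near. Qed.

End stage_factors.

Section stage_estimates.
Context {R : realType}.
Local Notation nc := (@Normc.normc R).
Local Notation kap := (@kap R).
Local Notation tk := (@tk R).
Implicit Types (p q g P Q : {poly R[i]}) (r t x c e : R) (k : nat).

Context (d : nat) (b tau : R) (b0 : 0 < b) (tau0 : 0 < tau).
Local Notation rhok := (stage_rho b tau).
Local Notation uk := (stage_u d b tau).
Local Notation sk := (stage_s d b tau).
Local Notation fk := (stage_f d b tau).
Local Notation qk := (@stage_q R).
Local Notation lk := (@stage_l R).
Local Notation vk := (@stage_v R).

Lemma low_terms_small g e : 0 < e -> exists2 A : R, 1 <= A & forall r, A <= r ->
  \sum_(i < d) nc g`_i * r ^+ i <= e * r ^+ d.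
Proof.
move=> e0; exists (1 + (\sum_(i < d) nc g`_i) / e).
  by rewrite lerDl divr_ge0 ?(ltW e0)//; apply: sumr_ge0 => i _; exact: nc_ge0.
move=> r Ar.
have r1 : 1 <= r.
  apply: le_trans Ar; rewrite lerDl divr_ge0 ?(ltW e0)//.
  by apply: sumr_ge0 => i _; exact: nc_ge0.
have r0 : 0 < r by exact: lt_le_trans r1.
have rA : (\sum_(i < d) nc g`_i) / e <= r by apply: le_trans Ar; rewrite lerDr.
rewrite ler_pdivrMr// in rA.
apply: (@le_trans _ _ (\sum_(i < d) nc g`_i * (r ^+ d / r))).
  apply: ler_sum => i _; apply: ler_wpM2l; first exact: nc_ge0.
  by rewrite ler_pdivlMr// -exprSr; apply: ler_weXn2l.
rewrite -mulr_suml mulrA ler_pdivrMr// mulrAC; apply: ler_wpM2r; first by rewrite exprn_ge0 ?ltW.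
by rewrite [leRHS]mulrC.
Qed.

Lemma pnorm_lead g r : size g = d.+1 ->
  pnorm r g = \sum_(i < d) nc g`_i * r ^+ i + nc (lead_coef g) * r ^+ d.
Proof. by move=> sg; rewrite /pnorm /wnorm sg big_ord_recr /= lead_coefE sg. Qed.

Lemma near_pnorm_lead g (C : R) : size g = d.+1 -> nc (lead_coef g) < C ->
  \forall k \near \oo, pnorm (tk k) g <= C * tk k ^+ d.
Proof.
move=> sg gC; have Cp : 0 < C - nc (lead_coef g) by rewrite subr_gt0.
have [A A1 hA] := low_terms_small g Cp.
near=> k; rewrite pnorm_lead//.
have At : A <= tk k by near: k; exact: near_tk.
by have := hA _ At; rewrite mulrBl; lra.
Unshelve. all: end_near. Qed.

(** Here g has full degree d and the top block does not vanish as k grows: it is of size tau, which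
    is why tau must be summable over the stages. In the constant, 4 exp 3 comes from the top block,
    where g and v each cost a factor 2, and 1 from the low one. *)
Lemma near_functional g : size g = d.+1 -> nc (lead_coef g) = b ->
  \forall k \near \oo, nrm (bg (g * (fk k - 1))) <= (4 * expR 3 + 1) / Num.sqrt c0 * tau.
Proof.
move=> sg gb.
have ck : 0 < Num.sqrt c0 :> R by rewrite sqrtr_gt0 c0_gt0.
pose W : R := wnorm kap g + 1.
have W0 : 0 < W by rewrite ltr_wpDl// wnorm_ge0// => i; rewrite ltW// kap_gt0.
near=> k.
have win : window d k by near: k; exact: near_window.
have [k0 _ _] := win; have t0 := tk_gt0 (R := R) k0.
have d1 : Num.sqrt ((d + (2 * k).+2)%:R / pi) / tk k <= 1 :> R by near: k; exact: near_delta.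
have d2 : Num.sqrt ((d + (2 * k).+2)%:R / pi) / tk k <= tau / W.
  by near: k; apply: near_delta; rewrite divr_gt0.
set w := Num.sqrt _ in d1 d2; have w0 : 0 <= w by exact: sqrtr_ge0.
have gt : pnorm (tk k) g <= 2 * b * tk k ^+ d.
  by near: k; apply: near_pnorm_lead => //; rewrite gb ltr_pMl// ltr1n.
have -> : g * (fk k - 1) = g * (vk k - 1) + rX (rhok k) (k ^ 2 - d) * (g * vk k).
  by rewrite /fk /uk /upol; ring.
apply: (le_trans (nrm_bg_le _)); rewrite mulrAC; apply: ler_wpM2r; first by rewrite invr_ge0 ltW.
apply: (le_trans (wnormD _ _ _)) => [i|]; first by rewrite ltW// kap_gt0.
rewrite mulrDl mul1r addrC; apply: lerD.
  apply: (le_trans (wnorm_top b0 tau0 win _)).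
    by apply: leq_trans (size_mul_bound (a := d) (b := 2 * k) _ (size_vpol_le _ _)) _; rewrite ?sg//; lia.
  rewrite ler_pdivrMr ?exprn_gt0//.
  have h : pnorm (tk k) (g * vk k) <= 2 * b * tk k ^+ d * 2.
    apply: (le_trans (pnormM _ _ (ltW t0))).
    apply: ler_pM; rewrite ?pnorm_ge0 ?(ltW t0)//.
    apply: (le_trans (pnormB1_le _ (ltW t0))).
    by rewrite pnorm_vpol ?(ltW t0)// divff ?gt_eqF// expr1n.
  apply: (le_trans (ler_wpM2l _ h)); first by rewrite divr_ge0 ?(ltW b0)// mulr_ge0 ?expR_ge0 ?(ltW tau0).
  by rewrite le_eqVlt; apply/orP; left; apply/eqP; field; rewrite gt_eqF.
apply: (le_trans (@wnorm_kapM _ _ _ (d + (2 * k).+2) _)).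
  have : (size (vk k - 1)%R <= (2 * k).+2)%N.
    rewrite (leq_trans (size_polyD _ _))// geq_max size_polyN size_poly1 /= andbT.
    by rewrite (leq_trans (size_vpol_le _ _)).
  by rewrite sg; lia.
rewrite -/w pnorm_vpol ?(ltW t0)//; set de := w / tk k in d1 d2 *.
have de0 : 0 <= de by rewrite divr_ge0 ?(ltW t0).
have h : de ^+ (2 * k) <= de.
  by rewrite -[leRHS]expr1; apply: ler_wiXn2l => //; lia.
apply: (@le_trans _ _ (W * de)).
  by apply: ler_pM; rewrite ?exprn_ge0 ?lerDl// wnorm_ge0// => i; rewrite ltW// kap_gt0.
by rewrite mulrC -ler_pdivlMr.
Unshelve. all: end_near. Qed.

Lemma near_factors (B : R) : 1 <= B ->
  \forall k \near \oo, B <= tk k / 4 /\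
    (pnorm B (sk k - 1) <= 28 * B / tk k /\ pnorm B (fk k - 1) <= 28 * B / tk k).
Proof.
move=> B1; have B0 : 0 <= B by lra.
near=> k.
have [k0 _ dk] : window d k by near: k; exact: near_window.
have t0 := tk_gt0 (R := R) k0.
have Bt : 4 * B <= tk k by near: k; exact: near_tk.
have rx : rhok k * (tk k / 4) ^+ (k ^ 2 - d) <= 1 by near: k; exact: near_rho_small.
set x := tk k / 4 in rx *.
have x0 : 0 < x by rewrite divr_gt0.
have tx : tk k = 4 * x by rewrite /x mulrC divfK.
have Bx : B <= x by rewrite tx in Bt; lra.
split=> //.
set e := B / x; have e0 : 0 <= e by rewrite divr_ge0 ?(ltW x0).
have e1 : e <= 1 by rewrite ler_pdivrMr ?mul1r.
have e4 : e / 4 <= 2^-1 by rewrite ler_pdivrMr//; apply: (le_trans e1); lra.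
have N1 : (1 <= k ^ 2 - d)%N by rewrite subn_gt0.
have k2 : (1 <= 2 * k)%N by rewrite muln_gt0.
(* Every factor is within e = B / x of 1, three of them give (1 + e)^3 - 1 <= 7 e, and t = 4 x turns
   7 into 28. *)
have -> : 28 * B / tk k = 7 * e by rewrite tx /e; field; rewrite gt_eqF.
have Bt4 : B / tk k = e / 4 by rewrite tx /e; field; rewrite gt_eqF.
have hu : pnorm B (uk k - 1) <= e.
  rewrite pnorm_upol; last by rewrite ltW// rhok_gt0.
  have -> : B = x * e by rewrite /e mulrC divfK// gt_eqF.
  rewrite exprMn mulrA; apply: (@le_trans _ _ (1 * e)); last by rewrite mul1r.
  apply: ler_pM => //; rewrite ?exprn_ge0//.
    by rewrite mulr_ge0 ?exprn_ge0 ?(ltW x0)// ltW// rhok_gt0.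
  by rewrite -[leRHS]expr1; apply: ler_wiXn2l.
have hq : pnorm B (qk k - 1) <= e.
  apply: (@le_trans _ _ (2 * (B / tk k))); last first.
    by rewrite Bt4 mulrCA ler_piMr// ler_pdivrMr// mul1r ler_nat.
  by apply: pnorm_qpol; rewrite ?(ltW t0) ?Bt4.
have hl : pnorm B (lk k - 1) <= e by rewrite pnorm_lpol ?(ltW x0).
have hv : pnorm B (vk k - 1) <= e.
  rewrite pnorm_vpol ?(ltW t0)// Bt4; apply: (@le_trans _ _ (e / 4)).
    rewrite -[leRHS]expr1; apply: ler_wiXn2l => //; first by rewrite divr_ge0.
    by apply: (le_trans e4); rewrite invf_le1// ler1n.
  by rewrite ler_pdivrMr// ler_peMr// ler1n.
have e2 : e * e <= e by rewrite -[leRHS]mulr1 ler_wpM2l.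
have e3 : e * (e * e) <= e by rewrite -[leRHS]mulr1 ler_wpM2l// (le_trans e2).
split.
  apply: (le_trans (pnormM1 B0 (pnormM1 B0 hu hq) hl)).
  have -> : (1 + ((1 + e) * (1 + e) - 1)) * (1 + e) - 1 = 3 * e + 3 * (e * e) + e * (e * e) by ring.
  by lra.
by apply: (le_trans (pnormM1 B0 hu hv)); lra.
Unshelve. all: end_near. Qed.

Lemma near_factors_small (B e : R) : 1 <= B -> 0 < e ->
  \forall k \near \oo, pnorm B (sk k - 1) <= e /\ pnorm B (fk k - 1) <= e.
Proof.
move=> B1 e0; near=> k.
have [_ [h1 h2]] : B <= tk k / 4 /\
    (pnorm B (sk k - 1) <= 28 * B / tk k /\ pnorm B (fk k - 1) <= 28 * B / tk k).
  by near: k; exact: near_factors.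
have k0 : (0 < k)%N by near: k; exact: near_ge.
have h : 28 * B / e <= tk k by near: k; exact: near_tk.
have {}h : 28 * B / tk k <= e by rewrite ler_pdivrMr ?tk_gt0// [leRHS]mulrC; rewrite ler_pdivrMr// in h.
by split; [exact: le_trans h1 h|exact: le_trans h2 h].
Unshelve. all: end_near. Qed.

(* The quotient is the modulus of the coefficient [fcoef] of the new node [tk k]. *)
Lemma near_new_node g e : size g = d.+1 -> nc (lead_coef g) = b -> 0 < e ->
  \forall k \near \oo, expR ((k ^ 2)%:R / 2) /
    (2 * k%:R * (1 + rhok k * tk k ^+ (k ^ 2 - d)) * nc g.[((tk k)%:C)%C]) <= e.
Proof.
move=> sg gb e0; have [A A1 hA] := low_terms_small g (divr_gt0 b0 (ltr0n R 2)).
near=> k.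
have [k0 _ dk] : window d k by near: k; exact: near_window.
have t0 := tk_gt0 (R := R) k0; have kn := kap_gt0 (R := R) (k ^ 2).
have kR : 0 < k%:R :> R by rewrite ltr0n.
have kA : (expR 1 / tau / e) ^+ 2 <= k%:R by near: k; exact: near_geR.
have gt : \sum_(i < d) nc g`_i * tk k ^+ i <= b / 2 * tk k ^+ d.
  by apply: hA; near: k; exact: near_tk.
have lower : b / 2 * tk k ^+ d <= nc g.[((tk k)%:C)%C].
  rewrite horner_coef sg big_ord_recr /= addrC.
  set T := \sum_(i < d) _; rewrite -[T]opprK; apply: le_trans (ncB_ge _ _).
  have hT : nc T <= b / 2 * tk k ^+ d.
    apply: le_trans gt; apply: (le_trans (nc_sum _ _ _)); apply: ler_sum => i _.
    by rewrite ncM ncX nc_real ger0_norm// ltW.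
  have -> : g`_d = lead_coef g by rewrite lead_coefE sg.
  rewrite ncM ncX nc_real (ger0_norm (ltW t0)) gb ncN; lra.
have G0 : 0 < nc g.[((tk k)%:C)%C].
  by apply: lt_le_trans lower; rewrite mulr_gt0 ?exprn_gt0// divr_gt0.
have rn := rhok_gt0 (R := R) b0 tau0 k.
have rt : 0 < rhok k * tk k ^+ (k ^ 2 - d) by rewrite mulr_gt0// exprn_gt0.
have u0 := kap_upper (R := R) k0.
have tE : tk k ^+ (k ^ 2) = tk k ^+ (k ^ 2 - d) * tk k ^+ d by rewrite -exprD subnK// ltnW.
have sk0 : 0 < Num.sqrt k%:R :> R by rewrite sqrtr_gt0.
have ske : expR 1 / tau / e <= Num.sqrt k%:R.
  apply: ler_of_sq; rewrite ?sqrtr_ge0 ?sqr_sqrtr// divr_ge0 ?(ltW e0)// divr_ge0 ?expR_ge0 ?(ltW tau0)//.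
(* Dropping the 1 beside rho t^N and keeping half of the leading term of g leaves a factor k, which
   outruns the sqrt k of [kap_upper]. *)
have den : k%:R * (tau * tk k ^+ (k ^ 2) / kap (k ^ 2)) <=
    2 * k%:R * (1 + rhok k * tk k ^+ (k ^ 2 - d)) * nc g.[((tk k)%:C)%C].
  have -> : k%:R * (tau * tk k ^+ (k ^ 2) / kap (k ^ 2)) =
    2 * k%:R * (rhok k * tk k ^+ (k ^ 2 - d)) * (b / 2 * tk k ^+ d).
    by rewrite tE /stage_rho; field; rewrite !gt_eqF.
  apply: ler_pM => //; first by rewrite mulr_ge0 ?(ltW rt)// mulr_ge0.
    by rewrite mulr_ge0 ?divr_ge0 ?exprn_ge0 ?(ltW b0) ?(ltW t0).
  by apply: ler_wpM2l; [rewrite mulr_ge0|rewrite lerDr].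
have den0 : 0 < k%:R * (tau * tk k ^+ (k ^ 2) / kap (k ^ 2)).
  by rewrite mulr_gt0// divr_gt0// mulr_gt0// exprn_gt0.
rewrite ler_pdivrMr; last exact: lt_le_trans den.
apply: le_trans (ler_wpM2l (ltW e0) den).
rewrite !mulrA ler_pdivlMr// mulrC; apply: (le_trans u0).
rewrite ler_pdivrMr// ler_pdivrMr// in ske.
have -> : e * k%:R * tau * tk k ^+ (k ^ 2) = (Num.sqrt k%:R * e * tau) * Num.sqrt k%:R * tk k ^+ (k ^ 2).
  by rewrite -[in LHS](sqr_sqrtr (ler0n R k)); ring.
apply: ler_wpM2r; first by rewrite exprn_ge0// ltW.
by apply: ler_wpM2r => //; exact: ltW.
Unshelve. all: end_near. Qed.

End stage_estimates.

(** * Lagrange interpolation and completeness *)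

Section lagrange.
Context {F : fieldType}.
Implicit Types (p : {poly F}) (rs : seq F) (x y : F).

Definition node_prod rs x : {poly F} := \prod_(y <- rs | y != x) ('X - y%:P).

Definition lagrange_basis rs x : {poly F} := (node_prod rs x).[x]^-1 *: node_prod rs x.

Lemma node_prodE rs x : uniq rs -> x \in rs ->
  \prod_(y <- rs) ('X - y%:P) = ('X - x%:P) * node_prod rs x.
Proof. by move=> urs xrs; rewrite (bigD1_seq x). Qed.

Lemma deriv_node_prod rs x : uniq rs -> x \in rs ->
  (\prod_(y <- rs) ('X - y%:P))^`().[x] = (node_prod rs x).[x].
Proof.
move=> urs xrs; rewrite (node_prodE urs xrs) derivM derivXsubC mul1r.
by rewrite hornerD hornerM hornerXsubC subrr mul0r addr0.
Qed.

Lemma node_prod_neq0 rs x : (node_prod rs x).[x] != 0.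
Proof.
rewrite horner_prod prodf_seq_neq0; apply/allP => y _; apply/implyP => yx.
by rewrite hornerXsubC subr_eq0 eq_sym.
Qed.

Lemma node_prod_eq0 rs x y : y \in rs -> y != x -> (node_prod rs x).[y] = 0.
Proof.
move=> yrs yx; apply/eqP; rewrite horner_prod prodf_seq_eq0; apply/hasP; exists y => //.
by rewrite yx hornerXsubC subrr eqxx.
Qed.

Lemma size_node_prod rs x : uniq rs -> x \in rs -> size (node_prod rs x) = size rs.
Proof.
move=> urs xrs; have := size_prod_XsubC rs id.
rewrite (node_prodE urs xrs) size_monicM ?monicXsubC//; last first.
  by apply: contraTneq (node_prod_neq0 rs x) => ->; rewrite horner0 eqxx.
by rewrite size_XsubC => -[].
Qed.

Lemma lagrange_interpolation rs p : uniq rs -> (size p <= size rs)%N ->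
  p = \sum_(x <- rs) p.[x] *: lagrange_basis rs x.
Proof.
move=> urs sp; apply/eqP; rewrite -subr_eq0; apply/eqP.
apply: (@roots_geq_poly_eq0 _ _ rs) => //.
  apply/allP => y yrs; rewrite rootE hornerD hornerN horner_sum (bigD1_seq y)//=.
  rewrite !hornerZ mulVf ?node_prod_neq0// mulr1 big1 ?addr0 ?subrr// => x xy.
  by rewrite !hornerZ (@node_prod_eq0 rs x y yrs) ?mulr0// eq_sym.
rewrite (leq_trans (size_polyD _ _))// geq_max sp size_polyN /=.
rewrite big_seq (leq_trans (size_sum _ _ _))//; apply/bigmax_leqP_seq => x xrs _.
by rewrite (leq_trans (size_scale_leq _ _))// (leq_trans (size_scale_leq _ _))// size_node_prod.
Qed.

(** Coefficient m of the interpolation formula for ['X^n]. The m-th coefficients of the basis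
    polynomials are thus weights at the nodes whose moments of order below [size rs] vanish, except
    the m-th. *)
Lemma lagrange_dual rs n m : uniq rs -> (n < size rs)%N ->
  \sum_(x <- rs) (lagrange_basis rs x)`_m * x ^+ n = (n == m)%:R.
Proof.
move=> urs nrs; have h := @lagrange_interpolation rs 'X^n urs.
rewrite size_polyXn in h; have {}h := h nrs.
rewrite eq_sym -coefXn h coef_sum; apply: eq_bigr => x _.
by rewrite coefZ hornerXn mulrC.
Qed.

(** Compare coefficients of degree [(size rs).-1] in the interpolation formula: the degree of p is
    smaller. *)
Lemma lagrange_sum0 rs p : uniq rs -> (size p < size rs)%N ->
  \sum_(x <- rs) p.[x] / (\prod_(y <- rs) ('X - y%:P))^`().[x] = 0.
Proof.
move=> urs sp; have := lagrange_interpolation urs (ltnW sp).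
move=> /(congr1 (fun q : {poly F} => q`_(size rs).-1)); rewrite nth_default; last by rewrite -ltnS prednK//; exact: leq_ltn_trans sp.
rewrite coef_sum => h; rewrite [RHS]h big_seq [RHS]big_seq; apply: eq_bigr => x xrs.
rewrite coefZ deriv_node_prod// /lagrange_basis coefZ; congr (_ * _).
have m1 : node_prod rs x \is monic by apply: monic_prod => y _; exact: monicXsubC.
by move/monicP: m1; rewrite lead_coefE size_node_prod// => ->; rewrite mulr1.
Qed.

End lagrange.

Section recurrence.
Context {R : realType}.
Local Notation nc := (@Normc.normc R).

(** Among the first D terms only [y m] is nonzero, and it produces the boundary term [pnorm 1 T];
    the factor 4 is 1 / (1 - 3/4). *)
Lemma recurrence_tail (T : {poly R[i]}) (y : nat -> R[i]) D m (r : R) M :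
  (m < D)%N -> 1 <= r -> nc T`_D.+1 != 0 ->
  \sum_(i < D.+1) nc T`_i * r ^+ i <= 3 / 4 * (nc T`_D.+1 * r ^+ D.+1) ->
  (forall n, (n < D)%N -> y n = (n == m)%:R) ->
  (forall n, \sum_(i < D.+2) T`_i * y (n + i)%N = 0) ->
  \sum_(0 <= n < M) nc (y (n + D)%N) / r ^+ (n + D) <=
  4 * (nc (y D) / r ^+ D + pnorm 1 T / (nc T`_D.+1 * r ^+ D.+1)).
Proof.
move=> mD r1 T0 dom ym rec.
have r0 : 0 < r by exact: lt_le_trans r1.
have rp n : 0 < r ^+ n by exact: exprn_gt0.
pose w n := nc (y n) / r ^+ n.
have w0 n : 0 <= w n by rewrite divr_ge0 ?nc_ge0 ?ltW.
pose a i := nc T`_i * r ^+ i.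
have a0 i : 0 <= a i by rewrite mulr_ge0 ?nc_ge0 ?ltW.
have ap : 0 < a D.+1 by rewrite mulr_gt0// lt_def T0 nc_ge0.
have step n : a D.+1 * w (n + D.+1)%N <= \sum_(i < D.+1) a i * w (n + i)%N.
  have aw i : a i * w (n + i)%N = nc (T`_i * y (n + i)%N) / r ^+ n.
    by rewrite /a /w ncM exprD; field; rewrite !gt_eqF.
  under eq_bigr do rewrite aw; rewrite aw -mulr_suml; apply: ler_wpM2r; first by rewrite invr_ge0 ltW.
  have := rec n; rewrite big_ord_recr /= addrC => /eqP; rewrite addr_eq0 => /eqP ->.
  by rewrite ncN; exact: nc_sum.
set V := \sum_(0 <= n < M) w (n + D.+1)%N.
have V0 : 0 <= V by apply: sumr_ge0.
have wsmall n : (n < D)%N -> w n = (n == m)%:R / r ^+ m.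
  by move=> nD; rewrite /w ym//; case: eqP => [->|_]; rewrite ?nc1// nc0 !mul0r.
have total : \sum_(0 <= n < M) w (n + D)%N <= w D + V.
  case: (M) @V V0 => [|M'] V V0; first by rewrite big_nil addr_ge0.
  rewrite big_nat_recl// add0n lerD2l /V [leRHS]big_nat_recr//= .
  under eq_bigr do rewrite addSnnS.
  by rewrite lerDl.
have shifted i : (i <= D)%N -> \sum_(0 <= n < M) w (n + i)%N <= (i <= m)%N%:R / r ^+ m + (w D + V).
  move=> iD; pose G j := (D <= j)%N%:R * w j.
  have G0 j : 0 <= G j by rewrite mulr_ge0.
  have wE j : w j = (j == m)%:R / r ^+ m + G j.
    rewrite /G; case: leqP => [Dj|jD]; last by rewrite mul0r addr0 wsmall.
    by rewrite gtn_eqF ?mul0r ?add0r ?mul1r//; exact: leq_trans Dj.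
  under eq_bigr do rewrite wE.
  rewrite big_split /=; apply: lerD.
    rewrite -mulr_suml; apply: ler_wpM2r; first by rewrite invr_ge0 ltW.
    have [im|mi] := leqP i m; last first.
      by rewrite big1// => n _; rewrite gtn_eqF//; lia.
    rewrite -natr_sum ler_nat; apply: (@leq_trans (\sum_(0 <= n < M) (n == (m - i)%N))).
      by apply: leq_sum => n _; case: eqP => // <-; rewrite addnK eqxx.
    rewrite big_mkord; have [mM|Mm] := ltnP (m - i) M.
      rewrite (bigD1 (Ordinal mM)) //= eqxx big1 // => j jm.
      by rewrite (_ : (_ == _) = false)//; apply: contraNF jm => /eqP h; apply/eqP/val_inj.
    by rewrite big1// => j _; rewrite ltn_eqF//; exact: leq_trans Mm.
  apply: le_trans total.
  have -> : \sum_(0 <= n < M) G (n + i)%N = \sum_(i <= j < M + i) G j.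
    by rewrite -[in RHS](add0n i) big_addn add0n addnK.
  have -> : \sum_(0 <= n < M) w (n + D)%N = \sum_(D <= j < M + D) G j.
    rewrite -[in RHS](add0n D) big_addn add0n addnK; apply: eq_bigr => n _.
    by rewrite /G leq_addl mul1r.
  apply: (@le_trans _ _ (\sum_(0 <= j < M + D) G j)).
    rewrite [leRHS](big_cat_nat (leq0n i)) ?ler_wpDl ?sumr_ge0 //=; last by lia.
    rewrite [leRHS](@big_cat_nat _ _ _ (M + i)) ?leq_addl ?leq_add2l//=.
    by rewrite lerDl sumr_ge0.
  rewrite (big_cat_nat (leq0n D)) ?leq_addl//= big_nat big1 ?add0r// => j /andP[_ jD].
  by rewrite /G leqNgt jD mul0r.
(* Summing [step] over [n] bounds the tail [V] by 3/4 of itself plus boundary terms. *)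
have key : a D.+1 * V <= 3 / 4 * a D.+1 * (w D + V) + pnorm 1 T.
  rewrite /V mulr_sumr; apply: (le_trans (ler_sum _ (fun n _ => step n))).
  rewrite exchange_big /=.
  under eq_bigr do rewrite -mulr_sumr.
  apply: (@le_trans _ _ (\sum_(i < D.+1) (a i * ((i <= m)%N%:R / r ^+ m) + a i * (w D + V)))).
    apply: ler_sum => i _; rewrite -mulrDr; apply: ler_wpM2l => //; apply: shifted.
    by rewrite -ltnS.
  rewrite big_split /= addrC; apply: lerD.
    by rewrite -mulr_suml; apply: ler_wpM2r => //; rewrite addr_ge0.
  rewrite /pnorm (@wnorm_widen _ _ _ (maxn (size T) D.+1)) ?leq_maxl//.
  rewrite (big_ord_widen _ (fun i => a i * ((i <= m)%N%:R / r ^+ m)) (leq_maxr (size T) D.+1)).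
  rewrite big_mkcond /=; apply: ler_sum => i _; rewrite expr1n mulr1.
  case: ifP => _; last exact: nc_ge0.
  case: leqP => im; last by rewrite mul0r mulr0 nc_ge0.
  rewrite mul1r /a -[leRHS]mulr1 -mulrA; apply: ler_wpM2l; first exact: nc_ge0.
  by rewrite ler_pdivrMr// mul1r; apply: ler_weXn2l.
apply: (le_trans total).
rewrite -/(w D) -[X in _ / X]/(a D.+1).
rewrite -(ler_pM2l ap).
have -> : a D.+1 * (4 * (w D + pnorm 1 T / a D.+1)) = 4 * (a D.+1 * w D + pnorm 1 T).
  by field; rewrite gt_eqF.
by move: key; rewrite !mulrDr; lra.
Qed.

End recurrence.

(** * Hermite functions approximated by atoms at the zeros of one polynomial *)

Section phi_approximation.
Context {R : realType}.
Local Notation nc := (@Normc.normc R).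
Local Notation kap := (@kap R).

Definition pt (z : R[i]) : R * R := (complex.Re z, complex.Im z).

Lemma cpxK : cancel cpx pt. Proof. by case. Qed.
Lemma ptK : cancel pt (@cpx R). Proof. by case. Qed.

Lemma separable_roots (P : {poly R[i]}) : P != 0 -> separable_poly P ->
  exists rs, [/\ uniq rs, P = lead_coef P *: \prod_(z <- rs) ('X - z%:P) & size P = (size rs).+1].
Proof.
move=> P0 sP; have [rs Prs] := closed_field_poly_normal P.
have lP : lead_coef P != 0 by rewrite lead_coef_eq0.
exists rs; split => //.
  have e : P %= \prod_(z <- rs) ('X - z%:P) by rewrite {1}Prs eqp_scale.
  by rewrite -separable_prod_XsubC -(eqp_separable e).
by rewrite Prs size_scale// size_prod_XsubC.
Qed.

Lemma nrm_phiE n : nrm (phi n : R -> R[i]) = Num.sqrt c0 / kap n.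
Proof.
have k0 := kap_gt0 (R := R) n; have c0p := @c0_gt0 R.
apply/eqP; rewrite -(@eqrXn2 _ 2) ?nrm_ge0 ?divr_ge0 ?sqrtr_ge0 ?(ltW k0)//.
by rewrite nrm_phi_sq expr_div_n sqr_sqrtr ?(ltW c0p)// kap_sq.
Qed.

Lemma gabor_sum_approx rs (c : R[i] -> R[i]) : exists2 C : R, 0 <= C & forall N,
  nrm (fun s => \sum_(z <- rs) c z * gabor_part (pt z) N s - \sum_(z <- rs) c z * gabor (pt z) s)
    <= C * 2^-1 ^+ N.
Proof.
elim: rs => [|z l [C C0 hC]].
  exists 0 => // N; rewrite mul0r (_ : (fun s => _) = (fun=> 0)) ?nrm0//.
  by apply/funext => s; rewrite !big_nil subr0.
have [Lg [A A0 hA]] := gabor_approx (pt z).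
exists (nc (c z) * A + C); first by rewrite addr_ge0 ?mulr_ge0 ?nc_ge0.
move=> N; rewrite mulrDl.
have Lp : L2 (fun s => gabor_part (pt z) N s - gabor (pt z) s).
  by apply: L2B => //; exact: L2_phi_sum.
rewrite (_ : (fun s => _) = (fun s => c z * (gabor_part (pt z) N s - gabor (pt z) s) +
    (\sum_(z <- l) c z * gabor_part (pt z) N s - \sum_(z <- l) c z * gabor (pt z) s))); last first.
  by apply/funext => s; rewrite !big_cons; ring.
apply: (le_trans (nrmD _ _)).
- exact: L2Z.
- apply: L2B; apply: L2_sum => u _; apply: L2Z; [exact: L2_phi_sum|exact: L2_gabor].
- apply: lerD => //; rewrite nrmZ// -mulrA; apply: ler_wpM2l; first exact: nc_ge0.
  by rewrite nrmBC.
Qed.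

(** After division by [omega], the combination with coefficients [c] has the moments [y n] as its
    Hermite coefficients. A bound on all long partial sums therefore passes to the limit. *)
Lemma phi_combination rs (c : R[i] -> R[i]) m D (B : R) :
  let y n := \sum_(z <- rs) c z * z ^+ n in
  (forall N, nrm (fun s => phi_sum y (N + D) s - phi m s) <= B) ->
  exists2 v, lin_span ((@gabor R) @` [set p | cpx p \in rs]) v & nrm (fun s => phi m s - v s) <= B.
Proof.
move=> y hB.
pose v (s : R) := \sum_(z <- rs) (c z / omega (pt z)) * gabor (pt z) s.
pose w N (s : R) := \sum_(z <- rs) (c z / omega (pt z)) * gabor_part (pt z) N s.
have wE N : w N = phi_sum y N.
  apply/funext => s; rewrite /w /phi_sum /gabor_part.
  under eq_bigr do rewrite /phi_sum mulr_sumr.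
  rewrite exchange_big /=; apply: eq_bigr => n _.
  rewrite /y mulr_suml; apply: eq_bigr => z _.
  by rewrite ptK mulrA mulrA -[_ / _ * _]mulrA mulVf ?omega_neq0// mulr1.
have Lv : L2 v by apply: L2_sum => z _; apply: L2Z; exact: L2_gabor.
have Lw N : L2 (w N) by rewrite wE; exact: L2_phi_sum.
exists v.
  pose V z (s : R) := if z \in rs then c z / omega (pt z) * gabor (pt z) s else 0.
  rewrite (_ : v = fun s => \sum_(z <- rs) V z s); last first.
    by apply/funext => s; apply: eq_big_seq => z zrs; rewrite /V zrs.
  apply: lin_span_sum => z; rewrite /V; case zrs: (z \in rs); last exact: lin_span0.
  by apply: lin_spanZ; apply: lin_span_in; exists (pt z) => //=; rewrite ptK.
have [C C0 hC] := gabor_sum_approx rs (fun z => c z / omega (pt z)).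
apply: (@le_half _ _ _ C) => N.
apply: le_trans (nrm_tri (g := w (N + D)) _ (Lw _) Lv) _; first exact: L2_phi.
apply: lerD.
  by rewrite nrmBC wE.
apply: (le_trans (hC _)); apply: ler_wpM2l => //.
by apply: ler_wiXn2l; rewrite ?invr_ge0 ?invf_le1 ?ler1n ?leq_addr.
Qed.

(** The weights of [lagrange_dual] at the zeros of P give D initial moments equal to the Hermite
    coefficients of [phi m]; the later ones obey the recurrence of P, hence that of T. The factor 1
    - X / t is there because P will contain q, whose coefficients all have equal size at radius t,
    while q (1 - X / t) is a binomial that its top term dominates slightly beyond t. *)
Lemma phi_approx (P : {poly R[i]}) D (t r : R) m : size P = D.+1 -> separable_poly P ->
  0 < t <= r -> 1 <= r -> r ^+ 2 <= D.+1%:R / pi -> (m < D)%N ->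
  let T := P * (1 - rX t^-1 1) in
  \sum_(i < D.+1) nc T`_i * r ^+ i <= 3 / 4 * (nc T`_D.+1 * r ^+ D.+1) ->
  exists2 v, lin_span ((@gabor R) @` [set p | root P (cpx p)]) v &
    nrm (fun s => phi m s - v s) <=
      12 * Num.sqrt c0 * pnorm 1 P / (nc (lead_coef P) * kap D).
Proof.
move=> sP sep /andP[t0 tr] r1 rD mD T dom.
have r0 : 0 < r by exact: lt_le_trans r1.
have P0 : P != 0 by rewrite -size_poly_gt0 sP.
have [rs [urs Prs szrs]] := separable_roots P0 sep.
have {}szrs : size rs = D by rewrite sP in szrs; case: szrs.
have memrs z : (z \in rs) = root P z by rewrite Prs rootZ ?lead_coef_eq0// root_prod_XsubC.
pose c z := (lagrange_basis rs z)`_m.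
pose y n := \sum_(z <- rs) c z * z ^+ n.
have ym n : (n < D)%N -> y n = (n == m)%:R by rewrite -szrs; exact: lagrange_dual.
have rec (Q : {poly R[i]}) N n : (size Q <= N)%N -> (forall z, root P z -> root Q z) ->
    \sum_(i < N) Q`_i * y (n + i)%N = 0.
  move=> sQ rQ; under eq_bigr do rewrite mulr_sumr.
  rewrite exchange_big /= big_seq big1// => z; rewrite memrs => /rQ /rootP h.
  transitivity (c z * z ^+ n * Q.[z]); last by rewrite h mulr0.
  rewrite (horner_coef_wide _ sQ) mulr_sumr; apply: eq_bigr => i _.
  by rewrite exprD; ring.
have lP : 0 < nc (lead_coef P) by rewrite nc_gt0 lead_coef_eq0.
have PD : P`_D = lead_coef P by rewrite lead_coefE sP.
have TD : nc T`_D.+1 = nc (lead_coef P) / t.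
  rewrite /T /rX expr1 mulrBr mulr1 -scalerAr coefB coefZ coefMX /= nth_default ?sP// sub0r PD.
  by rewrite ncN ncM nc_real ger0_norm ?invr_ge0 ?(ltW t0)// mulrC.
have sT : (size T <= D.+2)%N.
  rewrite (leq_trans (size_polyMleq _ _))// sP.
  have : (size (1 - rX t^-1 1 : {poly R[i]})%R <= 2)%N.
    by rewrite (leq_trans (size_polyD _ _))// geq_max size_poly1 size_polyN size_rX.
  by move=> h; rewrite addSn /=; apply: (leq_trans (leq_add (leqnn D) h)); rewrite addn2.
(* The recurrence of T, of degree D + 1, starts one moment late; the moment of order D comes from P
   itself. *)
have yD : nc (y D) <= pnorm 1 P / nc (lead_coef P).
  have := rec P D.+1 0%N; rewrite sP => /(_ (leqnn _) (fun z => id)).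
  rewrite big_ord_recr /= PD addrC => /eqP; rewrite addr_eq0 => /eqP e.
  rewrite ler_pdivlMr// mulrC -ncM add0n in e *; rewrite e ncN.
  apply: (le_trans (nc_sum _ _ _)); rewrite /pnorm /wnorm sP big_ord_recr /= ler_wpDr//.
    by rewrite mulr_ge0 ?nc_ge0 ?exprn_ge0.
  apply: ler_sum => i _; rewrite add0n ym// ncM expr1n; apply: ler_wpM2l; first exact: nc_ge0.
  by case: (_ == _); rewrite ?nc1 ?nc0.
have T1 : pnorm 1 T / (nc T`_D.+1 * r ^+ D.+1) <= 2 * (pnorm 1 P / nc (lead_coef P) / r ^+ D).
  have p1 : pnorm 1 T <= pnorm 1 P * (1 + t^-1).
    apply: (le_trans (pnormM _ _ ler01)); apply: ler_wpM2l; first exact: pnorm_ge0.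
    apply: (le_trans (pnormB _ _ ler01)).
    by rewrite pnorm1 pnorm_rX expr1n mulr1 ger0_norm// invr_ge0 ltW.
  have rD0 : 0 < r ^+ D by rewrite exprn_gt0.
  rewrite TD ler_pdivrMr; last by rewrite mulr_gt0 ?divr_gt0// exprn_gt0.
  have -> : 2 * (pnorm 1 P / nc (lead_coef P) / r ^+ D) * (nc (lead_coef P) / t * r ^+ D.+1)
     = pnorm 1 P * (2 * r / t) by rewrite exprS; field; rewrite !gt_eqF.
  apply: (le_trans p1); apply: ler_wpM2l; first exact: pnorm_ge0.
  rewrite ler_pdivlMr// mulrDl mul1r mulVf ?gt_eqF//; lra.
have TD0 : nc T`_D.+1 != 0 by rewrite TD mulf_neq0 ?gt_eqF// invr_gt0.
have rT z : root P z -> root T z by move=> /rootP Pz; apply/rootP; rewrite hornerM Pz mul0r.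
(* 12 = 4 (1 + 2): the moment of order D counts once, the boundary term of T twice. *)
have tail M : \sum_(0 <= n < M) nc (y (n + D)%N) / r ^+ (n + D) <= 12 * (pnorm 1 P / nc (lead_coef P) / r ^+ D).
  apply: (le_trans (recurrence_tail M mD r1 TD0 dom ym (fun n => rec T D.+2 n sT rT))).
  have : nc (y D) / r ^+ D <= pnorm 1 P / nc (lead_coef P) / r ^+ D.
    by apply: ler_wpM2r => //; rewrite invr_ge0 exprn_ge0// ltW.
  by move: T1; lra.
pose B := 12 * Num.sqrt c0 * pnorm 1 P / (nc (lead_coef P) * kap D); suff /phi_combination[v Sv hv] : forall N,
    nrm (fun s => phi_sum y (N + D) s - phi m s) <= B.
  exists v => //; rewrite (_ : [set p | _] = [set p | cpx p \in rs])//.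
  by apply/funext => p; rewrite /= memrs.
rewrite /B => N.
rewrite (_ : (fun s => _) = (fun s => \sum_(0 <= n < N) y (n + D)%N * phi (n + D) s)); last first.
  apply/funext => s; rewrite /phi_sum (big_cat_nat (leq0n D)) ?leq_addl//=.
  rewrite (_ : \sum_(0 <= n < D) _ = phi m s) 1?addrC ?addrK; last first.
    rewrite big_mkord (bigD1 (Ordinal mD))//= ym// eqxx mul1r big1 ?addr0// => i im.
    rewrite ym// (_ : (_ == _) = false) ?mul0r//; apply: contraNF im => /eqP h.
    by apply/eqP/val_inj.
  by rewrite -{1}(add0n D) big_addn addnK.
have kD := kap_gt0 (R := R) D.
apply: (le_trans (nrm_sum _ _)) => [n|]; first by apply: L2Z; exact: L2_phi.
apply: (@le_trans _ _ (\sum_(0 <= n < N) (Num.sqrt c0 * r ^+ D / kap D) * (nc (y (n + D)%N) / r ^+ (n + D)))).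
  apply: ler_sum => n _; rewrite nrmZ; last exact: L2_phi.
  rewrite nrm_phiE [leRHS]mulrCA; apply: ler_wpM2l; first exact: nc_ge0.
  have kn := kap_gt0 (R := R) (n + D).
  rewrite ler_pdivrMr// exprD.
  (* Beyond degree D the norms of the [phi n] decay at least like powers of 1 / r, which turns the
     weighted l1 bound on the moments into a bound on norms. *)
  have h : kap D * r ^+ n <= kap (n + D) by rewrite addnC; apply: kap_add_ge => //; exact: ltW.
  have -> : Num.sqrt c0 * r ^+ D / kap D / (r ^+ n * r ^+ D) * kap (n + D) =
    Num.sqrt c0 * (kap (n + D) / (kap D * r ^+ n)).
    by field; rewrite !gt_eqF ?exprn_gt0.
  rewrite -[leLHS]mulr1; apply: ler_wpM2l; first exact: sqrtr_ge0.
  by rewrite ler_pdivlMr ?mul1r// mulr_gt0// exprn_gt0.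
rewrite -mulr_sumr; apply: (le_trans (ler_wpM2l _ (tail N))).
  by rewrite divr_ge0 ?(ltW kD)// mulr_ge0 ?sqrtr_ge0// exprn_ge0// ltW.
rewrite le_eqVlt; apply/orP; left; apply/eqP; field.
by rewrite !gt_eqF ?exprn_gt0.
Qed.

End phi_approximation.

(** * Existence of the next stage *)

Section binomial_factors.
Context {R : realType}.
Local Notation nc := (@Normc.normc R).
Implicit Types (p q P Q g S : {poly R[i]}) (c t x : R) (n m k : nat) (z : R[i]).

Lemma rXN c n : rX (- c) n = - rX c n.
Proof. by rewrite /rX rmorphN scaleNr. Qed.

Lemma realC_neq0 c : c != 0 -> (c%:C)%C != 0.
Proof. by rewrite -!nc_gt0 nc_real normr_gt0. Qed.

Lemma size_binom c n : c != 0 -> (0 < n)%N -> size (upol c n) = n.+1.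
Proof.
move=> c0 n0; rewrite /upol addrC size_polyDl size_scale ?realC_neq0// size_polyXn//.
by rewrite size_poly1.
Qed.

Lemma lead_binom c n : c != 0 -> (0 < n)%N -> lead_coef (upol c n) = (c%:C)%C.
Proof.
move=> c0 n0; rewrite /upol addrC lead_coefDl ?size_scale ?realC_neq0// ?size_polyXn ?size_poly1//.
by rewrite lead_coefZ lead_coefXn mulr1.
Qed.

(** All zeros of a binomial share one modulus, so coprimality of the stage factors reduces to
    comparing moduli. *)
Lemma root_binom c n z : root (upol c n) z -> `|c| * nc z ^+ n = 1.
Proof.
rewrite rootE hornerD hornerC horner_rX addrC addr_eq0 => /eqP h.
by rewrite -nc_real -ncX -ncM h ncN nc1.
Qed.

Lemma deriv_binom c n z : (upol c n)^`().[z] = (c%:C)%C * (z ^+ n.-1 *+ n).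
Proof. by rewrite derivD derivC add0r derivZ derivXn hornerZ hornerMn hornerXn. Qed.

Lemma separable_binom c n : c != 0 -> (0 < n)%N -> separable_poly (upol c n).
Proof.
move=> c0 n0; rewrite separable_poly.unlock; apply/Pdiv.ClosedField.coprimepP => z rz.
rewrite deriv_binom mulf_neq0 ?realC_neq0// mulrn_eq0 negb_or -lt0n n0 expf_neq0//.
apply: contraTneq rz => ->; rewrite rootE hornerD hornerC horner_rX expr0n eqn0Ngt n0 mulr0 addr0.
exact: oner_neq0.
Qed.

Lemma lpolE x : lpol x = upol x^-1 1. Proof. by []. Qed.

Lemma vpolE t m : vpol t m = upol (- t^-1 ^+ m) m.
Proof. by rewrite /upol rXN. Qed.

Lemma root_vpol t m z : 0 < t -> (0 < m)%N -> root (vpol t m) z -> nc z = t.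
Proof.
move=> t0 m0; rewrite vpolE => /root_binom; rewrite normrN ger0_norm ?exprn_ge0 ?invr_ge0 ?(ltW t0)//.
rewrite exprVn mulrC => /divr1_eq h.
by apply/eqP; rewrite -(@eqrXn2 _ m)// ?nc_ge0 ?(ltW t0)//; apply/eqP.
Qed.

Lemma root_lpol x z : 0 < x -> root (lpol x) z -> nc z = x.
Proof.
move=> x0; rewrite lpolE => /root_binom; rewrite ger0_norm ?invr_ge0 ?(ltW x0)// expr1 mulrC.
exact: divr1_eq.
Qed.

Lemma qpol_dvd t m : qpol t m %| vpol t m.
Proof. by rewrite -qpol_vpol dvdp_mulIr. Qed.

Lemma root_qpol t m z : 0 < t -> (0 < m)%N -> root (qpol t m) z -> nc z = t.
Proof.
move=> t0 m0 rz; apply: (@root_vpol t m) => //.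
by rewrite -qpol_vpol rootM rz orbT.
Qed.

Lemma separable_vpol t m : 0 < t -> (0 < m)%N -> separable_poly (vpol t m).
Proof.
by move=> t0 m0; rewrite vpolE; apply: separable_binom; rewrite ?oppr_eq0 ?expf_neq0 ?invr_eq0 ?gt_eqF.
Qed.

Lemma size_qpol t m : 0 < t -> (0 < m)%N -> size (qpol t m) = m.
Proof.
move=> t0; case: m => // m _; apply/eqP; rewrite eqn_leq size_qpol_le /= ltnNge.
apply/negP => h; have := @coef_qpol _ t m.+1 m (leqnn _); rewrite nth_default// => /esym /eqP.
by apply/negP; rewrite realC_neq0// expf_neq0// invr_eq0 gt_eqF.
Qed.

Lemma lead_qpol t m : 0 < t -> lead_coef (qpol t m.+1) = ((t^-1 ^+ m)%:C)%C.
Proof. by move=> t0; rewrite lead_coefE size_qpol// coef_qpol. Qed.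

Lemma root_bound p : p != 0 -> exists B : R, forall z, root p z -> nc z < B.
Proof.
move=> p0; have [rs prs] := closed_field_poly_normal p.
exists (\sum_(z <- rs) nc z + 1) => z; rewrite prs rootZ ?lead_coef_eq0// root_prod_XsubC => zrs.
rewrite (big_rem z zrs) /= -addrA ltrDl ltr_wpDl//.
by apply: sumr_ge0 => i _; exact: nc_ge0.
Qed.

Lemma coprimep_moduli p q (B : R) : (forall z, root p z -> nc z < B) ->
  (forall z, root q z -> B <= nc z) -> coprimep p q.
Proof.
move=> hp hq; apply/Pdiv.ClosedField.coprimepP => z /hp pz.
rewrite -[_ == _]/(root q z); apply/negP => /hq qz.
by move: (lt_le_trans pz qz); rewrite ltxx.
Qed.

(** Domination by the leading term is multiplicative, so the recurrence polynomial T can be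
    estimated factor by factor. *)
Lemma pnorm_dominated p q r a b : 0 <= r -> 0 <= a ->
  pnorm r p <= a * (nc (lead_coef p) * r ^+ (size p).-1) ->
  pnorm r q <= b * (nc (lead_coef q) * r ^+ (size q).-1) -> p != 0 -> q != 0 ->
  pnorm r (p * q) <= a * b * (nc (lead_coef (p * q)) * r ^+ (size (p * q)%R).-1).
Proof.
move=> r0 a0 hp hq p0 q0; apply: (le_trans (pnormM _ _ r0)).
apply: (le_trans (ler_pM (pnorm_ge0 _ r0) (pnorm_ge0 _ r0) hp hq)).
rewrite lead_coefM ncM size_mul// le_eqVlt; apply/orP; left; apply/eqP.
rewrite -!size_poly_gt0 in p0 q0.
rewrite (_ : (size p + size q).-1.-1 = (size p).-1 + (size q).-1)%N; last by lia.
by rewrite exprD; ring.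
Qed.

Lemma pnorm_binom_dominated c n (r e : R) : 0 < r -> c != 0 -> (0 < n)%N ->
  1 <= e * (`|c| * r ^+ n) ->
  pnorm r (upol c n) <= (1 + e) * (nc (lead_coef (upol c n)) * r ^+ (size (upol c n)).-1).
Proof.
move=> r0 c0 n0 h; rewrite lead_binom// size_binom// nc_real succnK.
apply: (le_trans (pnormD _ _ (ltW r0))); rewrite pnorm1 pnorm_rX mulrDl mul1r addrC.
by rewrite lerD2l.
Qed.

End binomial_factors.

(** * The completeness estimate of a stage *)

Section near_completeness.
Context {R : realType}.
Local Notation nc := (@Normc.normc R).
Local Notation kap := (@kap R).
Local Notation tk := (@tk R).
Implicit Types (p q g P Q S : {poly R[i]}) (r t x c e : R) (k : nat).

Context (d : nat) (b tau : R) (b0 : 0 < b) (tau0 : 0 < tau).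
Local Notation rhok := (stage_rho b tau).
Local Notation uk := (stage_u d b tau).
Local Notation sk := (stage_s d b tau).
Local Notation qk := (@stage_q R).
Local Notation lk := (@stage_l R).
Local Notation vk := (@stage_v R).

Lemma bernoulli_le (a : R) n : 0 <= a -> 1 + n%:R * a <= (1 + a) ^+ n.
Proof.
move=> a0; elim: n => [|n ih]; first by rewrite mul0r addr0 expr0.
rewrite exprS -natr1; apply: le_trans (ler_wpM2l _ ih); last by rewrite addr_ge0.
have : 0 <= n%:R * (a * a) by rewrite !mulr_ge0.
have -> : (1 + a) * (1 + n%:R * a) = 1 + (n%:R + 1) * a + n%:R * (a * a) by ring.
by rewrite lerDl.
Qed.

(** (1 + 1/20)^2 (1 + 1/4)^2 < 7/4: the allowances for S and u, and for 1 + X / x and v. *)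
Lemma dominated_rest (X Y : R) : 0 <= X ->
  Y + X <= (1 + 20^-1) * ((1 + 20^-1) * ((1 + 4^-1) * (1 + 4^-1))) * X -> Y <= 3 / 4 * X.
Proof. by move=> X0; lra. Qed.

(** Bernoulli's inequality. At radius [tk k] the two terms of v have equal size; moving to [tk k.+1]
    gives the leading one an advantage of 4. *)
Lemma tkS_ratio k : (0 < k)%N -> 4 <= (tk k.+1 / tk k) ^+ (2 * k).
Proof.
move=> k0; have kR : 0 < k%:R :> R by rewrite ltr0n.
have sp : 0 < Num.sqrt pi :> R by rewrite sqrtr_gt0 pi_gt0.
have -> : tk k.+1 / tk k = 1 + k%:R^-1.
  by rewrite /tk -natr1; field; rewrite !gt_eqF.
have {}h : 2 <= (1 + k%:R^-1) ^+ k :> R.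
  apply: le_trans (bernoulli_le k _); last by rewrite invr_ge0 ltW.
  by rewrite mulfV ?gt_eqF.
rewrite mulnC exprM (_ : 4 = 2 ^+ 2); last by ring.
by apply: lerXn2r; rewrite ?nnegrE// (le_trans _ h).
Qed.

Lemma leadS_sk S k : (0 < k)%N -> (d < k ^ 2)%N -> size S = d.+1 ->
  size (S * sk k) = (k ^ 2 + 2 * k).+1 /\
  nc (lead_coef (S * sk k)) = nc (lead_coef S) * (rhok k * (4 / tk k ^+ (2 * k))).
Proof.
move=> k0 dk sS; have t0 := tk_gt0 (R := R) k0; have r0 := rhok_gt0 (R := R) b0 tau0 k.
have N0 : (0 < k ^ 2 - d)%N by rewrite subn_gt0.
have x0 : 0 < tk k / 4 by rewrite divr_gt0.
have su : size (uk k) = (k ^ 2 - d).+1 by rewrite size_binom ?gt_eqF.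
have sl : size (lk k) = 2%N by rewrite /stage_l lpolE size_binom ?gt_eqF// invr_gt0.
have k2 : (0 < 2 * k)%N by rewrite muln_gt0.
have sq : size (qk k) = (2 * k)%N by rewrite size_qpol.
have S0 : S != 0 by rewrite -size_poly_gt0 sS.
have u0 : uk k != 0 by rewrite -size_poly_gt0 su.
have l0 : lk k != 0 by rewrite -size_poly_gt0 sl.
have q0 : qk k != 0 by rewrite -size_poly_gt0 sq.
split.
  rewrite /stage_s size_mul ?mulf_neq0// (size_mul (mulf_neq0 u0 q0) l0) (size_mul u0 q0).
  by rewrite sS su sq sl; clear -dk k2; lia.
rewrite /stage_s !lead_coefM !ncM; congr (_ * _).
rewrite (lead_binom _ N0) ?gt_eqF// nc_real ger0_norm ?(ltW r0)//.
rewrite /stage_l lpolE lead_binom ?gt_eqF ?invr_gt0// nc_real ger0_norm ?invr_ge0 ?(ltW x0)//.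
rewrite /stage_q -(prednK k2) lead_qpol// nc_real ger0_norm ?exprn_ge0 ?invr_ge0 ?(ltW t0)//.
by rewrite -mulrA; congr (_ * _); rewrite exprVn exprS; field; rewrite !gt_eqF ?exprn_gt0.
Qed.

Lemma near_phi_approx S : size S = d.+1 ->
  \forall k \near \oo, separable_poly (S * sk k) -> forall m, (m < k ^ 2 + 2 * k)%N ->
    exists2 v, lin_span ((@gabor R) @` [set p | root (S * sk k) (cpx p)]) v &
      nrm (fun s => phi m s - v s) <=
        3 * Num.sqrt c0 * pnorm 1 (S * sk k) * b / (tau * nc (lead_coef S)).
Proof.
move=> sS; have S0 : S != 0 by rewrite -size_poly_gt0 sS.
have lS : 0 < nc (lead_coef S) by rewrite nc_gt0 lead_coef_eq0.
have [A A1 hA] := @low_terms_small R d S (20^-1 * nc (lead_coef S)) ltac:(by rewrite mulr_gt0).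
have e20 : 0 < 20 :> R by [].
near=> k => sep m mD.
have [k0 _ dk] : window d k by near: k; exact: near_window.
have tA : A <= tk k by near: k; exact: near_tk.
have rt : 20 <= rhok k * tk k ^+ (k ^ 2 - d) by near: k; exact: near_rho_large.
have t0 := tk_gt0 (R := R) k0; have r0 := rhok_gt0 (R := R) b0 tau0 k.
have N0 : (0 < k ^ 2 - d)%N by rewrite subn_gt0.
have k2 : (0 < 2 * k)%N by rewrite muln_gt0.
have x0 : 0 < tk k / 4 by rewrite divr_gt0.
set D := (k ^ 2 + 2 * k)%N in mD *.
(* [D.+1] is [k.+1 ^ 2], so this is the largest radius that [kap_add_ge] allows at degree D. *)
pose r := tk k.+1.
have tr : tk k <= r.
  apply: ler_wpM2r; first by rewrite invr_ge0 sqrtr_ge0.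
  by rewrite ler_nat.
have rp : 0 < r by exact: lt_le_trans tr.
have [sP lP] := leadS_sk k0 dk sS.
have P0 : S * sk k != 0 by rewrite -size_poly_gt0 sP.
have lPp : 0 < nc (lead_coef (S * sk k)) by rewrite nc_gt0 lead_coef_eq0.
(* rho kap (k ^ 2) = tau / b, and [kap D] is at least t^(2k) kap (k ^ 2), which makes up for the
   small leading coefficient of q (1 + X / x); the 4 is t / x. *)
have kD : nc (lead_coef S) * tau * 4 / b <= nc (lead_coef (S * sk k)) * kap D.
  have h : kap (k ^ 2) * tk k ^+ (2 * k) <= kap D.
    apply: kap_add_ge; first exact: ltW.
    by rewrite tk_sq; apply: ler_wpM2r; rewrite ?invr_ge0 ?pi_ge0// ler_nat.
  rewrite lP /stage_rho.
  have kn := kap_gt0 (R := R) (k ^ 2).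
  apply: (@le_trans _ _ (nc (lead_coef S) * tau * 4 / b * (kap D / (kap (k ^ 2) * tk k ^+ (2 * k))))).
    rewrite -[leLHS]mulr1; apply: ler_wpM2l; first by rewrite divr_ge0 ?(ltW b0)// !mulr_ge0 ?(ltW tau0) ?(ltW lS).
    by rewrite ler_pdivlMr ?mul1r// mulr_gt0// exprn_gt0.
  rewrite le_eqVlt; apply/orP; left; apply/eqP; field.
  by rewrite !gt_eqF ?exprn_gt0.
have TE : S * sk k * (1 - rX (tk k)^-1 1) = S * (uk k * (lk k * vk k)).
  rewrite /stage_v -qpol_vpol /stage_s /stage_q; ring.
have vE : vk k = upol (- (tk k)^-1 ^+ (2 * k)) (2 * k) by rewrite /stage_v vpolE.
have lE : lk k = upol (tk k / 4)^-1 1 by [].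
have c1 : (tk k / 4)^-1 != 0 by rewrite invr_neq0 ?gt_eqF.
have c2 : - (tk k)^-1 ^+ (2 * k) != 0 by rewrite oppr_eq0 expf_neq0// invr_neq0 ?gt_eqF.
have hl : pnorm r (lk k) <= (1 + 4^-1) * (nc (lead_coef (lk k)) * r ^+ (size (lk k)).-1).
  rewrite lE; apply: pnorm_binom_dominated => //.
  rewrite ger0_norm ?invr_ge0 ?(ltW x0)// expr1 invf_div.
  have -> : 4^-1 * (4 / tk k * r) = r / tk k by field; rewrite gt_eqF.
  by rewrite ler_pdivlMr// mul1r.
have hv : pnorm r (vk k) <= (1 + 4^-1) * (nc (lead_coef (vk k)) * r ^+ (size (vk k)).-1).
  rewrite vE; apply: pnorm_binom_dominated => //.
  rewrite normrN ger0_norm ?exprn_ge0 ?invr_ge0 ?(ltW t0)// -exprMn [_^-1 * r]mulrC.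
  by rewrite ler_pdivlMl// mulr1; exact: tkS_ratio.
have hu : pnorm r (uk k) <= (1 + 20^-1) * (nc (lead_coef (uk k)) * r ^+ (size (uk k)).-1).
  apply: pnorm_binom_dominated => //; first by rewrite gt_eqF.
  rewrite ger0_norm ?(ltW r0)// ler_pdivlMl// mulr1; apply: (le_trans rt).
  apply: ler_wpM2l; first exact: ltW.
  by apply: lerXn2r; rewrite ?nnegrE// ?(ltW rp)// (ltW t0).
have hS : pnorm r S <= (1 + 20^-1) * (nc (lead_coef S) * r ^+ (size S).-1).
  rewrite (@pnorm_lead R d)// sS /=.
  by rewrite [leRHS]mulrDl mul1r addrC lerD2l mulrA; exact: hA (le_trans tA tr).
have v0 : vk k != 0 by rewrite -size_poly_gt0 vE size_binom.
have l0 : lk k != 0 by rewrite -size_poly_gt0 lE size_binom.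
have u0 : uk k != 0 by rewrite -size_poly_gt0 size_binom// gt_eqF.
have a4 : 0 <= 1 + 4^-1 :> R by rewrite addr_ge0.
have a20 : 0 <= 1 + 20^-1 :> R by rewrite addr_ge0.
have hlv := pnorm_dominated (ltW rp) a4 hl hv l0 v0.
have hulv := pnorm_dominated (ltW rp) a20 hu hlv u0 (mulf_neq0 l0 v0).
have hT := pnorm_dominated (ltW rp) a20 hS hulv S0 (mulf_neq0 u0 (mulf_neq0 l0 v0)).
rewrite -TE in hT.
set P := S * sk k in sP lP P0 lPp kD TE hT sep *.
set T := P * (1 - rX (tk k)^-1 1) in TE hT.
have sT : size T = D.+2.
  have c : - (tk k)^-1 != 0 by rewrite oppr_eq0 invr_neq0 ?gt_eqF.
  have f : 1 - rX (tk k)^-1 1 = upol (- (tk k)^-1) 1 :> {poly R[i]} by rewrite /upol rXN.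
  rewrite /T f size_mul// -?size_poly_gt0 size_binom// sP addn2 //.
have dom : \sum_(i < D.+1) nc T`_i * r ^+ i <= 3 / 4 * (nc T`_D.+1 * r ^+ D.+1).
  have TD : T`_D.+1 = lead_coef T by rewrite lead_coefE sT.
  rewrite (@pnorm_lead R D.+1)// sT /= in hT; rewrite TD.
  have : 0 <= nc (lead_coef T) * r ^+ D.+1 by rewrite mulr_ge0 ?nc_ge0// exprn_ge0// ltW.
  by move=> h; apply: dominated_rest h hT.
have t0r : 0 < tk k <= r by rewrite t0 tr.
have r1 : 1 <= r by apply: le_trans tr; near: k; exact: near_tk.
have rD : r ^+ 2 <= D.+1%:R / pi.
  rewrite /r tk_sq; apply: ler_wpM2r; first by rewrite invr_ge0 pi_ge0.
  by rewrite ler_nat /D -addn1 sqrnD muln1; clear; lia.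
have [v Sv hv'] := phi_approx sP sep t0r r1 rD mD dom.
exists v => //; apply: (le_trans hv').
have kDp := kap_gt0 (R := R) D.
rewrite ler_pdivrMr ?mulr_gt0//.
rewrite ler_pdivrMr// in kD.
have pP : 0 <= 3 * Num.sqrt c0 * pnorm 1 P by rewrite mulr_ge0 ?pnorm_ge0// mulr_ge0// sqrtr_ge0.
have -> : 12 * Num.sqrt c0 * pnorm 1 P = 3 * Num.sqrt c0 * pnorm 1 P * 4 by ring.
have -> : 3 * Num.sqrt c0 * pnorm 1 P * b / (tau * nc (lead_coef S)) * (nc (lead_coef P) * kap D) =
  3 * Num.sqrt c0 * pnorm 1 P * (nc (lead_coef P) * kap D * b / (tau * nc (lead_coef S))).
  by field; rewrite !gt_eqF.
apply: ler_wpM2l => //; rewrite ler_pdivlMr ?mulr_gt0//; apply: le_trans kD.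
by rewrite le_eqVlt; apply/orP; left; apply/eqP; ring.
Unshelve. all: end_near. Qed.

End near_completeness.

(** * Admissible stages and the passage to the next one *)

Section stages.
Context {R : realType}.
Local Notation nc := (@Normc.normc R).
Local Notation tk := (@tk R).
Implicit Types (p q g P Q S : {poly R[i]}) (r t x c e : R) (k : nat) (z : R[i]).

(** The rate of completeness per stage: 3/2 from the growth of S, 2 from tau, 1/4 from the leading
    coefficients. *)
Lemma phi_step_constant (K : nat) (c b : R) : 0 < b ->
  9 / 2 * c * (3 / 4) ^+ K = 3 * c * (3 / 2) ^+ K.+1 * b / (2^-1 ^+ K * (4 ^+ K * b)).
Proof.
move=> b0; rewrite exprS !expr_div_n exprVn.
have -> : 4 ^+ K = 2 ^+ K * 2 ^+ K :> R by rewrite -exprMn -natrM.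
by field; rewrite !gt_eqF ?exprn_gt0.
Qed.

Lemma lt_abs_sum (a b c : R) : [/\ a < 1 + `|a| + `|b| + `|c|,
  b < 1 + `|a| + `|b| + `|c| & c < 1 + `|a| + `|b| + `|c|].
Proof.
have := ler_norm a; have := ler_norm b; have := ler_norm c.
by have := normr_ge0 a; have := normr_ge0 b; have := normr_ge0 c; split; lra.
Qed.

Lemma half3 : 3 / 2 = 1 + 2^-1 :> R. Proof. by field. Qed.

Lemma root_factor t : t != 0 -> root (1 - rX t^-1 1) ((t%:C)%C).
Proof.
move=> t0; rewrite rootE hornerD hornerN hornerC horner_rX expr1.
have -> : ((t^-1)%:C * t%:C)%C = 1 :> R[i] by rewrite -rmorphM mulVf.
by rewrite subrr.
Qed.

(* A stage: [core] carries the zeros common to [Spoly] and [gpoly]; the remaining zeros are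
   [- x] for [x] in [negs] (of [Spoly]) and [t] for [t] in [poss] (of [gpoly]). *)
Record state := State { core : {poly R[i]} ; negs : seq R ; poss : seq R }.

Definition Spoly st : {poly R[i]} := core st * \prod_(x <- negs st) lpol x.
Definition gpoly st : {poly R[i]} := core st * \prod_(t <- poss st) (1 - rX t^-1 1).

(** [adm_lead] and [adm_norm] carry completeness; [adm_len] and [adm_uniq] are what Lagrange's
    identity requires, with 0 as the additional node. *)
Record admissible (K : nat) st : Prop := {
  adm_size : size (gpoly st) = size (Spoly st);
  adm_sepS : separable_poly (Spoly st);
  adm_sepG : separable_poly ('X * gpoly st);
  adm_lead : nc (lead_coef (Spoly st)) = 4 ^+ K * nc (lead_coef (gpoly st));
  adm_norm : pnorm 1 (Spoly st) <= (3 / 2) ^+ K;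
  adm_len : size (poss st) = size (negs st);
  adm_uniq : uniq (0 :: poss st);
  adm_pos : all (fun t => 0 < t) (poss st);
  adm_neg : all (fun x => 0 < x) (negs st) }.

(* [bg (dual st z)] is biorthogonal to the Gabor atoms at the zeros of [Spoly st]. *)
Definition dual st z : {poly R[i]} :=
  ((Spoly st)^`().[z] * omega (pt z))^-1 *: (Spoly st %/ ('X - z%:P)).

Definition fcoef st t : R[i] := (omega (t, 0) * ('X * gpoly st)^`().[((t%:C)%C)])^-1.

(* Pairing [func st] with [bg p] gives the sum of [p / ('X * gpoly st)^`()] over 0 and [poss st]. *)
Definition func st : R -> R[i] := fun s => \sum_(t <- 0 :: poss st) fcoef st t * gabor (t, 0) s.

Section next_stage.
Context (K : nat) (st : state) (H : admissible K st).

Let S := Spoly st.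
Let g := gpoly st.
Let d := (size S).-1.
Let b := nc (lead_coef g).
Let tau : R := 2^-1 ^+ K.

Local Notation rhok := (stage_rho b tau).
Local Notation uk := (stage_u d b tau).
Local Notation sk := (stage_s d b tau).
Local Notation fk := (stage_f d b tau).
Local Notation qk := (@stage_q R).
Local Notation lk := (@stage_l R).
Local Notation vk := (@stage_v R).

(** As q (1 - X / t) is v, the factor u q can go into the common core, and the new zeros that are
    not shared are only - t / 4 and t. *)
Definition next_state k := State (core st * uk k * qk k) (tk k / 4 :: negs st) (tk k :: poss st).

Lemma Spoly_next k : Spoly (next_state k) = S * sk k.
Proof. by rewrite /Spoly /= big_cons /S /Spoly /stage_s /stage_l; ring. Qed.

Lemma gpoly_next k : gpoly (next_state k) = g * fk k.
Proof.
rewrite /gpoly /= big_cons /g /gpoly /stage_f /stage_v -qpol_vpol /stage_q; ring.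
Qed.

Let S0 : S != 0. Proof. exact: separable_poly_neq0 (adm_sepS H). Qed.
Let Xg0 : 'X * g != 0. Proof. exact: separable_poly_neq0 (adm_sepG H). Qed.
Let g0 : g != 0. Proof. by move: Xg0; rewrite mulf_eq0 negb_or => /andP[]. Qed.
Let sS : size S = d.+1. Proof. by rewrite prednK// size_poly_gt0. Qed.
Let sg : size g = d.+1. Proof. by rewrite /g (adm_size H). Qed.
Let b0 : 0 < b. Proof. by rewrite nc_gt0 lead_coef_eq0. Qed.
Let tau0 : 0 < tau. Proof. by rewrite exprn_gt0 ?invr_gt0. Qed.

Let near_basic (B : R) : \forall k \near \oo,
  [/\ window d k, B <= tk k / 4,
      rhok k * (tk k / 4) ^+ (k ^ 2 - d) <= 2^-1 & 2 <= rhok k * tk k ^+ (k ^ 2 - d)].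
Proof.
near=> k; split.
- by near: k; exact: near_window.
- by rewrite ler_pdivlMr//; near: k; exact: near_tk.
- by near: k; apply: near_rho_small.
- by near: k; apply: near_rho_large.
Unshelve. all: end_near. Qed.

(** rho |z|^N = 1 at the zeros, while rho r^N is at most 1/2 at r = t / 4 and at least 2 at r =
    t. *)
Let root_uk k z : window d k ->
  rhok k * (tk k / 4) ^+ (k ^ 2 - d) <= 2^-1 -> 2 <= rhok k * tk k ^+ (k ^ 2 - d) ->
  root (uk k) z -> tk k / 4 < nc z < tk k.
Proof.
move=> [k0 _ dk] h1 h2 /root_binom; have r0 := rhok_gt0 b0 tau0 k.
have t0 := tk_gt0 (R := R) k0.
have N0 : (0 < k ^ 2 - d)%N by rewrite subn_gt0.
rewrite ger0_norm ?(ltW r0)// => hz.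
have x0 : 0 < tk k / 4 by rewrite divr_gt0.
apply/andP; split; rewrite ltNge; apply/negP => hle.
  have : nc z ^+ (k ^ 2 - d) <= (tk k / 4) ^+ (k ^ 2 - d).
    by apply: lerXn2r; rewrite ?nnegrE ?nc_ge0 ?(ltW x0).
  by move=> /(ler_wpM2l (ltW r0)); rewrite hz => h; have := le_trans h h1; rewrite leNgt invf_lt1 ?ltr1n.
have : tk k ^+ (k ^ 2 - d) <= nc z ^+ (k ^ 2 - d).
  by apply: lerXn2r; rewrite ?nnegrE ?nc_ge0 ?(ltW t0).
by move=> /(ler_wpM2l (ltW r0)); rewrite hz => h; have := le_trans h2 h; rewrite (ler_nat _ 2 1).
Qed.

Let sep_next k : window d k ->
  rhok k * (tk k / 4) ^+ (k ^ 2 - d) <= 2^-1 -> 2 <= rhok k * tk k ^+ (k ^ 2 - d) ->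
  (forall z, root S z -> nc z < tk k / 4) -> (forall z, root ('X * g) z -> nc z < tk k / 4) ->
  [/\ (forall z, root (sk k) z -> tk k / 4 <= nc z), separable_poly (S * sk k)
    & separable_poly ('X * (g * fk k))].
Proof.
move=> win h1 h2 BS BG; have [k0 _ dk] := win.
have r0 := rhok_gt0 b0 tau0 k; have t0 := tk_gt0 (R := R) k0.
have N0 : (0 < k ^ 2 - d)%N by rewrite subn_gt0.
have k2 : (0 < 2 * k)%N by rewrite muln_gt0.
have x0 : 0 < tk k / 4 by rewrite divr_gt0.
have xt : tk k / 4 < tk k by rewrite ltr_pdivrMr// ltr_pMr// ltr1n.
have hu z := @root_uk k z win h1 h2.
have hq z : root (qk k) z -> nc z = tk k by exact: root_qpol.
have hv z : root (vk k) z -> nc z = tk k by exact: root_vpol.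
have hl z : root (lk k) z -> nc z = tk k / 4 by exact: root_lpol.
have su : separable_poly (uk k) by apply: separable_binom; rewrite ?gt_eqF.
have sv : separable_poly (vk k) by exact: separable_vpol.
have sq : separable_poly (qk k) by exact: dvdp_separable (qpol_dvd _ _) sv.
have sl : separable_poly (lk k).
  by rewrite /stage_l lpolE; apply: separable_binom; rewrite ?gt_eqF// invr_gt0.
have rs z : root (sk k) z -> tk k / 4 <= nc z.
  rewrite !rootM => /orP[/orP[/hu/andP[/ltW]//|/hq ->]|/hl ->//]; exact: ltW.
have rf z : root (fk k) z -> tk k / 4 <= nc z.
  rewrite !rootM => /orP[/hu/andP[/ltW]//|/hv ->]; exact: ltW.
have cuq : coprimep (uk k) (qk k).
  by apply: (@coprimep_moduli _ _ _ (tk k)) => z; [move=> /hu/andP[]|move=> /hq ->].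
have cuv : coprimep (uk k) (vk k).
  by apply: (@coprimep_moduli _ _ _ (tk k)) => z; [move=> /hu/andP[]|move=> /hv ->].
have cl : coprimep (lk k) (uk k * qk k).
  apply/Pdiv.ClosedField.coprimepP => z /hl hz; rewrite -[_ == _]/(root _ z) rootM.
  apply/negP => /orP[/hu/andP[]|/hq]; rewrite hz ?ltxx// => e.
  by move: xt; rewrite e ltxx.
have ss : separable_poly (sk k).
  rewrite /stage_s separable_mul sl separable_mul su sq cuq /=.
  by rewrite coprimep_sym.
split=> //.
- rewrite separable_mul (adm_sepS H) ss /=.
  exact: (@coprimep_moduli _ _ _ (tk k / 4)).
- rewrite mulrA separable_mul (adm_sepG H) separable_mul su sv cuv /=.
  exact: (@coprimep_moduli _ _ _ (tk k / 4)).
Qed.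

Lemma near_admissible (B : R) : \forall k \near \oo, admissible K.+1 (next_state k) /\
  (forall z, root (Spoly (next_state k)) z -> root S z \/ B < nc z).
Proof.
have [B1 hB1] := root_bound S0.
have [B2 hB2] := root_bound Xg0.
near=> k.
have [win xB h1 h2] : [/\ window d k,
  1 + `|B1| + `|B2| + `|B| <= tk k / 4,
  rhok k * (tk k / 4) ^+ (k ^ 2 - d) <= 2^-1 & 2 <= rhok k * tk k ^+ (k ^ 2 - d)].
  by near: k; exact: near_basic.
have [n1 _] : pnorm 1 (sk k - 1) <= 2^-1 /\ pnorm 1 (fk k - 1) <= 2^-1.
  by near: k; apply: near_factors_small.
have [k0 _ dk] := win.
have r0 := rhok_gt0 b0 tau0 k; have t0 := tk_gt0 (R := R) k0.
have x0 : 0 < tk k / 4 by rewrite divr_gt0.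
have N0 : (0 < k ^ 2 - d)%N by rewrite subn_gt0.
have k2 : (0 < 2 * k)%N by rewrite muln_gt0.
have [l1 l2 l3] := lt_abs_sum B1 B2 B.
have b1 := lt_le_trans l1 xB; have b2 := lt_le_trans l2 xB; have bB := lt_le_trans l3 xB.
have hS z : root S z -> nc z < tk k / 4 by move=> /hB1 h; exact: lt_trans h b1.
have hG z : root ('X * g) z -> nc z < tk k / 4 by move=> /hB2 h; exact: lt_trans h b2.
have [rs sepS sepG] := sep_next win h1 h2 hS hG.
have [szS ldS] := leadS_sk b0 tau0 k0 dk sS.
split; last first.
  move=> z; rewrite Spoly_next rootM => /orP[|/rs h]; first by left.
  by right; exact: lt_le_trans h.
have c2 : - (tk k)^-1 ^+ (2 * k) != 0 by rewrite oppr_eq0 expf_neq0// invr_neq0 ?gt_eqF.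
have vE : vk k = upol (- (tk k)^-1 ^+ (2 * k)) (2 * k) by rewrite /stage_v vpolE.
have su : size (uk k) = (k ^ 2 - d).+1 by rewrite size_binom ?gt_eqF.
have sv : size (vk k) = (2 * k).+1 by rewrite vE size_binom.
have u0 : uk k != 0 by rewrite -size_poly_gt0 su.
have v0 : vk k != 0 by rewrite -size_poly_gt0 sv.
split; rewrite ?Spoly_next ?gpoly_next//.
- rewrite szS /stage_f (size_mul g0 (mulf_neq0 u0 v0)) (size_mul u0 v0) sg su sv.
  by clear -dk; lia.
- rewrite ldS /stage_f [lead_coef (g * _)]lead_coefM [lead_coef (uk k * _)]lead_coefM !ncM.
  rewrite (lead_binom _ N0) ?gt_eqF// nc_real ger0_norm ?(ltW r0)//.
  rewrite vE lead_binom// nc_real normrN ger0_norm ?exprn_ge0 ?invr_ge0 ?(ltW t0)//.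
  by rewrite [nc (lead_coef S)](adm_lead H) -/g exprVn [4 ^+ K.+1]exprS; ring.
- apply: (le_trans (pnormM _ _ ler01)); rewrite exprS mulrC.
  apply: ler_pM; rewrite ?pnorm_ge0// ?(adm_norm H)//.
  by apply: (le_trans (pnormB1_le _ ler01)); rewrite half3 lerD2l.
- by rewrite /= (adm_len H).
- rewrite /= inE negb_or lt_eqF//=.
  have := adm_uniq H; rewrite /= => /andP[-> ->]; rewrite andbT /=.
  apply/negP => tp.
  have : root ('X * g) ((tk k)%:C)%C.
    rewrite rootM; apply/orP; right; rewrite /g /gpoly rootM; apply/orP; right.
    rewrite rootE horner_prod prodf_seq_eq0; apply/hasP; exists (tk k) => //=.
    by rewrite -[_ == _]/(root _ _) root_factor ?gt_eqF.
  move=> /hG; rewrite nc_real ger0_norm ?(ltW t0)// ltNge => /negP; apply.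
  by rewrite ler_pdivrMr// ler_peMr ?(ltW t0)// ler1n.
- by rewrite /= t0 (adm_pos H).
- by rewrite /= x0 (adm_neg H).
Unshelve. all: end_near. Qed.

Lemma near_gpoly_step : \forall k \near \oo,
  nrm (fun s => bg (gpoly (next_state k)) s - bg g s) <= (4 * expR 3 + 1) / Num.sqrt c0 * tau.
Proof.
near=> k; rewrite -bgB gpoly_next.
have -> : g * fk k - g = g * (fk k - 1) by rewrite mulrBr mulr1.
by near: k; exact: near_functional.
Unshelve. all: end_near. Qed.

Lemma near_phi_step : \forall k \near \oo, admissible K.+1 (next_state k) -> forall m, (m <= K)%N ->
  exists2 v, lin_span ((@gabor R) @` [set p | root (Spoly (next_state k)) (cpx p)]) v &
    nrm (fun s => phi m s - v s) <= 9 / 2 * Num.sqrt c0 * (3 / 4) ^+ K.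
Proof.
have h := near_phi_approx b0 tau0 sS.
near=> k => Hk m mK.
have Kk : (K < k)%N by near: k; exact: near_ge.
have mD : (m < k ^ 2 + 2 * k)%N by nia.
have sep : separable_poly (S * sk k) by have := adm_sepS Hk; rewrite Spoly_next.
have hk : separable_poly (S * sk k) -> forall m, (m < k ^ 2 + 2 * k)%N ->
    exists2 v, lin_span ((@gabor R) @` [set p | root (S * sk k) (cpx p)]) v &
      nrm (fun s => phi m s - v s) <=
        3 * Num.sqrt c0 * pnorm 1 (S * sk k) * b / (tau * nc (lead_coef S)).
  by near: k; exact: h.
have [v Sv hv] := hk sep m mD.
exists v; first by rewrite Spoly_next.
apply: (le_trans hv).
have n1 := adm_norm Hk; rewrite Spoly_next in n1.
have lS : nc (lead_coef S) = 4 ^+ K * b := adm_lead H.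
have K4 : 0 < 4 ^+ K :> R by rewrite exprn_gt0.
have -> : 9 / 2 * Num.sqrt c0 * (3 / 4) ^+ K =
   3 * Num.sqrt c0 * (3 / 2) ^+ K.+1 * b / (tau * nc (lead_coef S)).
  by rewrite lS /tau -phi_step_constant.
apply: ler_wpM2r; first by rewrite invr_ge0 mulr_ge0 ?(ltW tau0)// nc_ge0.
apply: ler_wpM2r; first exact: ltW.
by apply: ler_wpM2l => //; rewrite mulr_ge0// sqrtr_ge0.
Unshelve. all: end_near. Qed.

Lemma near_all_seq (T : eqType) (l : seq T) (P : T -> nat -> Prop) :
  (forall y : T, y \in l -> \forall k \near \oo, P y k) ->
  \forall k \near \oo, forall y : T, y \in l -> P y k.
Proof.
elim: l => [|z l ih] h; first by near=> k.
have h1 := h z (mem_head _ _).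
have h2 := ih (fun y yl => h y (mem_behead (s := z :: l) yl)).
near=> k => y; rewrite inE => /predU1P[->|yl]; first by near: k; exact: h1.
have : forall x : T, x \in l -> P x k by near: k; exact: h2.
exact.
Unshelve. all: end_near. Qed.

Let horner_near1 (P : {poly R[i]}) z (B e : R) : nc z <= B -> pnorm B (P - 1) <= e -> nc (P.[z] - 1) <= e.
Proof.
move=> zB hP; rewrite -[1](hornerC 1 z) -hornerN -hornerD.
by apply: (le_trans (horner_le_pnorm _ _)); apply: le_trans hP; apply: pnorm_mono; rewrite nc_ge0.
Qed.

Let near1_neq0 (w : R[i]) : nc (w - 1) <= 2^-1 -> 2^-1 <= nc w.
Proof. by move=> h; have := ncB_ge 1 (1 - w); rewrite subKr nc1 -(ncN (1 - w)) opprB; lra. Qed.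

(** Since S vanishes at z, the derivative of S s there is S'(z) s(z), and the dual polynomial is
    just multiplied by s / s(z). The increment splits into a part for [near_dual] and a scalar
    error. *)
Lemma dual_next k z : root S z -> (sk k).[z] != 0 ->
  dual (next_state k) z - dual st z =
  (sk k).[z]^-1 *: (dual st z * (sk k - 1) - ((sk k).[z] - 1) *: dual st z).
Proof.
move=> Sz sz; rewrite {1}/dual Spoly_next derivM hornerD [(S^`() * _).[_]]hornerM [(S * _).[_]]hornerM (rootP Sz) mul0r addr0.
have -> : (S * sk k) %/ ('X - z%:P) = (S %/ ('X - z%:P)) * sk k.
  by rewrite divp_mulAC// dvdp_XsubCl.
have -> : (S^`().[z] * (sk k).[z] * omega (pt z))^-1 *: (S %/ ('X - z%:P) * sk k) =
    (sk k).[z]^-1 *: (dual st z * sk k).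
  rewrite /dual -/S -[(_ *: _) * sk k]scalerAl [RHS]scalerA; congr (_ *: _).
  by rewrite -invfM; congr (_^-1); ring.
rewrite mulrBr mulr1 scalerBl scale1r opprB addrA subrK.
by rewrite [RHS]scalerBr [X in _ = _ - X]scalerA mulVf// scale1r.
Qed.

Lemma near_dual_step : \forall k \near \oo, forall z, root S z ->
  nrm (fun s => bg (dual (next_state k) z) s - bg (dual st z) s) <= tau.
Proof.
have [l [_ Sl _]] := separable_roots S0 (adm_sepS H).
have meml z : root S z -> z \in l.
  by rewrite Sl rootZ ?lead_coef_eq0// root_prod_XsubC.
suff h : forall z, z \in l -> \forall k \near \oo, root S z ->
    nrm (fun s => bg (dual (next_state k) z) s - bg (dual st z) s) <= tau.
  have {}h := near_all_seq h.
  near=> k => z Sz.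
  have hk : forall z, z \in l -> root S z ->
     nrm (fun s => bg (dual (next_state k) z) s - bg (dual st z) s) <= tau by near: k; exact: h.
  exact: hk (meml _ Sz) Sz.
move=> z _.
pose W := nrm (bg (dual st z)) + 1.
have W0 : 0 < W by rewrite ltr_wpDl// nrm_ge0.
have [Sz|nSz] := boolP (root S z); last by near=> k.
have szd : (size (dual st z) <= d)%N.
  by rewrite (leq_trans (size_scale_leq _ _))// size_divp ?polyXsubC_eq0// size_XsubC -/S sS subn1.
have e1 : 0 < tau / 4 by rewrite divr_gt0.
have e2 : 0 < tau / (4 * W) by rewrite divr_gt0// mulr_gt0.
near=> k => _.
have t1 : nrm (bg (dual st z * (sk k - 1))) <= tau / 4 by near: k; exact: near_dual.
have [p1 _] : pnorm (1 + nc z) (sk k - 1) <= 2^-1 /\ pnorm (1 + nc z) (fk k - 1) <= 2^-1.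
  by near: k; apply: near_factors_small; rewrite ?lerDl ?nc_ge0.
have [p2 _] : pnorm (1 + nc z) (sk k - 1) <= tau / (4 * W) /\
    pnorm (1 + nc z) (fk k - 1) <= tau / (4 * W).
  by near: k; apply: near_factors_small; rewrite ?lerDl ?nc_ge0.
have zB : nc z <= 1 + nc z by rewrite lerDr.
have s1 := near1_neq0 (horner_near1 zB p1); have s2 := horner_near1 zB p2.
have sn0 : 0 < nc (sk k).[z] by apply: lt_le_trans s1; rewrite invr_gt0.
rewrite -bgB dual_next -?nc_gt0//.
rewrite nrm_bgZ ncV ler_pdivrMl//.
apply: (@le_trans _ _ (tau / 2)); last first.
  by rewrite mulrC; apply: ler_wpM2r => //; exact: ltW.
rewrite bgB; apply: (le_trans (nrmB (L2_bg _) (L2_bg _))).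
have -> : tau / 2 = tau / 4 + tau / (4 * W) * W by field; rewrite gt_eqF.
apply: lerD => //; rewrite nrm_bgZ.
by apply: ler_pM; rewrite ?nc_ge0 ?nrm_ge0 ?lerDl.
Unshelve. all: end_near. Qed.

Let rootXg t : t \in 0 :: poss st -> root ('X * g) ((t%:C)%C).
Proof.
rewrite inE rootM => /predU1P[->|tp]; first by rewrite rootE hornerX eqxx.
apply/orP; right; rewrite /g /gpoly rootM; apply/orP; right.
rewrite rootE horner_prod prodf_seq_eq0; apply/hasP; exists t => //=.
rewrite -[_ == _]/(root _ _) root_factor// gt_eqF//.
by have /allP := adm_pos H; apply.
Qed.

Lemma fcoef_next k t : t \in 0 :: poss st -> (fk k).[((t%:C)%C)] != 0 ->
  fcoef (next_state k) t = fcoef st t / (fk k).[((t%:C)%C)].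
Proof.
move=> tp f0; rewrite /fcoef gpoly_next mulrA derivM hornerD [(('X * g)^`() * _).[_]]hornerM [('X * g * _).[_]]hornerM (rootP (rootXg tp)) mul0r addr0.
by rewrite -/g mulrA invfM.
Qed.

(** v'(t) = - 2k / t, and the factor X removes the 1 / t; the exponential is the inverse modulus of
    [omega] at t. *)
Lemma nc_fcoef_new k : window d k ->
  nc (fcoef (next_state k) (tk k)) = expR ((k ^ 2)%:R / 2) /
    (2 * k%:R * (1 + rhok k * tk k ^+ (k ^ 2 - d)) * nc g.[((tk k)%:C)%C]).
Proof.
move=> [k0 _ dk]; have r0 := rhok_gt0 b0 tau0 k; have t0 := tk_gt0 (R := R) k0.
have kR : 0 < k%:R :> R by rewrite ltr0n.
have k2 : (0 < 2 * k)%N by rewrite muln_gt0.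
rewrite /fcoef ncV ncM nc_omega /= expr0n addr0 tk_sq.
have -> : - (pi * ((k ^ 2)%:R / pi) / 2) = - ((k ^ 2)%:R / 2) :> R.
  by rewrite [pi * _]mulrC divfK// gt_eqF// pi_gt0.
rewrite invfM expRN invrK; congr (_ * _^-1).
have vt : root (vk k) ((tk k)%:C)%C.
  by rewrite /stage_v -qpol_vpol rootM root_factor// gt_eqF.
rewrite gpoly_next /stage_f 2!mulrA derivM hornerD !hornerM (rootP vt) mulr0 add0r.
rewrite /stage_v vpolE deriv_binom hornerX !ncM !nc_real normrN !ger0_norm ?exprn_ge0 ?invr_ge0 ?(ltW t0)//.
have -> : nc (uk k).[((tk k)%:C)%C] = 1 + rhok k * tk k ^+ (k ^ 2 - d).
  rewrite hornerD hornerC horner_rX.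
  have -> : 1 + ((rhok k)%:C * (tk k)%:C ^+ (k ^ 2 - d))%C =
      ((1 + rhok k * tk k ^+ (k ^ 2 - d))%:C)%C.
    by rewrite [in RHS]rmorphD [in RHS]rmorphM; congr (_ + _ * _); rewrite ?rmorph1 ?rmorphXn.
  by rewrite nc_real ger0_norm// addr_ge0// mulr_ge0 ?exprn_ge0 ?ltW.
have -> : nc (((tk k)%:C)%C ^+ (2 * k).-1 *+ (2 * k)) = tk k ^+ (2 * k).-1 * (2 * k)%:R.
  rewrite -mulr_natr ncM ncX nc_real ger0_norm ?(ltW t0)//; congr (_ * _).
  have -> : (2 * k)%:R = (((2 * k)%:R)%:C)%C :> R[i] by rewrite rmorph_nat.
  by rewrite nc_real ger0_norm.
have -> : tk k ^+ (2 * k).-1 = tk k ^+ (2 * k) / tk k.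
  by rewrite -[in RHS](prednK k2) exprSr mulfK// gt_eqF.
rewrite exprVn natrM; set U := 1 + _; set T := tk k ^+ (2 * k).
have T0 : 0 < T by exact: exprn_gt0.
by move: U => U; move: T T0 => T T0; field; rewrite !gt_eqF.
Qed.

Lemma near_func_step : \forall k \near \oo,
  nrm (fun s => func (next_state k) s - func st s) <= 2 * Num.sqrt c0 * tau.
Proof.
pose W := \sum_(t <- 0 :: poss st) nc (fcoef st t) + 1.
pose B := \sum_(t <- 0 :: poss st) `|t| + 1.
have W0 : 0 < W by rewrite ltr_wpDl// sumr_ge0// => t _; exact: nc_ge0.
have B1 : 1 <= B by rewrite lerDr sumr_ge0.
have e1 : 0 < tau / (2 * W) by rewrite divr_gt0// mulr_gt0.
near=> k.
have win : window d k by near: k; exact: near_window.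
have [_ p1] : pnorm B (sk k - 1) <= 2^-1 /\ pnorm B (fk k - 1) <= 2^-1.
  by near: k; apply: near_factors_small.
have [_ p2] : pnorm B (sk k - 1) <= tau / (2 * W) /\ pnorm B (fk k - 1) <= tau / (2 * W).
  by near: k; apply: near_factors_small.
have new : nc (fcoef (next_state k) (tk k)) <= tau.
  by rewrite nc_fcoef_new//; near: k; exact: near_new_node.
have tB t : t \in 0 :: poss st -> nc ((t%:C)%C) <= B.
  move=> tp; rewrite nc_real /B (big_rem t tp) /= -addrA lerDl addr_ge0// sumr_ge0// => u _.
have fn0 t : t \in 0 :: poss st -> 2^-1 <= nc (fk k).[((t%:C)%C)].
  by move=> /tB tb; exact: near1_neq0 (horner_near1 tb p1).
have fs t : t \in 0 :: poss st -> nc ((fk k).[((t%:C)%C)] - 1) <= tau / (2 * W).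
  by move=> /tB tb; exact: horner_near1 tb p2.
(* The new atom has a small coefficient; each old coefficient is divided by f(t), close to 1 because
   the old nodes lie in a fixed disc. *)
have fE : (fun s => func (next_state k) s - func st s) = (fun s =>
    fcoef (next_state k) (tk k) * gabor (tk k, 0) s +
    \sum_(t <- 0 :: poss st) (fcoef (next_state k) t - fcoef st t) * gabor (t, 0) s).
  apply/funext => s; rewrite /func !big_cons /=.
  under [X in _ = _ + (_ + X)]eq_bigr do rewrite mulrBl.
  by rewrite sumrB; ring.
rewrite fE; apply: (le_trans (nrmD _ _)).
- by apply: L2Z; exact: L2_gabor.
- by apply: L2_sum => t _; apply: L2Z; exact: L2_gabor.
have -> : 2 * Num.sqrt c0 * tau = tau * Num.sqrt c0 + tau * Num.sqrt c0 by ring.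
have cn : 0 <= Num.sqrt c0 :> R by exact: sqrtr_ge0.
apply: lerD.
  rewrite nrmZ; last exact: L2_gabor.
  by apply: ler_pM; rewrite ?nc_ge0 ?nrm_ge0 ?nrm_gabor.
apply: (le_trans (nrm_sum _ _)) => [t|]; first by apply: L2Z; exact: L2_gabor.
apply: (@le_trans _ _ (\sum_(t <- 0 :: poss st) nc (fcoef st t) * (tau / W * Num.sqrt c0))).
  rewrite [leLHS]big_seq [leRHS]big_seq; apply: ler_sum => t tp.
  rewrite nrmZ; last exact: L2_gabor.
  rewrite mulrA; apply: ler_pM; rewrite ?nc_ge0 ?nrm_ge0 ?nrm_gabor//.
  have f1 := fn0 _ tp; have f2 := fs _ tp.
  have f0 : 0 < nc (fk k).[((t%:C)%C)] by apply: lt_le_trans f1; rewrite invr_gt0.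
  rewrite fcoef_next -?nc_gt0//.
  have -> : fcoef st t / (fk k).[((t%:C)%C)] - fcoef st t =
      fcoef st t * (- (((fk k).[((t%:C)%C)] - 1) / (fk k).[((t%:C)%C)])).
    by field; rewrite -nc_gt0.
  rewrite ncM; apply: ler_wpM2l; first exact: nc_ge0.
  rewrite ncN ncM ncV ler_pdivrMr//; apply: (le_trans f2).
  have -> : tau / (2 * W) = tau / W * 2^-1 by field; rewrite gt_eqF.
  by apply: ler_wpM2l => //; rewrite divr_ge0 ?ltW.
rewrite -mulr_suml.
apply: (@le_trans _ _ (W * (tau / W * Num.sqrt c0))).
  apply: ler_wpM2r; first by rewrite mulr_ge0// divr_ge0 ?ltW.
  by rewrite lerDl.
by rewrite mulrA [W * _]mulrC divfK ?gt_eqF.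
Unshelve. all: end_near. Qed.

End next_stage.

End stages.

(** * The sequence of stages and the exact identities of one stage *)

Section construction.
Context {R : realType}.
Local Notation nc := (@Normc.normc R).
Local Notation state := (@state R).
Implicit Types (p q g P Q S : {poly R[i]}) (z : R[i]) (st : state).

Definition step_const : R := (4 * expR 3 + 1) / Num.sqrt c0 + 2 * Num.sqrt c0 + 1.

(** [step_new] drives the new zeros out of every disc, whence discreteness; the geometric bounds on
    g, the duals and [func] give limits in norm. *)
Record Step (K : nat) st st' : Prop := {
  step_core : core st %| core st';
  step_S : Spoly st %| Spoly st';
  step_negs : {subset negs st <= negs st'};
  step_new : forall z, root (Spoly st') z -> root (Spoly st) z \/ K%:R < nc z;
  step_g : nrm (fun s => bg (gpoly st') s - bg (gpoly st) s) <= step_const * 2^-1 ^+ K;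
  step_dual : forall z, root (Spoly st) z ->
    nrm (fun s => bg (dual st' z) s - bg (dual st z) s) <= 2^-1 ^+ K;
  step_func : nrm (fun s => func st' s - func st s) <= step_const * 2^-1 ^+ K;
  step_phi : forall m, (m <= K)%N ->
    exists2 v, lin_span ((@gabor R) @` [set p | root (Spoly st') (cpx p)]) v &
      nrm (fun s => phi m s - v s) <= 9 / 2 * Num.sqrt c0 * (3 / 4) ^+ K }.

(** Each requirement holds for all large k, so one k meets them all. *)
Lemma step_exists K st : admissible K st -> exists st', admissible K.+1 st' /\ Step K st st'.
Proof.
move=> H.
have h0 := near_admissible H K%:R; have h1 := near_gpoly_step H; have h2 := near_phi_step H.
have h3 := near_dual_step H; have h4 := near_func_step H.
have [k [k0 [k1 [k2 [k3 k4]]]]] := filter_ex (filterI h0 (filterI h1 (filterI h2 (filterI h3 h4)))).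
have [Hk new] := k0.
have cn : 0 <= Num.sqrt c0 :> R by exact: sqrtr_ge0.
have t0 : 0 <= 2^-1 ^+ K :> R by rewrite exprn_ge0.
have e0 : 0 <= (4 * expR 3 + 1) / Num.sqrt c0 :> R.
  by rewrite divr_ge0// addr_ge0// mulr_ge0// expR_ge0.
exists (next_state K st k); split=> //; split.
- by rewrite /= -mulrA dvdp_mulIl.
- by rewrite Spoly_next dvdp_mulIl.
- by move=> x /=; rewrite inE orbC => ->.
- exact: new.
- apply: (le_trans k1); apply: ler_wpM2r => //.
  by rewrite /step_const -addrA lerDl addr_ge0// mulr_ge0.
- exact: k3.
- apply: (le_trans k4); apply: ler_wpM2r => //.
  by rewrite /step_const addrAC lerDr addr_ge0.
- exact: k2.
Qed.

Definition state0 : state := State 1 [::] [::].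

Lemma admissible0 : admissible 0 state0.
Proof.
split; rewrite /Spoly /gpoly /= ?big_nil ?mulr1//.
- by rewrite separable_poly.unlock coprime1p.
- by rewrite separable_poly.unlock derivX coprimep1.
- by rewrite expr0 mul1r.
- by rewrite pnorm1 expr0.
Qed.

Lemma stages_exist : exists st : nat -> state,
  forall K, admissible K (st K) /\ Step K (st K) (st K.+1).
Proof.
pose P (x : nat * state) st' := admissible x.1 x.2 -> admissible x.1.+1 st' /\ Step x.1 x.2 st'.
have [F hF] : {F : nat * state -> state & forall x, P x (F x)}.
  apply: (@choice _ _ P) => x; have [H|nH] := pselect (admissible x.1 x.2).
    by have [st' h] := step_exists H; exists st'.
  (* A default for inputs that are not admissible, which the sequence never meets. *)
  by exists state0.
pose st := fix st K : state := if K is K'.+1 then F (K', st K') else state0.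
have H K : admissible K (st K).
  elim: K => [|K ih]; first exact: admissible0.
  by have [] := hF (K, st K) ih.
by exists st => K; split=> //; have [] := hF (K, st K) (H K).
Qed.

Lemma horner_dual st z K : admissible K st -> root (Spoly st) z ->
  omega (pt z) * (dual st z).[z] = 1.
Proof.
move=> H Sz; have S' : (Spoly st)^`().[z] != 0.
  by apply: coprimep_root Sz; have := adm_sepS H; rewrite separable_poly.unlock.
rewrite /dual hornerZ; set Q := Spoly st %/ _.
have SQ : Spoly st = Q * ('X - z%:P) by rewrite divpK// dvdp_XsubCl.
have -> : (Spoly st)^`().[z] = Q.[z].
  by rewrite SQ derivM derivXsubC mulr1 hornerD hornerM hornerXsubC subrr mulr0 add0r.
have Q0 : Q.[z] != 0.
  by move: S'; rewrite SQ derivM derivXsubC mulr1 hornerD hornerM hornerXsubC subrr mulr0 add0r.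
have o0 := omega_neq0 (pt z); move: (omega _) o0 => o o0.
by rewrite mulrCA invfM mulrACA; field; apply/andP.
Qed.

Lemma horner_dual0 st z w : root (Spoly st) z -> root (Spoly st) w -> w != z -> (dual st z).[w] = 0.
Proof.
move=> Sz Sw wz; rewrite /dual hornerZ; set Q := Spoly st %/ _.
have SQ : Spoly st = Q * ('X - z%:P) by rewrite divpK// dvdp_XsubCl.
move: Sw; rewrite SQ rootM root_XsubC (negbTE wz) orbF => /rootP ->.
by rewrite mulr0.
Qed.

Lemma cpx_real (t : R) : cpx (t, 0) = (t%:C)%C. Proof. by []. Qed.

Lemma inner_func_bg st p : inner (func st) (bg p) =
  \sum_(t <- 0 :: poss st) p.[(t%:C)%C] / ('X * gpoly st)^`().[(t%:C)%C].
Proof.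
rewrite /func inner_suml; [|exact: L2_bg|by move=> t; apply: L2Z; exact: L2_gabor].
apply: eq_bigr => t _; rewrite innerZl; [|exact: L2_gabor|exact: L2_bg].
rewrite inner_gabor_bg cpx_real /fcoef invfM mulrACA mulVf ?omega_neq0// mul1r.
by rewrite mulrC.
Qed.

Lemma L2_func st : L2 (func st).
Proof. by apply: L2_sum => t _; apply: L2Z; exact: L2_gabor. Qed.

(** g vanishes at every node except 0, where the derivative of X g is g(0). *)
Lemma inner_func_gpoly K st : admissible K st -> inner (func st) (bg (gpoly st)) = 1.
Proof.
move=> H; rewrite inner_func_bg big_cons big_seq big1 => [|t tp]; last first.
  have /rootP -> : root (gpoly st) (t%:C)%C; last by rewrite mul0r.
  rewrite /gpoly rootM; apply/orP; right.
  rewrite rootE horner_prod prodf_seq_eq0; apply/hasP; exists t => //=.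
  rewrite -[_ == _]/(root _ _) root_factor// gt_eqF//.
  by have /allP := adm_pos H; apply.
have X0 : root ('X * gpoly st) 0 by rewrite rootM rootE hornerX eqxx.
have : ('X * gpoly st)^`().[0] != 0.
  by apply: coprimep_root X0; have := adm_sepG H; rewrite separable_poly.unlock.
have z0 : ((0%:C)%C : R[i]) = 0 by rewrite rmorph0.
rewrite addr0 z0 derivM derivX mul1r hornerD [('X * _).[_]]hornerM hornerX mul0r addr0 => g0.
by rewrite divff.
Qed.

Lemma root_Spoly K st z : admissible K st -> root (Spoly st) z ->
  root (core st) z \/ exists2 x, x \in negs st & z = ((- x)%:C)%C.
Proof.
move=> H; rewrite rootM => /orP[|]; first by left.
rewrite rootE horner_prod prodf_seq_eq0 => /hasP[x xs /= hx]; right; exists x => //.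
have x0 : 0 < x by have /allP := adm_neg H; apply.
move: hx; rewrite hornerD hornerC horner_rX expr1 addrC addr_eq0 => /eqP h.
have xc : ((x%:C)%C : R[i]) != 0 by rewrite realC_neq0// gt_eqF.
have xi : ((x^-1)%:C)%C = ((x%:C)%C)^-1 :> R[i] by rewrite fmorphV.
rewrite rmorphN; apply: (mulfI (invr_neq0 xc)).
by rewrite -xi h mulrN xi mulVf.
Qed.

Lemma size_prod_lpol (s : seq R) : (size (\prod_(x <- s) lpol x)%R <= (size s).+1)%N.
Proof.
elim: s => [|x s ih]; first by rewrite big_nil size_poly1.
by rewrite big_cons; apply: leq_trans (size_mul_bound (size_lpol_le _) ih) _; rewrite add1n.
Qed.

(* Lagrange's identity at the nodes 0 and [poss st]: the node [- x] lowers the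
   degree of the numerator below the critical one. *)
Lemma inner_func_dual K st x : admissible K st -> x \in negs st ->
  inner (func st) (bg (dual st ((- x)%:C)%C)) = 0.
Proof.
move=> H xs; have x0 : 0 < x by have /allP := adm_neg H; apply.
rewrite inner_func_bg /dual.
set c := _^-1; set z := ((- x)%:C)%C.
pose Q := \prod_(y <- rem x (negs st)) lpol y.
have SQ : Spoly st = (x^-1%:C)%C *: (core st * Q) * ('X - z%:P).
  rewrite /Spoly (big_rem x xs) /= -/Q.
  have -> : lpol x = (x^-1%:C)%C *: ('X - z%:P).
    rewrite /lpol /rX expr1 scalerBr -[in RHS](mulr1 z%:P) mul_polyC scalerA /z rmorphN mulrN.
    by rewrite -rmorphM mulVf ?gt_eqF// scaleN1r opprK addrC.
  by rewrite -!scalerAl -!scalerAr; congr (_ *: _); ring.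
rewrite SQ mulpK ?polyXsubC_eq0//.
pose nodes := [seq (t%:C)%C | t <- 0 :: poss st].
pose C := 'X * \prod_(t <- poss st) (1 - rX t^-1 1) : {poly R[i]}.
have XgC : 'X * gpoly st = core st * C by rewrite /gpoly /C; ring.
have unodes : uniq nodes by rewrite map_inj_uniq; [exact: adm_uniq H|move=> a b [] ].
have [a a0 Ca] : exists2 a : R[i], a != 0 & C = a *: \prod_(y <- nodes) ('X - y%:P).
  rewrite /C /nodes map_cons big_cons subr0.
  have := adm_pos H; elim: (poss st) => [|t l ih] /=.
    by move=> _; exists 1; rewrite ?oner_eq0// !big_nil scale1r.
  move=> /andP[t0 /ih[a a0 e]]; exists (- (t^-1%:C)%C * a).
    by rewrite mulf_neq0// oppr_eq0 realC_neq0// invr_neq0// gt_eqF.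
  rewrite !big_cons mulrCA e.
  have -> : 1 - rX t^-1 1 = - (t^-1%:C)%C *: ('X - ((t%:C)%C)%:P).
    rewrite /rX expr1 scalerBr scaleNr addrC -[in RHS](mulr1 ((t%:C)%C)%:P) mul_polyC scalerA.
    by rewrite mulNr -rmorphM mulVf ?gt_eqF// scaleN1r opprK.
  by rewrite -!scalerAl -!scalerAr scalerA; congr (_ *: _); ring.
(* The nodes are zeros of [C], so the derivative of X g there is the core times C', and the core
   cancels. What remains is a Lagrange sum for [Q], whose size is below the number of nodes. *)
transitivity (\sum_(t <- 0 :: poss st) (c * (x^-1%:C)%C / a) *
   (Q.[(t%:C)%C] / (\prod_(y <- nodes) ('X - y%:P))^`().[(t%:C)%C])).
  rewrite big_seq [RHS]big_seq; apply: eq_bigr => t tp.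
  have tn : (t%:C)%C \in nodes by rewrite map_f.
  have Ct : C.[(t%:C)%C] = 0.
    by rewrite Ca hornerZ (rootP (_ : root _ _)) ?mulr0// root_prod_XsubC.
  have rt : root ('X * gpoly st) (t%:C)%C by rewrite XgC rootM [root C _]rootE Ct eqxx orbT.
  have : ('X * gpoly st)^`().[(t%:C)%C] != 0.
    by apply: coprimep_root rt; have := adm_sepG H; rewrite separable_poly.unlock.
  rewrite XgC derivM hornerD [((core st)^`() * C).[_]]hornerM [(core st * _).[_]]hornerM Ct mulr0 add0r.
  rewrite Ca derivZ !hornerZ [(core st * Q).[_]]hornerM.
  rewrite mulf_eq0 negb_or mulf_eq0 negb_or => /and3P[h1 _ h2].
  by field; rewrite h1 h2 a0 realC_neq0 ?gt_eqF.
rewrite -mulr_sumr -(big_map (fun t => (t%:C)%C) xpredT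
  (fun y => Q.[y] / (\prod_(y <- nodes) ('X - y%:P))^`().[y])).
rewrite lagrange_sum0 ?mulr0//.
rewrite size_map /= (adm_len H) ltnS; apply: (leq_trans (size_prod_lpol _)).
by rewrite size_rem// prednK//; case: (negs st) xs.
Qed.

End construction.

(** * The limit system *)

Section limits.
Context {R : realType}.
Implicit Types (p q g P Q S : {poly R[i]}) (z : R[i]).

(** The start [K0] is for the dual functions, which are controlled only from the stage at which
    their zero appears. *)
Lemma L2_limit (u : nat -> R -> R[i]) (K0 : nat) (C : R) : (forall n, L2 (u n)) ->
  (forall n, (K0 <= n)%N -> nrm (fun s => u n.+1 s - u n s) <= C * 2^-1 ^+ n) ->
  exists f, L2 f /\ exists C', forall n, (K0 <= n)%N -> nrm (fun s => f s - u n s) <= C' * 2^-1 ^+ n.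
Proof.
move=> Lu hu.
have [f [Lf hf]] : exists f, L2 f /\ forall n,
    nrm (fun s => f s - u (n + K0)%N s) <= (C * 2^-1 ^+ K0) * 2 * 2^-1 ^+ n.
  apply: (@L2_complete _ (fun n => u (n + K0)%N)) => // n.
  by rewrite addSn -mulrA -exprD [(K0 + n)%N]addnC; apply: hu; exact: leq_addl.
exists f; split=> //; exists (C * 2) => n Kn.
have := hf (n - K0)%N; rewrite subnK// => /le_trans; apply.
have -> : 2^-1 ^+ n = 2^-1 ^+ K0 * 2^-1 ^+ (n - K0) :> R by rewrite -exprD subnKC.
set A := _ ^+ K0; set B := _ ^+ (n - K0); move: A B => A B.
by rewrite le_eqVlt; apply/orP; left; apply/eqP; ring.
Qed.

Lemma inner_limit (f g : R -> R[i]) (u v : nat -> R -> R[i]) (C C' : R) (K0 : nat) (a : R[i]) :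
  L2 f -> L2 g -> (forall n, L2 (u n)) -> (forall n, L2 (v n)) ->
  (forall n, (K0 <= n)%N -> nrm (fun s => f s - u n s) <= C * 2^-1 ^+ n) ->
  (forall n, (K0 <= n)%N -> nrm (fun s => g s - v n s) <= C' * 2^-1 ^+ n) ->
  (forall n, (K0 <= n)%N -> inner (u n) (v n) = a) -> inner f g = a.
Proof.
move=> Lf Lg Lu Lv hu hv ha.
have C0 : 0 <= C by have := le_trans (nrm_ge0 _) (hu _ (leqnn _)); rewrite pmulr_lge0// exprn_gt0.
have C'0 : 0 <= C' by have := le_trans (nrm_ge0 _) (hv _ (leqnn _)); rewrite pmulr_lge0// exprn_gt0.
apply/eqP; rewrite -subr_eq0 -nc_eq0 eq_le nc_ge0 andbT.
apply: (@le_half _ _ _ (C * nrm g + (nrm f + C) * C')) => n; rewrite add0r.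
set N := (n + K0)%N.
have KN : (K0 <= N)%N by exact: leq_addl.
have Lfu : L2 (fun s => f s - u N s) by exact: L2B.
have Lgv : L2 (fun s => g s - v N s) by exact: L2B.
have e1 : inner f g = inner (fun s => f s - u N s) g + inner (u N) g.
  by rewrite -innerDl//; congr inner; apply/funext => s; rewrite subrK.
have e2 : inner (u N) g = inner (u N) (fun s => g s - v N s) + inner (u N) (v N).
  by rewrite -innerDr//; congr inner; apply/funext => s; rewrite subrK.
rewrite e1 e2 ha// addrA addrK; apply: (le_trans (ncD _ _)); rewrite mulrDl.
have half1 : 2^-1 ^+ N <= 2^-1 ^+ n :> R.
  by apply: ler_wiXn2l; rewrite ?invr_ge0 ?invf_le1 ?ler1n ?leq_addr.
have h0 : 0 <= 2^-1 ^+ n :> R by rewrite exprn_ge0.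
have half2 : 2^-1 ^+ n <= 1 :> R by rewrite exprn_ile1// invf_le1 ?ler1n.
have hu' := le_trans (hu N KN) (ler_wpM2l C0 half1).
have hv' := le_trans (hv N KN) (ler_wpM2l C'0 half1).
apply: lerD.
  apply: (le_trans (inner_le Lfu Lg)); rewrite mulrAC; apply: ler_wpM2r => //; exact: nrm_ge0.
apply: (le_trans (inner_le (Lu N) Lgv)); rewrite -mulrA.
apply: ler_pM; rewrite ?nrm_ge0//.
have -> : u N = (fun s => f s - (f s - u N s)) by apply/funext => s; rewrite subKr.
apply: (le_trans (nrmB Lf Lfu)); rewrite lerD2l; apply: (le_trans hu').
by rewrite -[leRHS]mulr1; apply: ler_wpM2l.
Qed.

End limits.

Section final.
Context {R : realType}.
Local Notation nc := (@Normc.normc R).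
Implicit Types (p q g P Q S : {poly R[i]}) (z : R[i]).

Lemma nc_cpx_le (p : R * R) : nc (cpx p) <= `|p.1| + `|p.2|.
Proof.
rewrite -(@ler_pXn2r _ 2)// ?nnegrE ?nc_ge0 ?addr_ge0// nc_sq /sq /= sqrrD !real_normK ?num_real//.
by rewrite addrAC lerDl mulrn_wge0// mulr_ge0.
Qed.

(** The bound [e <= 1] keeps the box in a disc known in advance, so that the finite list of zeros
    can be fixed before the box. *)
Lemma isolating_box (l : seq R[i]) (a : R * R) : exists2 e : R, 0 < e <= 1 &
  forall p : R * R, cpx p \in l -> p != a -> ~ (`|a.1 - p.1| < e /\ `|a.2 - p.2| < e).
Proof.
elim: l => [|z l [e /andP[e0 e1] he]]; first by exists 1; rewrite ?ltr01 ?lexx.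
have [za|za] := eqVneq (pt z) a.
  exists e; rewrite ?e0// => p; rewrite inE => /predU1P[pz|]; last exact: he.
  by move=> /eqP; rewrite -za -pz cpxK.
pose m := Num.max `|a.1 - (pt z).1| `|a.2 - (pt z).2|.
have m0 : 0 < m.
  rewrite lt_max !normr_gt0 !subr_eq0 -negb_and; apply: contra za => /andP[/eqP h1 /eqP h2].
  by rewrite (surjective_pairing (pt z)) -h1 -h2 -surjective_pairing.
exists (Num.min e m); first by rewrite lt_min e0 m0 ge_min e1.
move=> p; rewrite inE => /predU1P[pz _ []|pl pa []].
  rewrite !lt_min => /andP[_ h1] /andP[_ h2]; have := ltxx m.
  by rewrite {1}/m gt_max -pz cpxK h1 h2.
by rewrite !lt_min => /andP[h1 _] /andP[h2 _]; exact: (he p pl pa).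
Qed.

Section system.
Context (st : nat -> @state R)
  (adm : forall K, admissible K (st K)) (hst : forall K, Step K (st K) (st K.+1)).

Lemma root_dvdp p q z : p %| q -> root p z -> root q z.
Proof. by move=> /dvdpP[c ->] h; rewrite rootM h orbT. Qed.

Definition index_set : set (R * R) := [set p | exists K, root (Spoly (st K)) (cpx p)].

Lemma core_dvd K L : (K <= L)%N -> core (st K) %| core (st L).
Proof.
move=> /subnKC <-; elim: (L - K)%N => [|n ih]; first by rewrite addn0.
by rewrite addnS; exact: dvdp_trans ih (step_core (hst _)).
Qed.

Lemma Spoly_dvd K L : (K <= L)%N -> Spoly (st K) %| Spoly (st L).
Proof.
move=> /subnKC <-; elim: (L - K)%N => [|n ih]; first by rewrite addn0.
by rewrite addnS; exact: dvdp_trans ih (step_S (hst _)).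
Qed.

Lemma negs_sub K L : (K <= L)%N -> {subset negs (st K) <= negs (st L)}.
Proof.
move=> /subnKC <-; elim: (L - K)%N => [|n ih] x; first by rewrite addn0.
by rewrite addnS => /ih; exact: (step_negs (hst _)).
Qed.

Lemma root_mono K L z : (K <= L)%N -> root (Spoly (st K)) z -> root (Spoly (st L)) z.
Proof. by move=> KL; apply: root_dvdp; exact: Spoly_dvd. Qed.

(** Zeros added from stage K on have modulus above K, so a bounded region sees only the zeros of one
    polynomial. *)
Lemma root_small K L z : nc z <= K%:R -> root (Spoly (st L)) z -> root (Spoly (st K)) z.
Proof.
move=> zK; have [LK|KL] := leqP L K; first exact: root_mono.
rewrite -(subnKC (ltnW KL)); elim: (L - K)%N => [|n ih]; first by rewrite addn0.
rewrite addnS => /(step_new (hst _)) [|h]; first exact: ih.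
by move: (lt_le_trans h zK); rewrite ltr_nat ltnNge leq_addr.
Qed.

Lemma discrete_index_set : discrete_set index_set.
Proof.
rewrite /discrete_set; apply/seteqP; split=> // a /= la.
pose M := `|a.1| + `|a.2| + 2.
have [K MK] := filter_ex (near_geR M).
have [l [_ Sl _]] := separable_roots (separable_poly_neq0 (adm_sepS (adm K))) (adm_sepS (adm K)).
have [e /andP[e0 e1] he] := isolating_box l a.
have [y [ya [L Ly] [y1 y2]]] := la _ (nbhsx_ballx a e e0).
have yK : nc (cpx y) <= K%:R.
  apply: le_trans MK; apply: (le_trans (nc_cpx_le _)).
  have h1 := ler_distD a.1 y.1 0; have h2 := ler_distD a.2 y.2 0.
  move: y1 y2; rewrite /ball /= => y1 y2.
  rewrite !subr0 in h1 h2; rewrite [`|y.1 - _|]distrC in h1; rewrite [`|y.2 - _|]distrC in h2.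
  rewrite /M; move: (lt_le_trans y1 e1) (lt_le_trans y2 e1) h1 h2; lra.
have := root_small yK Ly.
rewrite Sl rootZ ?lead_coef_eq0 ?(separable_poly_neq0 (adm_sepS (adm K)))// root_prod_XsubC => yl.
exact: (he y yl ya).
Qed.

Lemma dual_limit (p : R * R) : index_set p -> exists h, L2 h /\ exists C K0,
  root (Spoly (st K0)) (cpx p) /\
  forall K, (K0 <= K)%N -> nrm (fun s => h s - bg (dual (st K) (cpx p)) s) <= C * 2^-1 ^+ K.
Proof.
move=> [K0 rK0].
have [h [Lh [C hC]]] : exists h, L2 h /\ exists C', forall n, (K0 <= n)%N ->
    nrm (fun s => h s - bg (dual (st n) (cpx p)) s) <= C' * 2^-1 ^+ n.
  apply: (@L2_limit _ (fun n => bg (dual (st n) (cpx p))) K0 1) => [n|n Kn]; first exact: L2_bg.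
  by rewrite mul1r; apply: (step_dual (hst n)); exact: root_mono rK0.
by exists h; split=> //; exists C, K0.
Qed.

(** From the stage on at which both points are zeros the pairing already has its final value. *)
Lemma biorthogonal_limit (p q : R * R) (h : R -> R[i]) (C : R) K0 : L2 h -> root (Spoly (st K0)) (cpx p) ->
  (forall K, (K0 <= K)%N -> nrm (fun s => h s - bg (dual (st K) (cpx p)) s) <= C * 2^-1 ^+ K) ->
  index_set q -> inner (gabor q) h = (q == p)%:R.
Proof.
move=> Lh rp hC [K1 rq].
apply: (@inner_limit _ _ _ (fun=> gabor q) (fun n => bg (dual (st n) (cpx p))) 0 C (maxn K0 K1)) => //.
- exact: L2_gabor.
- by move=> _; exact: L2_gabor.
- by move=> n; exact: L2_bg.
- move=> n _; rewrite mul0r (_ : (fun s => _) = (fun=> 0)) ?nrm0//.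
  by apply/funext => s; rewrite subrr.
- by move=> n; rewrite geq_max => /andP[Kn _]; exact: hC.
- move=> n; rewrite geq_max => /andP[K0n K1n]; rewrite inner_gabor_bg.
  have rpn := root_mono K0n rp; have rqn := root_mono K1n rq.
  have [->|qp] := eqVneq q p; first by rewrite -{1}(cpxK p); exact: (horner_dual (adm n)).
  rewrite horner_dual0 ?mulr0//; apply: contra qp => /eqP e.
  by rewrite -(cpxK q) e cpxK.
Qed.

Lemma phi_in_span m : closed_span ((@gabor R) @` index_set) (phi m).
Proof.
have SL : (@gabor R) @` index_set `<=` L2 by move=> _ [p _ <-]; exact: L2_gabor.
apply/(closed_spanP _ SL); split; first exact: L2_phi.
move=> e e0.
pose C : R := 9 / 2 * Num.sqrt c0.
have C0 : 0 < C by rewrite mulr_gt0// sqrtr_gt0 c0_gt0.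
have small : \forall K \near \oo, C * (3 / 4) ^+ K < e.
  have q0 : geometric C (3 / 4) @ \oo --> (0 : R).
    by apply: cvg_geometric; rewrite ger0_norm//; lra.
  exact: (cvgr_lt _ q0).
have [K [mK hK]] := filter_ex (filterI (nbhs_infty_ge m) small).
have [v [n [c [w [Sw vE]]]] hv] := step_phi (hst K) mK.
exists v; last exact: le_lt_trans hv hK.
exists n, c, w; split=> // i; have [p hp <-] := Sw i.
by exists p => //; exists K.+1.
Qed.

Lemma complete_index_set : complete_system index_set (@gabor R).
Proof.
have SL : (@gabor R) @` index_set `<=` L2 by move=> _ [p _ <-]; exact: L2_gabor.
apply: gabor_span_sub => // p.
have [Lg [C C0 hC]] := gabor_approx p.
apply: closed_span_lim => // e e0.
have [N hN] := filter_ex (cvgr_lt _ (cvg_half C) _ e0).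
exists (gabor_part p N); last exact: le_lt_trans (hC N) hN.
elim: N {hN} => [|N ih].
  rewrite /gabor_part /phi_sum (_ : (fun s => _) = (fun=> 0)); last first.
    by apply/funext => s; rewrite big_nil.
  by apply: lin_span_closed => //; exact: lin_span0.
rewrite /gabor_part phi_sumS; apply: closed_spanD => //.
by apply: closed_spanZ => //; exact: phi_in_span.
Qed.

Lemma minimal_index_set : minimal_system index_set (@gabor R).
Proof.
move=> p Lp hp; have [h [Lh [C [K0 [rp hC]]]]] := dual_limit Lp.
have : inner (gabor p) h = 0.
  apply: closed_span_ortho hp => //.
    by move=> _ [q _ <-]; exact: L2_gabor.
  move=> _ [q [Lq qp] <-]; rewrite (biorthogonal_limit Lh rp hC)//.
  by rewrite (_ : (q == p) = false)//; apply/eqP => e; apply: qp; rewrite e.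
by rewrite (biorthogonal_limit Lh rp hC)// eqxx => /eqP; rewrite oner_eq0.
Qed.

Lemma not_strong : ~ strong_Markushevich_basis index_set (@gabor R).
Proof.
move=> [_ _ strong].
pose P (p : R * R) (f : R -> R[i]) := index_set p -> L2 f /\ exists C K0,
  root (Spoly (st K0)) (cpx p) /\
  forall K, (K0 <= K)%N -> nrm (fun s => f s - bg (dual (st K) (cpx p)) s) <= C * 2^-1 ^+ K.
have [h hh] : {h : R * R -> R -> R[i] & forall p : R * R, P p (h p)}.
  apply: choice => p; have [Lp|nLp] := pselect (index_set p).
    by have [f Hf] := dual_limit Lp; exists f.
  by exists (fun=> 0).
have bi : biorthogonal index_set (@gabor R) h.
  split=> [p /hh[]//|p q Lp Lq].
  by have [Lh [C [K0 [rq hC]]]] := hh q Lq; exact: (biorthogonal_limit Lh rq hC).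
have [F [LF [CF hF]]] := @L2_limit _ (fun K => func (st K)) 0 _ (fun K => L2_func _)
  (fun K _ => step_func (hst K)).
have [G [LG [CG hG]]] := @L2_limit _ (fun K => bg (gpoly (st K))) 0 _ (fun K => L2_bg _)
  (fun K _ => step_g (hst K)).
have FG : inner F G = 1.
  apply: (inner_limit LF LG (fun K => L2_func _) (fun K => L2_bg _) hF hG) => K _.
  exact: inner_func_gpoly (adm K).
suff : inner F G = 0 by rewrite FG => /eqP; rewrite oner_eq0.
have := strong h bi F LF; apply: closed_span_ortho => //.
  by move=> _ [p _ <-]; apply: L2Z; exact: L2_gabor.
move=> _ [p Lp <-]; rewrite innerZl//; last exact: L2_gabor.
have [K rK] := Lp; have [Lh [C [K0 [rp hC]]]] := hh p Lp.
(* One factor of (F, h_p) (e_p, G) vanishes: the second at a zero of the core, the first at a point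
   - x. *)
have [rc|[x xs px]] := root_Spoly (adm K) rK.
  rewrite (_ : inner (gabor p) G = 0) ?mulr0//.
  apply: (@inner_limit _ _ _ (fun=> gabor p) (fun n => bg (gpoly (st n))) 0 CG K) => //.
  - exact: L2_gabor.
  - by move=> _; exact: L2_gabor.
  - by move=> n; exact: L2_bg.
  - move=> n _; rewrite mul0r (_ : (fun s => _) = (fun=> 0)) ?nrm0//.
    by apply/funext => s; rewrite subrr.
  - by move=> n _; exact: hG.
  - move=> n Kn; rewrite inner_gabor_bg (rootP (_ : root _ _)) ?mulr0//.
    by rewrite /gpoly rootM (root_dvdp (core_dvd Kn) rc).
rewrite (_ : inner F (h p) = 0) ?mul0r//.
apply: (@inner_limit _ _ _ (fun n => func (st n)) (fun n => bg (dual (st n) (cpx p))) CF C (maxn K K0)) => //.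
- by move=> n; exact: L2_func.
- by move=> n; exact: L2_bg.
- by move=> n _; exact: hF.
- by move=> n; rewrite geq_max => /andP[_]; exact: hC.
- move=> n; rewrite geq_max => /andP[Kn _]; rewrite px.
  exact: (inner_func_dual (adm n) (negs_sub Kn xs)).
Qed.

End system.
End final.

Theorem theorem1p1 (R : realType) :
  exists Lambda : set (R * R),
    [/\ discrete_set Lambda,
        complete_system Lambda gabor,
        minimal_system Lambda gabor &
        ~ strong_Markushevich_basis Lambda gabor].
Proof.
have [st hst] := @stages_exist R.
pose adm K := (hst K).1; pose step K := (hst K).2.
exists (index_set st); split.
- exact: discrete_index_set adm step.
- exact: complete_index_set step.
- exact: minimal_index_set adm step.
- exact: not_strong adm step.
Qed.
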